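(* Let $K\subseteq L\subseteq\mathcal A$ be differential fields of characteristic $0$, where $\mathcal A$ is a saturated differentially closed field with $|L|<|\mathcal A|$, and let $L/K$ be a strongly normal extension. Then $Gal(L/K)$ is isomorphic to a group interpretable in the field $C_{\mathcal A}$, where the interpretation is given by quantifier-free formulas of the language of rings with parameters from $C_K$; that is, there are $d\ge 1$, a subset $S\subseteq C_{\mathcal A}^d$, an equivalence relation $\sim$ on $S$ and a ternary relation $R$ on $S$, all defined in $C_{\mathcal A}$ by quantifier-free ring formulas with parameters from $C_K$, such that $R$ induces the graph of a group law on $S/\!\sim$ and $(S/\!\sim,R/\!\sim)$ is isomorphic to $(Gal(L/K),\circ)$.
   Context: For a differential field $F$, $C_F$ is its field of constants. $\langle A,B\rangle$ denotes the differential field generated by $A\cup B$ inside $\mathcal A$. $Hom_K(L,\mathcal A)$ is the set of differential field embeddings of $L$ into $\mathcal A$ fixing $K$ pointwise. An element $\tau\in Hom_K(L,\mathcal A)$ is strong if $\tau$ is the identity on $C_L$ and $\langle L,C_{\mathcal A}\rangle=\langle\tau(L),C_{\mathcal A}\rangle$. $L/K$ is strongly normal if $L$ is finitely generated as a differential field over $K$ and every $\tau\in Hom_K(L,\mathcal A)$ is strong. $Gal(L/K)$ is the group of differential field automorphisms of $\langle L,C_{\mathcal A}\rangle$ fixing $\langle K,C_{\mathcal A}\rangle$ pointwise. The field $C_K$ is not assumed algebraically closed. *)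

(* Defs.v *)
From mathcomp Require Import all_boot all_order all_algebra.
Set Implicit Arguments. Unset Strict Implicit. Unset Printing Implicit Defensive.
Import GRing.Theory.
Local Open Scope ring_scope.

Section DiffAlg.
Variable A : fieldType.
Variable D : A -> A.

Definition is_derivation : Prop :=
  (forall x y, D (x + y) = D x + D y) /\ (forall x y, D (x * y) = D x * y + x * D y).

Definition is_dsubfield (F : A -> Prop) : Prop :=
  ((F 0) /\
    (F 1) /\
    ((forall x y, F x -> F y -> F (x - y))) /\
    ((forall x y, F x -> F y -> F (x * y))) /\
    ((forall x, F x -> F x^-1)) /\
    ((forall x, F x -> F (D x)))).

Definition consts (F : A -> Prop) : A -> Prop := fun x => F x /\ D x = 0.
Definition CA : A -> Prop := fun x => D x = 0.

Definition dgen (S : A -> Prop) : A -> Prop :=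
  fun x => forall F, is_dsubfield F -> (forall y, S y -> F y) -> F x.

Definition sunion (S T : A -> Prop) : A -> Prop := fun x => S x \/ T x.
Definition img (f : A -> A) (S : A -> Prop) : A -> Prop :=
  fun y => exists2 x, S x & y = f x.

Definition dfin_gen (K L : A -> Prop) : Prop :=
  exists s : seq A, forall x, L x <-> dgen (sunion K (fun y => y \in s)) x.

Definition is_Hom (K L : A -> Prop) (tau : A -> A) : Prop :=
  (((forall x y, L x -> L y -> tau (x + y) = tau x + tau y)) /\
    ((forall x y, L x -> L y -> tau (x * y) = tau x * tau y)) /\
    (tau 1 = 1) /\
    ((forall x, L x -> tau (D x) = D (tau x))) /\
    ((forall x y, L x -> L y -> tau x = tau y -> x = y)) /\
    ((forall x, K x -> tau x = x))).

Definition is_strong (L : A -> Prop) (tau : A -> A) : Prop :=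
  (forall x, consts L x -> tau x = x) /\
  (forall x, dgen (sunion L CA) x <-> dgen (sunion (img tau L) CA) x).

Definition strongly_normal (K L : A -> Prop) : Prop :=
  dfin_gen K L /\ forall tau, is_Hom K L tau -> is_strong L tau.

(* Gal(L/K): differential field automorphisms of <L, C_A> fixing <K, C_A>
   pointwise (represented by functions A -> A, compared on <L, C_A>) *)
Definition is_gal (K L : A -> Prop) (s : A -> A) : Prop :=
  let M := dgen (sunion L CA) in
  let M0 := dgen (sunion K CA) in
  (((forall x, M x -> M (s x))) /\
    ((forall y, M y -> exists2 x, M x & s x = y)) /\
    ((forall x y, M x -> M y -> s x = s y -> x = y)) /\
    ((forall x y, M x -> M y -> s (x + y) = s x + s y)) /\
    ((forall x y, M x -> M y -> s (x * y) = s x * s y)) /\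
    (s 1 = 1) /\
    ((forall x, M x -> s (D x) = D (s x))) /\
    ((forall x, M0 x -> s x = x))).

Definition agree_on (M : A -> Prop) (f g : A -> A) : Prop :=
  forall x, M x -> f x = g x.

Definition card_lt (B C : A -> Prop) : Prop :=
  ~ exists f : A -> A, (forall x, C x -> B (f x)) /\
                       (forall x y, C x -> C y -> f x = f y -> x = y).

End DiffAlg.

Fixpoint all_list (T : Type) (P : T -> Prop) (s : seq T) : Prop :=
  match s with nil => True | cons x s' => P x /\ all_list P s' end.

Inductive dterm (R : Type) : Type :=
| DVar of nat | DConst of R | DZero | DOne
| DAdd of dterm R & dterm R | DOpp of dterm R | DMul of dterm R & dterm R
| DDer of dterm R.
Arguments DZero {R}. Arguments DOne {R}.

Inductive dformula (R : Type) : Type :=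
| DTrue | DFalse
| DEq of dterm R & dterm R
| DNot of dformula R | DAnd of dformula R & dformula R | DOr of dformula R & dformula R
| DEx of nat & dformula R | DAll of nat & dformula R.
Arguments DTrue {R}. Arguments DFalse {R}.

Fixpoint dmap (R S : Type) (f : R -> S) (t : dterm R) : dterm S :=
  match t with
  | DVar i => DVar S i | DConst c => DConst (f c) | DZero => DZero | DOne => DOne
  | DAdd u v => DAdd (dmap f u) (dmap f v) | DOpp u => DOpp (dmap f u)
  | DMul u v => DMul (dmap f u) (dmap f v) | DDer u => DDer (dmap f u)
  end.

Section DEval.
Variable B : fieldType.
Variable DB : B -> B.

Fixpoint deval (e : nat -> B) (t : dterm B) : B :=
  match t with
  | DVar i => e i | DConst c => c | DZero => 0 | DOne => 1
  | DAdd u v => deval e u + deval e v | DOpp u => - deval e u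
  | DMul u v => deval e u * deval e v | DDer u => DB (deval e u)
  end.

Definition upd (e : nat -> B) (i : nat) (x : B) : nat -> B :=
  fun j => if j == i then x else e j.

Fixpoint dholds (e : nat -> B) (f : dformula B) : Prop :=
  match f with
  | DTrue => True | DFalse => False
  | DEq u v => deval e u = deval e v
  | DNot g => ~ dholds e g
  | DAnd g h => dholds e g /\ dholds e h
  | DOr g h => dholds e g \/ dholds e h
  | DEx i g => exists x, dholds (upd e i x) g
  | DAll i g => forall x, dholds (upd e i x) g
  end.

Fixpoint dterm_params (P : B -> Prop) (t : dterm B) : Prop :=
  match t with
  | DConst c => P c
  | DAdd u v | DMul u v => dterm_params P u /\ dterm_params P v
  | DOpp u | DDer u => dterm_params P u
  | _ => True
  end.

Fixpoint dformula_params (P : B -> Prop) (f : dformula B) : Prop :=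
  match f with
  | DTrue | DFalse => True
  | DEq u v => dterm_params P u /\ dterm_params P v
  | DNot g | DEx _ g | DAll _ g => dformula_params P g
  | DAnd g h | DOr g h => dformula_params P g /\ dformula_params P h
  end.

Definition env1 (a : B) : nat -> B := fun j => if j == 0%N then a else 0.

Definition saturated : Prop :=
  forall P : B -> Prop, card_lt P (fun _ => True) ->
  forall Sigma : dformula B -> Prop,
    (forall f, Sigma f -> dformula_params P f) ->
    (forall fs : seq (dformula B), all_list Sigma fs ->
       exists a, all_list (dholds (env1 a)) fs) ->
    exists a, forall f, Sigma f -> dholds (env1 a) f.
End DEval.

Definition differentially_closed (A : fieldType) (D : A -> A) : Prop :=
  forall (B : fieldType) (DB : B -> B) (iota : {rmorphism A -> B}),
    is_derivation DB -> (forall x, iota (D x) = DB (iota x)) ->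
  forall (ps qs : seq (dterm A)),
    (exists e : nat -> B,
       all_list (fun p => deval DB e (dmap iota p) = 0) ps /\
       all_list (fun q => deval DB e (dmap iota q) <> 0) qs) ->
    exists e : nat -> A,
       all_list (fun p => deval D e p = 0) ps /\
       all_list (fun q => deval D e q <> 0) qs.

Section RingFormulas.
Variable R : fieldType.
Fixpoint rterm_ok (P : R -> Prop) (t : GRing.term R) : Prop :=
  match t with
  | GRing.Var _ | GRing.NatConst _ => True
  | GRing.Const c => P c
  | GRing.Add u v | GRing.Mul u v => rterm_ok P u /\ rterm_ok P v
  | GRing.Opp u | GRing.NatMul u _ | GRing.Exp u _ => rterm_ok P u
  | GRing.Inv _ => False
  end.

Fixpoint qf_ring_formula (P : R -> Prop) (f : GRing.formula R) : Prop :=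
  match f with
  | GRing.Bool _ => True
  | GRing.Equal u v => rterm_ok P u /\ rterm_ok P v
  | GRing.And g h | GRing.Or g h | GRing.Implies g h =>
      qf_ring_formula P g /\ qf_ring_formula P h
  | GRing.Not g => qf_ring_formula P g
  | GRing.Unit _ | GRing.Exists _ _ | GRing.Forall _ _ => False
  end.
End RingFormulas.

(* Main.v *)
(* Write L = K<a> and C for the constants of A. Every constant c of L lies in K: otherwise
   the tensor square of A over K has a prime differential ideal not containing
   c (x) 1 - 1 (x) c, so by differential closedness and saturation some embedding of L over K
   moves c, against strong normality. Constants of A are linearly disjoint from L over
   C_L = C_K; hence an embedding tau of L over K extends by the identity on C to an element of
   Gal(L/K), and every automorphism arises in this way. By saturation there are finitely many
   m_k in K{a} such that every tau(a_j) is a quotient of C-linear combinations of the m_k, so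
   automorphisms are coded by tuples c of constants, with tau(a) = f(a,c). The condition that
   all differential equations of a over K hold at f(a,c) is polynomial in c, hence given by
   finitely many equations (Hilbert), with coefficients in C_K by linear disjointness. That
   a |-> f(a,c) is injective is not an equational condition; it is enforced by coding an
   automorphism by a pair (c,c') with c' a code of the inverse, since
   f(f(a,c),c') = a = f(f(a,c'),c) makes both specializations injective. *)
Require Import Defs.
From HB Require Import structures.
From mathcomp Require Import all_boot all_order all_algebra.
From mathcomp Require Import ring_quotient fraction.
From mathcomp Require Import boolp classical_sets.
From mathcomp Require Import ring.
Set Implicit Arguments. Unset Strict Implicit. Unset Printing Implicit Defensive.
Import GRing.Theory.
Local Open Scope ring_scope.

(** * Prime differential ideals *)

(** A differential ideal maximal among those missing all powers of [u] is prime because, when the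
    positive integers are invertible, radicals of differential ideals are differential. Hence it
    suffices that the difference of the two copies of [c] in the tensor square is not nilpotent.
    Homomorphisms are handled as graphs, because three kinds of map must be extended by the identity
    on the constants: embeddings of L, the identity of K{a}, and specializations of K{a} not yet
    known to be injective. The extension is a relation between formal sums, and its being
    single-valued is exactly linear disjointness. Definability is proved for functions of constant
    tuples rather than by syntax: rational functions over L are stable under the derivation because
    their arguments are constants, and each polynomial equation over L splits into equations over
    the constants of L. Denominators must not vanish where such functions are compared, so formulas
    are built in layers, nonvanishing first. An equivalence relation appears because the
    coefficients of a quotient are not unique. *)

(** [Zorn_bigcup] also asks for the union of the empty chain, which is empty, whereas ideals and
    subspaces contain 0. The empty set is therefore adjoined to the family and excluded again at the
    end. *)
Lemma zorn_nonempty (T : Type) (P : set T -> Prop) (A0 : set T) :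
  P A0 ->
  (forall F : set (set T), (exists X, F X) -> (forall X, F X -> P X) ->
     total_on F subset -> P (\bigcup_(X in F) X)%classic) ->
  exists A, P A /\ forall B, P B -> (A `<=` B)%classic -> (B `<=` A)%classic.
Proof.
move=> PA0 chain.
have [|A [PA maxA]] := @Zorn_bigcup T (fun A => A = set0 \/ P A).
  move=> F FP totF; have [[X [FX nX0]]|noX] := EM (exists X, F X /\ X <> set0).
    right; pose G := (fun X => F X /\ X <> set0) : set (set T).
    have -> : (\bigcup_(X in F) X = \bigcup_(X in G) X)%classic.
      rewrite eqEsubset; split=> x [Y FY Yx]; exists Y => //; last by case: FY.
      by split=> // Y0; rewrite Y0 in Yx.
    apply: chain; first by exists X.
      by move=> Y [FY nY]; case: (FP _ FY).
    by move=> Y Z [FY _] [FZ _]; apply: totF.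
  left; rewrite -subset0 => x [Y FY Yx]; apply: noX; exists Y; split=> //.
  by move=> Y0; rewrite Y0 in Yx.
have {}PA : P A.
  case: PA => // A_0; have [A0_0|nA0] := EM (A0 = set0); first by rewrite A_0 -A0_0.
  case: (maxA A0); last by right.
  by split; [rewrite A_0; apply: sub0set|rewrite A_0 subset0].
exists A; split=> // B PB AB; apply: contrapT => nBA.
by apply: (maxA B); [split|right].
Qed.

Section DerivationRing.
Variables (R : comNzRingType) (d : R -> R).
Hypothesis dD : forall x y, d (x + y) = d x + d y.
Hypothesis dM : forall x y, d (x * y) = d x * y + x * d y.

Lemma derivation0 : d 0 = 0.
Proof. by apply: (addrI (d 0)); rewrite -dD !addr0. Qed.

Lemma derivationN x : d (- x) = - d x.
Proof. by apply: (addrI (d x)); rewrite -dD !subrr derivation0. Qed.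

Lemma derivationB x y : d (x - y) = d x - d y.
Proof. by rewrite dD derivationN. Qed.

Lemma derivation1 : d 1 = 0.
Proof. by apply: (addrI (d 1)); rewrite addr0 -[in RHS](mulr1 1) dM mulr1 mul1r. Qed.

Lemma derivationX x n : d (x ^+ n.+1) = n.+1%:R * (x ^+ n * d x).
Proof.
elim: n => [|n IH]; first by rewrite expr1 mul1r expr0 mul1r.
rewrite exprS dM IH -[n.+2]addn1 natrD [x ^+ n.+1]exprS; ring.
Qed.

Definition diff_ideal (J : R -> Prop) : Prop :=
  [/\ J 0, forall x y, J x -> J y -> J (x + y), forall a x, J x -> J (a * x)
    & forall x, J x -> J (d x)].

Hypothesis divn : forall n, exists y : R, y * n.+1%:R = 1.

(* By induction on [k], some [a^(n-k) (da)^m] is in [J]: differentiate the previous one,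
   multiply by [da], and divide by the integer [n-k+1]. *)
Lemma diff_ideal_nilp (J : R -> Prop) (a : R) n :
  diff_ideal J -> J (a ^+ n) -> exists m, J (d a ^+ m).
Proof.
move=> [J0 JD JM Jd] Jan.
suff H k : (k <= n)%N -> exists m, J (a ^+ (n - k) * d a ^+ m).
  by have [m] := H n (leqnn n); rewrite subnn expr0 mul1r; exists m.
elim: k => [|k IH] le_kn; first by exists 0%N; rewrite subn0 expr0 mulr1.
have [m Jm] := IH (ltnW le_kn); exists (m + 2)%N.
move: Jm; rewrite subnS; case E: (n - k)%N => [|j] Jm /=.
  by move/eqP: E; rewrite subn_eq0 leqNgt le_kn.
have [y yE] := divn j.
have := Jd _ Jm; rewrite dM derivationX => /(JM (d a)) J1.
case: m Jm J1 => [|m] Jm J1.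
  move: J1; rewrite expr0 derivation1.
  move=> /(JM y); rewrite mulr0 addr0 mulr1.
  have -> : y * (d a * (j.+1%:R * (a ^+ j * d a))) =
     (y * j.+1%:R) * (a ^+ j * d a ^+ (0 + 2)) by ring.
  by rewrite yE mul1r.
move: J1; rewrite derivationX.
have J2 := JM (- (m.+1%:R * d (d a))) _ Jm.
move=> J1; have := JM y _ (JD _ _ J1 J2).
have -> : y * (d a * (j.+1%:R * (a ^+ j * d a) * d a ^+ m.+1 +
       a ^+ j.+1 * (m.+1%:R * (d a ^+ m * d (d a)))) +
       - (m.+1%:R * d (d a)) * (a ^+ j.+1 * d a ^+ m.+1)) =
   (y * j.+1%:R) * (a ^+ j * d a ^+ (m.+1 + 2)).
  by rewrite addn2 !exprS; ring.
by rewrite yE mul1r.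
Qed.

(** Zorn gives a differential ideal [J] maximal among those missing every [u ^+ k], including
    [u ^+ 0]. Maximality is then applied to the radical of [J] and to its colon ideals: each is
    differential, so it equals [J] as soon as it misses the powers of [u]. *)
Lemma prime_diff_ideal (u : R) : (forall k, u ^+ k != 0) ->
  exists J : R -> Prop, [/\ diff_ideal J, ~ J u, ~ J 1 &
    forall x y, J (x * y) -> J x \/ J y].
Proof.
move=> unil.
pose good (J : set R) := diff_ideal J /\ forall k, ~ J (u ^+ k).
have [||J [[dJ nJ] maxJ]] := @zorn_nonempty R good (fun x => x = 0).
- split; last by move=> k /eqP; rewrite (negPf (unil k)).
  split=> //; first by move=> x y -> ->; rewrite addr0.
    by move=> a x ->; rewrite mulr0.
  by move=> x ->; rewrite derivation0.
- move=> F [X0 FX0] Fgood totF; split; last first.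
    by move=> k [X FX]; have [_ nX] := Fgood _ FX; apply: nX.
  split.
  + by exists X0 => //; have [[]] := Fgood _ FX0.
  + move=> x y [X FX Xx] [Y FY Yy].
    have [XY|YX] := totF _ _ FX FY.
      by exists Y => //; have [[_ + _ _] _] := Fgood _ FY; apply=> //; apply: XY.
    by exists X => //; have [[_ + _ _] _] := Fgood _ FX; apply=> //; apply: YX.
  + move=> a x [X FX Xx]; exists X => //.
    by have [[_ _ + _] _] := Fgood _ FX; apply.
  + move=> x [X FX Xx]; exists X => //.
    by have [[_ _ _ +] _] := Fgood _ FX; apply.
have [J0 JD JM Jd] := dJ.
(* The radical of [J] is differential by [diff_ideal_nilp] and still misses the powers of [u], so it
   is [J]. *)
have Jrad x n : J (x ^+ n) -> J x.
  move=> Jx; apply: (maxJ (fun x => exists n, J (x ^+ n))); last by exists n.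
    split; last by move=> k [m]; rewrite -exprM; apply: nJ.
    split; first by exists 1%N.
    - move=> y z [p Jy] [q Jz]; exists (p + q)%N.
      rewrite exprDn; apply: (big_ind J) => // i _.
      rewrite -mulr_natl; apply: (JM).
      case: (leqP q i) => hi.
        by rewrite -(subnK hi) exprD mulrA; apply: JM.
      rewrite mulrC -(@subnK p (p + q - i)); last first.
        by rewrite -addnBA ?leq_addr // ltnW.
      by rewrite exprD mulrA; apply: JM.
    - by move=> a y [p Jy]; exists p; rewrite exprMn; apply: JM.
    - by move=> y [p Jy]; apply: diff_ideal_nilp Jy.
  by move=> y Jy; exists 1%N; rewrite expr1.
(* Colon ideals of a radical differential ideal are differential: multiplying the derivative of
   [a * x] by [d a * x] and removing a multiple of [a * x] leaves the square of [d a * x]. *)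
have Jquot x : diff_ideal (fun a => J (a * x)).
  split; first by rewrite mul0r.
  - by move=> a b Ja Jb; rewrite mulrDl; apply: JD.
  - by move=> a b Jb; rewrite -mulrA; apply: JM.
  - move=> a Ja; apply: (Jrad _ 2).
    have := Jd _ Ja; rewrite dM => /(JM (d a * x)) J1.
    have J2 := JM (- (d a * d x)) _ Ja; have := JD _ _ J1 J2.
    by congr (J _); ring.
(* Modulo [J] the element [u] is not a zero divisor. If [u ^+ m * x] is in [J], then [x] lies in the
   colon ideal of [u ^+ m]. Either that ideal misses the powers of [u] and equals [J], or some
   [u ^+ (p + m)] lies in [J], which is excluded. *)
have Jsub x k : J (u ^+ k * x) -> J x.
  elim: k x => [|k IH] x; first by rewrite expr0 mul1r.
  rewrite exprS => J1; apply: contrapT => nJx.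
  have [nq|] := EM (forall m, ~ J (u ^+ m * x)).
    apply: (nJ (k.+1)%N); apply: (maxJ (fun a => J (a * x))).
    - by split=> //; apply: Jquot.
    - by move=> a Ja; rewrite /= mulrC; apply: JM.
    - by rewrite exprS.
  move=> /existsNP [m /contrapT Jm].
  have [H|] := EM (forall p, ~ J (u ^+ p * u ^+ m)).
    apply: nJx; apply: (maxJ (fun a => J (a * u ^+ m))); last by rewrite mulrC.
      by split=> //; apply: Jquot.
    by move=> a Ja; rewrite mulrC; apply: JM.
  by move=> /existsNP [p /contrapT]; rewrite -exprD => /nJ.
exists J; split=> //; [exact: (nJ 1%N) | exact: (nJ 0%N) |].
move=> x y Jxy; apply: contrapT => /not_orP [nJx nJy].
(* By [Jsub] the colon ideal of [y] misses the powers of [u], so it equals [J]; and it contains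
   [x]. *)
apply: nJx; apply: (maxJ (fun a => J (a * y))) => //.
- by split=> [|k /Jsub //]; apply: Jquot.
- by move=> a Ja; rewrite mulrC; apply: JM.
Qed.

End DerivationRing.

(** * Differential fields of fractions *)

Local Notation "x %:F" := (@FracField.tofrac _ x).

Lemma fraction_rep (R : idomainType) (x : {fraction R}) :
  exists p : R * R, p.2 != 0 /\ x = p.1%:F / p.2%:F.
Proof.
elim/quotW: x => r; exists (frac r); split; first exact: denom_ratioP.
have m0 : (\d_r)%:F != 0 :> {fraction R} by rewrite tofrac_eq0 denom_ratioP.
apply: (mulIf m0); rewrite divfK //.
unlock FracField.tofrac; rewrite -[LHS]FracField.pi_mul /FracField.mulf.
apply/eqmodP; rewrite /= FracField.equivfE !numden_Ratio ?oner_neq0 ?mulr1 //.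
- by rewrite mulrC.
- exact: denom_ratioP.
- exact: denom_ratioP.
Qed.

Lemma quotient_ruleD (F : fieldType) (a b a' b' da db da' db' : F) :
  b != 0 -> b' != 0 ->
  ((da * b' + a * db' + (da' * b + a' * db)) * (b * b') -
   (a * b' + a' * b) * (db * b' + b * db')) / (b * b') ^+ 2 =
  (da * b - a * db) / b ^+ 2 + (da' * b' - a' * db') / b' ^+ 2.
Proof. by move=> b0 b0'; field; rewrite b0 b0'. Qed.

Lemma quotient_ruleM (F : fieldType) (a b a' b' da db da' db' : F) :
  b != 0 -> b' != 0 ->
  ((da * a' + a * da') * (b * b') - a * a' * (db * b' + b * db')) / (b * b') ^+ 2 =
  (da * b - a * db) / b ^+ 2 * (a' / b') + a / b * ((da' * b' - a' * db') / b' ^+ 2).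
Proof. by move=> b0 b0'; field; rewrite b0 b0'. Qed.

Lemma fraction_derivation (R : idomainType) (d : R -> R) :
  (forall x y, d (x + y) = d x + d y) ->
  (forall x y, d (x * y) = d x * y + x * d y) ->
  exists D : {fraction R} -> {fraction R},
    is_derivation D /\ forall x, D (x%:F) = (d x)%:F.
Proof.
move=> dD dM.
have /choice [f fP] := @fraction_rep R.
pose g (p : R * R) : {fraction R} :=
  ((d p.1)%:F * p.2%:F - p.1%:F * (d p.2)%:F) / p.2%:F ^+ 2.
(* The quotient rule does not depend on the representative: differentiate the cross-multiplied
   equality [a * b' = a' * b]. *)
have gwd (p q : R * R) : p.2 != 0 -> q.2 != 0 ->
    p.1%:F / p.2%:F = q.1%:F / q.2%:F :> {fraction R} -> g p = g q.
  case: p q => [a b] [a' b'] /= b0 b0' /eqP.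
  rewrite eqr_div ?tofrac_eq0 // -!tofracM tofrac_eq => /eqP E.
  have E2 : d (a * b') = d (a' * b) by rewrite E.
  rewrite !dM in E2.
  apply/eqP; rewrite /g /= eqr_div ?expf_neq0 ?tofrac_eq0 //.
  rewrite -!tofracXn -!tofracM -!tofracB -!tofracM tofrac_eq; apply/eqP.
  have -> : (d a * b - a * d b) * b' ^+ 2 =
     (d a * b' + a * d b') * b * b' - (a * b') * (d b' * b + b' * d b) by ring.
  by rewrite E2 E; ring.
pose D x := g (f x).
have DE (p : R * R) : p.2 != 0 -> D (p.1%:F / p.2%:F) = g p.
  move=> p0; have [f0 fE] := fP (p.1%:F / p.2%:F).
  by apply: gwd.
exists D; split; last first.
  move=> x; have := DE (x, 1) (oner_neq0 _); rewrite /= /g /= tofrac1 !divr1 => ->.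
  by rewrite expr1n divr1 mulr1 (derivation1 dM) tofrac0 mulr0 subr0.
have nf (b : R) : b != 0 -> b%:F != 0 :> {fraction R} by rewrite tofrac_eq0.
split=> x y; have [f0 fx] := fP x; have [f0' fy] := fP y;
  move: (f x) (f y) f0 f0' fx fy => [a b] [a' b'] /= b0 b0' -> ->.
- have -> : a%:F / b%:F + a'%:F / b'%:F =
     (a * b' + a' * b)%:F / (b * b')%:F :> {fraction R}.
    by rewrite tofracD !tofracM addf_div ?nf.
  rewrite !(DE (_, _)) ?mulf_neq0 // /g /= !(dD, dM, tofracD, tofracM).
  exact: quotient_ruleD (nf _ b0) (nf _ b0').
- have -> : a%:F / b%:F * (a'%:F / b'%:F) =
     (a * a')%:F / (b * b')%:F :> {fraction R} by rewrite !tofracM mulf_div.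
  rewrite !(DE (_, _)) ?mulf_neq0 // /g /= !(dD, dM, tofracD, tofracM).
  exact: quotient_ruleM (nf _ b0) (nf _ b0').
Qed.

Local Open Scope quotient_scope.

Section PrimeQuotient.
Variables (R : comNzRingType) (I : prime_idealr R).

(** The fraction field is built from an [idomainType], whose interface contains a unit predicate and
    an inverse function. Both are chosen classically, the inverse being the identity on non-units as
    the interface prescribes. *)
Definition prime_quot : Type := Quotient.quot I.
HB.instance Definition _ := GRing.ComNzRing.on prime_quot.

Definition pq_unit : pred prime_quot := fun x => `[< exists y, y * x = 1 >].
Definition pq_inv (x : prime_quot) : prime_quot :=
  if pselect (exists y, y * x = 1) is left e then projT1 (cid e) else x.

Lemma pq_mulVx : {in pq_unit, left_inverse 1 pq_inv *%R}.
Proof.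
move=> x /asboolP xu; rewrite /pq_inv; case: pselect => // e.
exact: (projT2 (cid e)).
Qed.

Lemma pq_unitPl (x y : prime_quot) : y * x = 1 -> pq_unit x.
Proof. by move=> yx; apply/asboolP; exists y. Qed.

Lemma pq_inv_out : {in [predC pq_unit], pq_inv =1 id}.
Proof. by move=> x /asboolP xu; rewrite /pq_inv; case: pselect. Qed.

HB.instance Definition _ := GRing.ComNzRing_hasMulInverse.Build prime_quot
  pq_mulVx pq_unitPl pq_inv_out.
HB.instance Definition _ := GRing.ComUnitRing_isIntegral.Build prime_quot
  (@Quotient.rquot_IdomainAxiom R I).

End PrimeQuotient.

Lemma diff_field_quotient (R : comNzRingType) (d : R -> R) (u : R) :
  (forall x y, d (x + y) = d x + d y) ->
  (forall x y, d (x * y) = d x * y + x * d y) ->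
  (forall n, exists y : R, y * n.+1%:R = 1) ->
  (forall k, u ^+ k != 0) ->
  exists (B : fieldType) (DB : B -> B) (h : {rmorphism R -> B}),
    [/\ is_derivation DB, forall x, h (d x) = DB (h x) & h u <> 0].
Proof.
move=> dD dM divn unil.
have [J [[J0 JD JM Jd] nJu nJ1 Jp]] := prime_diff_ideal dD dM divn unil.
pose I0 : R -> bool := fun x => `[< J x >].
have I0c : idealr_closed I0.
  split; [exact/asboolP|exact/asboolP|].
  by move=> a u' v /asboolP Ju /asboolP Jv; apply/asboolP; apply: JD => //; apply: JM.
have I0p : prime_idealr_closed I0.
  move=> x y /asboolP /Jp [H|H]; apply/orP; [left|right]; exact/asboolP.
pose I : prime_idealr R := HB.pack I0 (isIdealr.Build R I0 I0c)
  (isPrimeIdealrClosed.Build R I0 I0p).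
pose Q := prime_quot I.
pose pi (x : R) : Q := \pi_(Quotient.quot I) x.
have piE x y : pi x = pi y <-> J (x - y).
  split; first by move=> /eqmodP; rewrite /= Quotient.equivE => /asboolP.
  by move=> H; apply/eqmodP; rewrite /= Quotient.equivE; apply/asboolP.
have piD x y : pi (x + y) = pi x + pi y by exact: (rmorphD (\pi_(Quotient.quot I))).
have piM x y : pi (x * y) = pi x * pi y by exact: (rmorphM (\pi_(Quotient.quot I))).
have pi1 : pi 1 = 1 by exact: (rmorph1 (\pi_(Quotient.quot I))).
pose dQ (x : Q) : Q := pi (d (repr (x : Quotient.quot I))).
have dQE x : dQ (pi x) = pi (d x).
  apply/piE; rewrite -derivationB //; apply: Jd; apply/piE.
  by rewrite /pi reprK.
have [x y|x y|D [derD DE]] := @fraction_derivation Q dQ.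
- rewrite -[x]reprK -[y]reprK -!/(pi _).
  by rewrite -piD !dQE dD piD.
- rewrite -[x]reprK -[y]reprK -!/(pi _).
  by rewrite -piM !dQE dM piD !piM.
pose h x : {fraction Q} := (pi x)%:F.
have hB : zmod_morphism h.
  by move=> x y; apply: (addIr (h y)); rewrite subrK /h -tofracD -piD subrK.
have hM : monoid_morphism h.
  by split=> [|x y]; rewrite /h ?pi1 ?tofrac1 // piM tofracM.
exists {fraction Q}, D.
pose hr : {rmorphism R -> {fraction Q}} := HB.pack h (GRing.isZmodMorphism.Build _ _ h hB)
    (GRing.isMonoidMorphism.Build _ _ h hM).
exists hr; split=> //=.
- by move=> x; rewrite /h DE dQE.
- move=> /eqP; rewrite /h tofrac_eq0 => /eqP.
  have -> : 0 = pi 0 by exact/esym/(rmorph0 (\pi_(Quotient.quot I))).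
  by move=> /piE; rewrite subr0.
Qed.

(** * The tensor square of a field over a subfield *)

Section TensorSquare.
Variables (A : fieldType) (K : A -> Prop).

Definition klin (f : A -> A) : Prop :=
  (forall x y, f (x + y) = f x + f y) /\ (forall k x, K k -> f (k * x) = k * f x).

Definition tval (f : A -> A) (s : seq (A * A)) : A := \sum_(p <- s) f p.1 * p.2.

(* The list [s] stands for the sum of the [p.1 (x) p.2] in the tensor square of [A] over [K];
   two such sums agree iff [K]-linear maps applied to the left factors cannot tell them apart. *)
Definition teq (s t : seq (A * A)) : bool :=
  `[< forall f, klin f -> tval f s = tval f t >].

Lemma teqP s t : reflect (forall f, klin f -> tval f s = tval f t) (teq s t).
Proof. exact: asboolP. Qed.

Lemma teq_refl : reflexive teq.
Proof. by move=> s; apply/teqP. Qed.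
Lemma teq_sym : symmetric teq.
Proof. by move=> s t; apply/teqP/teqP => H f Hf; rewrite H. Qed.
Lemma teq_trans : transitive teq.
Proof. by move=> t s u /teqP H1 /teqP H2; apply/teqP => f Hf; rewrite H1 ?H2. Qed.

Canonical teq_equiv := EquivRel teq teq_refl teq_sym teq_trans.

Definition tensor : Type := {eq_quot teq}.
HB.instance Definition _ := Choice.on tensor.
HB.instance Definition _ := EqQuotient.on tensor.

Definition tclass (s : seq (A * A)) : tensor := \pi_tensor s.

Lemma tclassE s t : (forall f, klin f -> tval f s = tval f t) <-> tclass s = tclass t.
Proof.
split=> [H|/eqmodP /teqP //]; by apply/eqmodP/teqP.
Qed.

Definition trep (x : tensor) : seq (A * A) := repr x.

Lemma trepK x : tclass (trep x) = x.
Proof. exact: reprK. Qed.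

Lemma tval_rep f s : klin f -> tval f (trep (tclass s)) = tval f s.
Proof. by move=> Hf; have /tclassE H := trepK (tclass s); exact: H. Qed.

Lemma klin_mulr f a : klin f -> klin (fun x => f (x * a)).
Proof.
move=> [fD fK]; split=> [x y|k x Kk]; first by rewrite mulrDl fD.
by rewrite -mulrA fK.
Qed.

Definition tmul (s t : seq (A * A)) : seq (A * A) :=
  [seq (p.1 * q.1, p.2 * q.2) | p <- s, q <- t].

Lemma tval_cat f s t : tval f (s ++ t) = tval f s + tval f t.
Proof. exact: big_cat. Qed.

Lemma tval_seq1 f p : tval f [:: p] = f p.1 * p.2.
Proof. exact: big_seq1. Qed.

Lemma tval_mul f s t :
  tval f (tmul s t) = \sum_(q <- t) tval (fun x => f (x * q.1)) s * q.2.
Proof.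
rewrite /tval big_allpairs_dep /= exchange_big; apply: eq_bigr => q _.
by rewrite mulr_suml; apply: eq_bigr => p _; rewrite mulrA.
Qed.

Lemma tval_mulC f s t : tval f (tmul s t) = tval f (tmul t s).
Proof.
rewrite /tval !big_allpairs_dep /= exchange_big; apply: eq_bigr => q _.
by apply: eq_bigr => p _; rewrite [p.1 * _]mulrC [p.2 * _]mulrC.
Qed.

(** For a fixed factor [q] the map sending [x] to [f (x * q.1)] is again [K]-linear, so the first
    list may be replaced by an equivalent one; commutativity then gives the second. *)
Lemma tval_mul_eq f s s' t t' : klin f -> tclass s = tclass s' ->
  tclass t = tclass t' -> tval f (tmul s t) = tval f (tmul s' t').
Proof.
move=> Hf /tclassE H /tclassE H'.
transitivity (tval f (tmul s' t)).
  by rewrite !tval_mul; apply: eq_bigr => q _; rewrite H //; apply: klin_mulr.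
rewrite tval_mulC [RHS]tval_mulC.
by rewrite !tval_mul; apply: eq_bigr => q _; rewrite H' //; apply: klin_mulr.
Qed.

Definition taddT (x y : tensor) : tensor := tclass (trep x ++ trep y).
Definition toppT (x : tensor) : tensor := tclass [seq (p.1, - p.2) | p <- trep x].
Definition tmulT (x y : tensor) : tensor := tclass (tmul (trep x) (trep y)).
Definition tzeroT : tensor := tclass [::].
Definition toneT : tensor := tclass [:: (1, 1)].

Lemma taddE s t : taddT (tclass s) (tclass t) = tclass (s ++ t).
Proof. by apply/tclassE => f Hf; rewrite !tval_cat !tval_rep. Qed.

Lemma tval_opp f s : tval f [seq (p.1, - p.2) | p <- s] = - tval f s.
Proof. by rewrite /tval big_map -sumrN; apply: eq_bigr => p _; rewrite mulrN. Qed.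

Lemma toppE s : toppT (tclass s) = tclass [seq (p.1, - p.2) | p <- s].
Proof. by apply/tclassE => f Hf; rewrite !tval_opp !tval_rep. Qed.

Lemma tmulE s t : tmulT (tclass s) (tclass t) = tclass (tmul s t).
Proof. by apply/tclassE => f Hf; apply: tval_mul_eq => //; rewrite trepK. Qed.

Lemma tensor_ind (P : tensor -> Prop) : (forall s, P (tclass s)) -> forall x, P x.
Proof. by move=> H x; rewrite -(trepK x). Qed.

Lemma taddA : associative taddT.
Proof.
elim/tensor_ind=> s; elim/tensor_ind=> t; elim/tensor_ind=> u.
by rewrite !taddE catA.
Qed.
Lemma taddC : commutative taddT.
Proof.
elim/tensor_ind=> s; elim/tensor_ind=> t.
by rewrite !taddE; apply/tclassE => f _; rewrite !tval_cat addrC.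
Qed.
Lemma tadd0 : left_id tzeroT taddT.
Proof. by elim/tensor_ind=> s; rewrite taddE. Qed.
Lemma taddN : left_inverse tzeroT toppT taddT.
Proof.
elim/tensor_ind=> s; rewrite toppE taddE; apply/tclassE => f _.
by rewrite tval_cat tval_opp addNr /tval big_nil.
Qed.

HB.instance Definition _ := GRing.isZmodule.Build tensor taddA taddC tadd0 taddN.

Lemma tmulA : associative tmulT.
Proof.
elim/tensor_ind=> s; elim/tensor_ind=> t; elim/tensor_ind=> u.
rewrite !tmulE; apply/tclassE => f _.
rewrite /tval /tmul !big_allpairs_dep /=; apply: eq_bigr => p _.
rewrite !big_allpairs_dep /=; apply: eq_bigr => q _.
by apply: eq_bigr => r _; rewrite !mulrA.
Qed.
Lemma tmulC : commutative tmulT.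
Proof.
elim/tensor_ind=> s; elim/tensor_ind=> t.
by rewrite !tmulE; apply/tclassE => f _; rewrite tval_mulC.
Qed.
Lemma tmul1 : left_id toneT tmulT.
Proof.
elim/tensor_ind=> s; rewrite tmulE; apply/tclassE => f _.
rewrite /tval /tmul !big_allpairs_dep /= big_seq1 /=.
by apply: eq_bigr => p _; rewrite !mul1r.
Qed.
Lemma tmulD : left_distributive tmulT taddT.
Proof.
elim/tensor_ind=> s; elim/tensor_ind=> t; elim/tensor_ind=> u.
rewrite !(taddE, tmulE); apply/tclassE => f _.
by rewrite tval_cat /tval /tmul !big_allpairs_dep /= big_cat.
Qed.
Lemma tone_neq0 : toneT != 0.
Proof.
apply/eqP => /tclassE /(_ id).
rewrite tval_seq1 /tval big_nil /= mulr1 => H.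
by have /eqP := H (conj (fun _ _ => erefl) (fun _ _ _ => erefl)); rewrite oner_eq0.
Qed.

HB.instance Definition _ := GRing.Zmodule_isComNzRing.Build tensor
  tmulA tmulC tmul1 tmulD tone_neq0.

Lemma tclassD s t : tclass s + tclass t = tclass (s ++ t).
Proof. exact: taddE. Qed.
Lemma tclassM s t : tclass s * tclass t = tclass (tmul s t).
Proof. exact: tmulE. Qed.

Definition tleft (a : A) : tensor := tclass [:: (a, 1)].
Definition tright (a : A) : tensor := tclass [:: (1, a)].

Lemma tleft_zmod : zmod_morphism tleft.
Proof.
move=> x y; apply/eqP; rewrite eq_sym subr_eq tclassD; apply/eqP/tclassE => f [fD _].
by rewrite tval_cat !tval_seq1 /= -mulrDl -fD subrK.
Qed.
Lemma tleft_monoid : monoid_morphism tleft.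
Proof. by split=> [//|x y]; rewrite tclassM /tmul /= mulr1. Qed.
HB.instance Definition _ := GRing.isZmodMorphism.Build A tensor tleft tleft_zmod.
HB.instance Definition _ := GRing.isMonoidMorphism.Build A tensor tleft tleft_monoid.

Lemma tright_zmod : zmod_morphism tright.
Proof.
move=> x y; apply/eqP; rewrite eq_sym subr_eq tclassD; apply/eqP/tclassE => f [fD _].
by rewrite tval_cat !tval_seq1 /= -mulrDr subrK.
Qed.
Lemma tright_monoid : monoid_morphism tright.
Proof. by split=> [//|x y]; rewrite tclassM /tmul /= mulr1. Qed.
HB.instance Definition _ := GRing.isZmodMorphism.Build A tensor tright tright_zmod.
HB.instance Definition _ := GRing.isMonoidMorphism.Build A tensor tright tright_monoid.

Lemma tleft_right k : K k -> tleft k = tright k.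
Proof.
move=> Kk; apply/tclassE => f [fD fK].
by rewrite !tval_seq1 /= -{1}[k]mulr1 fK // mulr1 mulrC.
Qed.

Definition tapp (f : A -> A) (x : tensor) : A := tval f (trep x).

Lemma tappE f s : klin f -> tapp f (tclass s) = tval f s.
Proof. exact: tval_rep. Qed.

Lemma tapp_lr f a b : klin f -> tapp f (tleft a * tright b) = f a * b.
Proof. by move=> Hf; rewrite tclassM tappE // tval_seq1 /= mulr1 mul1r. Qed.

Lemma tappD f x y : klin f -> tapp f (x + y) = tapp f x + tapp f y.
Proof.
move=> Hf; elim/tensor_ind: x => s; elim/tensor_ind: y => t.
by rewrite tclassD !tappE // tval_cat.
Qed.

Lemma tapp0 f : klin f -> tapp f 0 = 0.
Proof. by move=> Hf; apply: (addrI (tapp f 0)); rewrite -tappD // !addr0. Qed.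

Lemma tapp_sum f n (F : 'I_n -> tensor) : klin f ->
  tapp f (\sum_i F i) = \sum_i tapp f (F i).
Proof. by move=> Hf; apply: (big_morph (tapp f)) => [x y|]; rewrite ?tappD ?tapp0. Qed.

Section Derivation.
Variable D : A -> A.
Hypothesis derD : is_derivation D.
Hypothesis KD : forall x, K x -> K (D x).

Definition tder (s : seq (A * A)) : seq (A * A) :=
  [seq (D p.1, p.2) | p <- s] ++ [seq (p.1, D p.2) | p <- s].

(** Composing with [D] destroys [K]-linearity, but in the commutator of [D] and [f] the two terms in
    [D k] cancel. By [tval_der], this makes the derivation of the tensor square independent of the
    representing list. *)
Lemma klin_comm f : klin f -> klin (fun x => D (f x) - f (D x)).
Proof.
move=> [fD fK]; have [DD DM] := derD; split=> [x y|k x Kk].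
  by rewrite fD !DD fD; ring.
rewrite fK // !DM fD !fK //; last exact: KD.
by ring.
Qed.

Lemma tval_der f s : klin f ->
  tval f (tder s) = D (tval f s) - tval (fun x => D (f x) - f (D x)) s.
Proof.
have [DD DM] := derD; have D0 : D 0 = 0 by apply: (addrI (D 0)); rewrite -DD !addr0.
move=> Hf; rewrite tval_cat /tval !big_map.
rewrite (big_morph D DD D0) -sumrB -big_split /=; apply: eq_bigr => p _.
by rewrite DM; ring.
Qed.

Definition tderT (x : tensor) : tensor := tclass (tder (trep x)).

Lemma tderE s : tderT (tclass s) = tclass (tder s).
Proof.
apply/tclassE => f Hf; rewrite !tval_der //.
by rewrite !tval_rep //; apply: klin_comm.
Qed.

Lemma tderD x y : tderT (x + y) = tderT x + tderT y.
Proof.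
elim/tensor_ind: x => s; elim/tensor_ind: y => t.
rewrite !(tclassD, tderE); apply/tclassE => f Hf.
by rewrite /tder !map_cat !tval_cat; ring.
Qed.

Lemma tderM x y : tderT (x * y) = tderT x * y + x * tderT y.
Proof.
have [DD DM] := derD.
elim/tensor_ind: x => s; elim/tensor_ind: y => t.
rewrite !(tclassD, tclassM, tderE); apply/tclassE => f [fD fK].
have E s' t' : tval f (tmul s' t') =
    \sum_(p <- s') \sum_(q <- t') f (p.1 * q.1) * (p.2 * q.2).
  by rewrite /tval big_allpairs_dep.
rewrite tval_cat !E {1}/tval /tder big_cat !big_map big_allpairs_dep /=.
rewrite big_allpairs_dep big_cat !big_map -!big_split /= -!big_split /=; apply: eq_bigr => p _.
rewrite big_cat !big_map -!big_split /= -!big_split /=; apply: eq_bigr => q _.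
by rewrite !DM fD; ring.
Qed.

Lemma tder_left a : tderT (tleft a) = tleft (D a).
Proof.
have [DD DM] := derD.
have D1 : D 1 = 0 by apply: (addrI (D 1)); rewrite addr0 -[in RHS](mulr1 1) DM mulr1 mul1r.
rewrite tderE; apply/tclassE => f _.
by rewrite /tval /= !(big_cons, big_nil) /= D1 mulr0 addr0.
Qed.

Lemma tder_right a : tderT (tright a) = tright (D a).
Proof.
have [DD DM] := derD.
have D1 : D 1 = 0 by apply: (addrI (D 1)); rewrite addr0 -[in RHS](mulr1 1) DM mulr1 mul1r.
rewrite tderE; apply/tclassE => f [fD _].
have f0 : f 0 = 0 by apply: (addrI (f 0)); rewrite -fD !addr0.
by rewrite /tval /= !(big_cons, big_nil) /= D1 f0 mul0r add0r.
Qed.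

End Derivation.
End TensorSquare.

(** * Moving an element outside the base field *)

Section DSubfield.
Variables (A : fieldType) (D : A -> A) (F : A -> Prop).
Hypothesis dF : is_dsubfield D F.

Lemma dsub0 : F 0. Proof. by case: dF. Qed.
Lemma dsub1 : F 1. Proof. by case: dF => _ []. Qed.
Lemma dsubB x y : F x -> F y -> F (x - y).
Proof. by case: dF => _ [_ [H _]]; apply: H. Qed.
Lemma dsubM x y : F x -> F y -> F (x * y).
Proof. by case: dF => _ [_ [_ [H _]]]; apply: H. Qed.
Lemma dsubV x : F x -> F x^-1.
Proof. by case: dF => _ [_ [_ [_ [H _]]]]; apply: H. Qed.
Lemma dsubd x : F x -> F (D x).
Proof. by case: dF => _ [_ [_ [_ [_ H]]]]; apply: H. Qed.
Lemma dsubN x : F x -> F (- x).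
Proof. by move=> Fx; rewrite -sub0r; apply: dsubB => //; apply: dsub0. Qed.
Lemma dsubD x y : F x -> F y -> F (x + y).
Proof. by move=> Fx Fy; rewrite -[y]opprK; apply: dsubB => //; apply: dsubN. Qed.
Lemma dsub_div x y : F x -> F y -> F (x / y).
Proof. by move=> Fx Fy; apply: dsubM => //; apply: dsubV. Qed.
Lemma dsubX x n : F x -> F (x ^+ n).
Proof.
move=> Fx; elim: n => [|n IH]; first by rewrite expr0; apply: dsub1.
by rewrite exprS; apply: dsubM.
Qed.
Lemma dsub_sum (I : Type) (r : seq I) (P : pred I) (f : I -> A) :
  (forall i, P i -> F (f i)) -> F (\sum_(i <- r | P i) f i).
Proof. by move=> H; apply: (big_ind F) => //; [apply: dsub0|apply: dsubD]. Qed.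
Lemma dsub_muln x n : F x -> F (x *+ n).
Proof.
move=> Fx; elim: n => [|n IH]; first by rewrite mulr0n; apply: dsub0.
by rewrite mulrS; apply: dsubD.
Qed.
Lemma dsub_nat n : F n%:R.
Proof. exact/dsub_muln/dsub1. Qed.

End DSubfield.

Section TwoEmbeddings.
Variables (A : fieldType) (D : A -> A) (K : A -> Prop).
Hypothesis derD : is_derivation D.
Hypothesis char0 : [pchar A] =i pred0.
Hypothesis dK : is_dsubfield D K.

(** A subspace [V] containing [W] and maximal among those omitting 1 is a hyperplane: every [x] is
    congruent modulo [V] to a unique scalar, and that scalar is [f x]. *)
Lemma klin_functional (W : A -> Prop) :
  W 0 -> (forall x y, W x -> W y -> W (x + y)) ->
  (forall k x, K k -> W x -> W (k * x)) -> ~ W 1 ->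
  exists f, [/\ klin K f, f 1 = 1 & forall w, W w -> f w = 0].
Proof.
move=> W0 WD WK W1.
pose sub (V : set A) := [/\ V 0, forall x y, V x -> V y -> V (x + y) &
  forall k x, K k -> V x -> V (k * x)].
pose good (V : set A) := [/\ sub V, (forall w, W w -> V w) & ~ V 1].
have [//||V [[[V0 VD VK] WV V1] maxV]] := @zorn_nonempty A good W.
  move=> F [X0 FX0] Fg tot; split.
  - split; first by exists X0 => //; have [[]] := Fg _ FX0.
    + move=> x y [X FX Xx] [Y FY Yy].
      have [XY|YX] := tot _ _ FX FY.
        by exists Y => //; have [[_ + _] _ _] := Fg _ FY; apply=> //; apply: XY.
      by exists X => //; have [[_ + _] _ _] := Fg _ FX; apply=> //; apply: YX.
    + move=> k x Kk [X FX Xx]; exists X => //.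
      by have [[_ _ +] _ _] := Fg _ FX; apply.
  - by move=> w Ww; exists X0 => //; have [_ H _] := Fg _ FX0; apply: H.
  - by move=> [X FX X1]; have [_ _] := Fg _ FX.
have VN x : V x -> V (- x).
  by move=> Vx; rewrite -mulN1r; apply: VK => //; apply: (dsubN dK (dsub1 dK)).
have ex x : exists k, K k /\ V (x - k).
  have [Vx|nVx] := EM (V x).
    by exists 0; rewrite subr0; split=> //; apply: (dsub0 dK).
  pose V' : set A := fun y => exists v k, [/\ V v, K k & y = v + k * x].
  have V'x : V' x by exists 0, 1; split=> //; [exact: (dsub1 dK)|rewrite mul1r add0r].
  have VV' : (V `<=` V')%classic.
    move=> v Vv; exists v, 0; split=> //; [exact: (dsub0 dK)|by rewrite mul0r addr0].
  (* By maximality the span of [V] and [x] contains 1. From [1 = v + k * x] it follows that [x] is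
     congruent to [k^-1]. *)
  have [v [k [Vv Kk E]]] : V' 1.
    apply: contrapT => nV'1; apply/nVx/(maxV V') => //; split=> //.
    - split; first exact: VV'.
      + move=> _ _ [v [k [Vv Kk ->]]] [w [l [Vw Kl ->]]].
        exists (v + w), (k + l); split; [exact: VD|exact: (dsubD dK)|ring].
      + move=> k _ Kk [w [l [Vw Kl ->]]]; exists (k * w), (k * l).
        by split; [exact: VK|exact: (dsubM dK)|ring].
    - by move=> w /WV /VV'.
  have k0 : k != 0 by apply/eqP => k0; apply: V1; rewrite E k0 mul0r addr0.
  exists k^-1; split; first exact: (dsubV dK).
  have -> : x - k^-1 = k^-1 * (- v).
    by rewrite -[X in _ - X]mulr1 E mulrDr mulKf // mulrN opprD addrCA subrr addr0.
  by apply: VK; [exact: (dsubV dK)|exact: VN].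
have [f fP] := choice ex.
have uniq x k : K k -> V (x - k) -> f x = k.
  move=> Kk Vk; have [Kf Vf] := fP x; apply/eqP; rewrite -subr_eq0.
  apply/negP => /negP d0; apply: V1.
  rewrite -[1](mulVf d0); apply: VK; first exact/(dsubV dK)/(dsubB dK).
  have -> : f x - k = (x - k) + - (x - f x) by ring.
  by apply: VD => //; apply: VN.
exists f; split.
- split=> [x y|k x Kk].
    have [K1 V1'] := fP x; have [K2 V2] := fP y.
    apply: uniq; first exact: (dsubD dK).
    have -> : x + y - (f x + f y) = (x - f x) + (y - f y) by ring.
    exact: VD.
  have [K1 V1'] := fP x; apply: uniq; first exact: (dsubM dK).
  by rewrite -mulrBr; apply: VK.
- by apply: uniq; [exact: (dsub1 dK)|rewrite subrr].
- by move=> w Ww; apply: uniq; [exact: (dsub0 dK)|rewrite subr0; apply: WV].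
Qed.

Lemma deriv_neq0 (p : {poly A}) : (1 < size p)%N -> p^`() != 0.
Proof.
move=> p1; apply/eqP => p0.
have := coef_deriv p (size p).-2; rewrite p0 coef0 => /esym/eqP.
rewrite -mulr_natr mulf_eq0 (proj1 (pcharf0P A) char0) orbF.
have -> : (size p).-2.+1 = (size p).-1 by case: (size p) p1 => [|[]].
rewrite lead_coef_eq0 => /eqP pz.
by move: p1; rewrite pz size_poly0.
Qed.

(** As long as [c] is also a root of the derivative, pass to the derivative. It is nonzero in
    characteristic 0, because a nonzero polynomial with a root is not constant. *)
Lemma separable_annihilator (c : A) (p : {poly A}) :
  (forall i, K p`_i) -> p != 0 -> p.[c] = 0 ->
  exists q : {poly A}, [/\ forall i, K q`_i, q.[c] = 0 & q^`().[c] != 0].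
Proof.
move: {2}(size p) (leqnn (size p)) => n.
elim: n p => [|n IH] p; first by rewrite leqn0 size_poly_eq0 => /eqP -> _ /eqP.
move=> sp Kp p0 pc.
have [H|H] := eqVneq p^`().[c] 0; last by exists p.
have p1 : (1 < size p)%N.
  rewrite ltnNge; apply/negP => /size1_polyC E.
  by move: p0 pc; rewrite E hornerC polyC_eq0 => /eqP.
apply: (IH p^`()) => //; last exact: deriv_neq0.
  by rewrite -ltnS (leq_trans _ sp) // lt_size_deriv.
by move=> i; rewrite coef_deriv; apply: (dsub_muln dK).
Qed.

Lemma horner_taylor1 (R : comNzRingType) (p : {poly R}) (x h : R) :
  exists w, p.[x + h] = p.[x] + h * (p^`().[x] + h * w).
Proof.
elim/poly_ind: p => [|p c [w IH]].
  by exists 0; rewrite deriv0 !horner0; ring.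
exists (p^`().[x] + w * (x + h)).
by rewrite !hornerMXaddC IH derivD derivM derivX derivC !hornerE; ring.
Qed.

Local Notation tl := (@tleft A K).
Local Notation tr := (@tright A K).

(* If [1] is not in the [K]-span of the positive powers of [c], a functional with value [1] at
   [1] and [0] on that span sends [u^k] to [(-c)^k]. Otherwise [c] is a simple root of some [q]
   over [K], and Taylor's formula gives [u (q'(1 (x) c) + u w) = 0], so [u] nilpotent forces
   [u = 0], against a functional with values [1] at [1] and [0] at [c]. *)
Lemma tensor_diff_not_nilp (c : A) : ~ K c -> forall k, (tl c - tr c) ^+ k != 0.
Proof.
move=> nKc k; set u := tl c - tr c.
have c0 : c != 0 by apply/eqP => c0; apply: nKc; rewrite c0; apply: (dsub0 dK).
pose W (w : A) := exists p : {poly A}, (forall i, K p`_i) /\ w = (p * 'X).[c].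
have [[p [Kp E]]|nW1] := EM (W 1).
  have p1 : (1 - p * 'X).[c] = 0 by rewrite hornerD hornerN hornerC -E subrr.
  have [|||q [Kq qc dqc]] := @separable_annihilator c (1 - p * 'X).
  - move=> i; rewrite coefB coef1 coefMX; apply: (dsubB dK).
      exact: (dsub_nat dK).
    by case: (i == 0)%N => //; apply: (dsub0 dK).
  - apply/eqP => /(congr1 (fun q : {poly A} => q.[0])).
    by rewrite !hornerE subr0 => /eqP; rewrite oner_eq0.
  - by [].
  have lr : map_poly tl q = map_poly tr q.
    by apply/polyP => i; rewrite !coef_map; apply: tleft_right.
  have [w] := horner_taylor1 (map_poly tr q) (tr c) u.
  have -> : tr c + u = tl c by rewrite addrC subrK.
  rewrite -{1}lr deriv_map !horner_map qc !rmorph0 add0r => /esym E0.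
  have uE : u = u * (- (tr (q^`().[c])^-1 * u * w)).
    have := congr1 (fun z => tr (q^`().[c])^-1 * z) E0; rewrite mulr0.
    have -> : tr (q^`().[c])^-1 * (u * (tr q^`().[c] + u * w)) =
      u * (tr (q^`().[c])^-1 * tr q^`().[c]) + u * (tr (q^`().[c])^-1 * u * w) by ring.
    by rewrite -rmorphM mulVf // rmorph1 mulr1 => /eqP; rewrite addr_eq0 -mulrN => /eqP.
  have uk m : u = u * (- (tr (q^`().[c])^-1 * u * w)) ^+ m.
    elim: m => [|m IH]; first by rewrite expr0 mulr1.
    by rewrite exprS mulrA -uE -IH.
  apply/eqP => uk0.
  have u0 : u = 0.
    rewrite (uk k) exprNn exprMn exprMn uk0; ring.
  have [||||f [Hf f1 fW]] := @klin_functional (fun w => exists2 k, K k & w = k * c).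
  - by exists 0; [exact: (dsub0 dK)|rewrite mul0r].
  - move=> _ _ [a Ka ->] [b Kb ->]; exists (a + b); [exact: (dsubD dK)|ring].
  - move=> a _ Ka [b Kb ->]; exists (a * b); [exact: (dsubM dK)|ring].
  - case=> a Ka E1; apply: nKc.
    have a0 : a != 0 by apply/eqP => a0; move/eqP: E1; rewrite a0 mul0r oner_eq0.
    by rewrite -[c](mulKf a0) -E1 mulr1; apply: (dsubV dK).
  have : tapp f (tl c * tr 1 + tl 1 * tr (- c)) = 0.
    by rewrite rmorphN !rmorph1 mulr1 mul1r -/u u0 tapp0.
  rewrite tappD // !tapp_lr // f1 (fW c); last by exists 1; [exact: (dsub1 dK)|rewrite mul1r].
  by rewrite mul0r add0r mul1r => /eqP; rewrite oppr_eq0 (negPf c0).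
have [||||f [Hf f1 fW]] := @klin_functional W.
- by exists 0; split=> [i|]; rewrite ?mul0r ?horner0 ?coef0 //; apply: (dsub0 dK).
- move=> _ _ [p [Kp ->]] [q [Kq ->]]; exists (p + q); split=> [i|].
    by rewrite coefD; apply: (dsubD dK).
  by rewrite mulrDl hornerD.
- move=> a _ Ka [p [Kp ->]]; exists (a *: p); split=> [i|].
    by rewrite coefZ; apply: (dsubM dK).
  by rewrite -scalerAl hornerZ.
- exact: nW1.
apply/eqP => uk0.
have : tapp f (\sum_(i < k.+1) tl (c ^+ (k - i)) * tr ((- c) ^+ i *+ 'C(k, i))) = 0.
  transitivity (tapp f (u ^+ k)); last by rewrite uk0 tapp0.
  rewrite /u exprDn; congr (tapp f _); apply: eq_bigr => i _.
  by rewrite -rmorphN -!rmorphXn -mulrnAr rmorphMn.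
rewrite tapp_sum // big_ord_recr /= tapp_lr // subnn expr0 f1 mul1r binn.
rewrite big1 => [|i _].
  by rewrite add0r => /eqP; rewrite expf_eq0 oppr_eq0 (negPf c0) andbF.
rewrite tapp_lr // fW ?mul0r //.
exists 'X^((k - i).-1); split.
  by move=> j; rewrite coefXn; apply: (dsub_nat dK).
by rewrite -exprSr prednK ?subn_gt0 // hornerXn.
Qed.

(** Both tensor factors are all of [A]: through [i1] the field [B] is an extension to which
    [differentially_closed] applies, while [i2] supplies a second copy of the generators of L inside
    [B]. *)
Lemma two_embeddings (c : A) : ~ K c ->
  exists (B : fieldType) (DB : B -> B) (i1 i2 : {rmorphism A -> B}),
    [/\ is_derivation DB, forall x, i1 (D x) = DB (i1 x),
      forall x, i2 (D x) = DB (i2 x), forall k, K k -> i1 k = i2 k & i1 c <> i2 c].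
Proof.
move=> nKc.
have Kd x : K x -> K (D x) by exact: (dsubd dK) x.
have [|||B [DB [h [dB hD hu]]]] :=
    @diff_field_quotient (tensor K) (@tderT A K D) (tl c - tr c) _ _ _
      (tensor_diff_not_nilp nKc).
- exact: tderD.
- exact: tderM.
- move=> n; exists (tl (n.+1%:R^-1)).
  rewrite -(rmorph_nat tl) -rmorphM mulVf ?rmorph1 //.
  by rewrite (proj1 (pcharf0P A) char0).
exists B, DB, (h \o tl), (h \o tr); split=> //=.
- by move=> x; rewrite -hD -tder_left.
- by move=> x; rewrite -hD -tder_right.
- by move=> k Kk; rewrite tleft_right.
- by move=> E; apply: hu; rewrite rmorphB E subrr.
Qed.

End TwoEmbeddings.

(** * Linear disjointness from the constants *)

Section DerivationField.
Variables (A : fieldType) (D : A -> A).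
Hypothesis derD : is_derivation D.

Lemma derD_add x y : D (x + y) = D x + D y. Proof. by case: derD. Qed.
Lemma derD_mul x y : D (x * y) = D x * y + x * D y. Proof. by case: derD. Qed.
Lemma derD0 : D 0 = 0. Proof. exact: (@derivation0 A D derD_add). Qed.
Lemma derD1 : D 1 = 0. Proof. exact: (@derivation1 A D derD_mul). Qed.
Lemma derDN x : D (- x) = - D x. Proof. exact: (@derivationN A D derD_add). Qed.
Lemma derDB x y : D (x - y) = D x - D y. Proof. exact: (@derivationB A D derD_add). Qed.
Lemma derD_sum (I : Type) (r : seq I) (P : pred I) (f : I -> A) :
  D (\sum_(i <- r | P i) f i) = \sum_(i <- r | P i) D (f i).
Proof. exact: (big_morph D derD_add derD0). Qed.
Lemma derD_div x y : y != 0 -> D (x / y) = (D x * y - x * D y) / y ^+ 2.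
Proof.
move=> y0; have := derD_mul (x / y) y; rewrite divfK // => ->.
by field; rewrite y0.
Qed.

Lemma CA_dsubfield : is_dsubfield D (CA D).
Proof.
rewrite /CA; do !split => //.
- exact: derD0.
- exact: derD1.
- by move=> x y Hx Hy; rewrite derDB Hx Hy subr0.
- by move=> x y Hx Hy; rewrite derD_mul Hx Hy mulr0 mul0r addr0.
- move=> x Hx; have [->|x0] := eqVneq x 0; first by rewrite invr0 derD0.
  by rewrite -div1r derD_div // derD1 Hx mulr0 mul0r subrr mul0r.
- by move=> x ->; exact: derD0.
Qed.

Lemma consts_dsubfield (F : A -> Prop) : is_dsubfield D F -> is_dsubfield D (consts D F).
Proof.
move=> dF; have dC := CA_dsubfield; rewrite /consts; do !split => //.
- exact: (dsub0 dF).
- exact: (dsub0 dC).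
- exact: (dsub1 dF).
- exact: (dsub1 dC).
- by move: H H0 => [? _] [? _]; apply: (dsubB dF).
- by move: H H0 => [_ ?] [_ ?]; apply: (dsubB dC).
- by move: H H0 => [? _] [? _]; apply: (dsubM dF).
- by move: H H0 => [_ ?] [_ ?]; apply: (dsubM dC).
- by move: H => [? _]; apply: (dsubV dF).
- by move: H => [_ ?]; apply: (dsubV dC).
- by move: H => [? _]; apply: (dsubd dF).
- by move: H => [_ ?]; apply: (dsubd dC).
Qed.

Lemma dgen_dsubfield (S : A -> Prop) : is_dsubfield D (dgen D S).
Proof.
rewrite /dgen; do !split.
- by move=> F dF _; exact: (dsub0 dF).
- by move=> F dF _; exact: (dsub1 dF).
- by move=> x y Hx Hy F dF SF; apply: (dsubB dF); [exact: Hx|exact: Hy].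
- by move=> x y Hx Hy F dF SF; apply: (dsubM dF); [exact: Hx|exact: Hy].
- by move=> x Hx F dF SF; apply: (dsubV dF); exact: Hx.
- by move=> x Hx F dF SF; apply: (dsubd dF); exact: Hx.
Qed.

Lemma dgen_incl (S : A -> Prop) x : S x -> dgen D S x.
Proof. by move=> Sx F _; apply. Qed.

Section LinearDisjointness.
Variable L : A -> Prop.
Hypothesis dL : is_dsubfield D L.

(* The space of constant solutions of a linear equation over [L] is spanned by
   its solutions with coordinates in the constants of [L]. *)
Lemma constant_relations N (l c : nat -> A) :
  (forall i, (i < N)%N -> L (l i)) -> (forall i, (i < N)%N -> D (c i) = 0) ->
  \sum_(i < N) l i * c i = 0 ->
  exists (r : nat) (d : nat -> A) (q : nat -> nat -> A),
    [/\ forall j, D (d j) = 0, forall i j, consts D L (q i j),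
      forall i, (i < N)%N -> c i = \sum_(j < r) q i j * d j &
      forall j, \sum_(i < N) l i * q i j = 0].
Proof.
have C0 : consts D L 0 by split; [exact: (dsub0 dL)|exact: derD0].
elim: N l => [|N IH] l Ll Dc.
  exists 0%N, (fun _ => 0), (fun _ _ => 0); split=> //; [by move=> _; exact: derD0|].
  by move=> j; rewrite big_ord0.
rewrite big_ord_recr /=.
(* A vanishing last coefficient leaves [c N] free, so [c N] itself becomes the additional parameter,
   with index [r]. *)
have [lN|lN] := eqVneq (l N) 0.
  rewrite lN mul0r addr0 => E.
  have [||r [d [q [Dd Cq cE qE]]]] := IH _ _ _ E.
  - by move=> i iN; apply: Ll; apply: ltnW.
  - by move=> i iN; apply: Dc; apply: ltnW.
  exists r.+1, (fun j => if j == r then c N else d j),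
    (fun i j => if (j < r)%N then (if i == N then 0 else q i j) else
      if (i == N) && (j == r) then 1 else 0); split.
  - by move=> j; case: ifP => // _; apply: Dc.
  - move=> i j; case: ifP => _; case: ifP => _ //.
    by split; [exact: (dsub1 dL)|exact: derD1].
  - move=> i iN; rewrite big_ord_recr /= ltnn eqxx andbT.
    case: (eqVneq i N) iN => [-> _|iN]; rewrite /=.
      by rewrite mul1r big1 ?add0r // => j _; rewrite ltn_ord mul0r.
    rewrite ltnS leq_eqVlt (negPf iN) /= mul0r addr0 => /cE ->.
    by apply: eq_bigr => j _; rewrite ltn_ord ltn_eqF.
  - move=> j; rewrite big_ord_recr /= lN mul0r addr0.
    case: ltnP => [jr|rj].
      by apply: etrans (qE j); apply: eq_bigr => i _; rewrite ltn_eqF.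
    by rewrite big1 // => i _; rewrite ltn_eqF //= mulr0.
(* Normalize the last coefficient to 1. Differentiation then eliminates [c N] and leaves a shorter
   relation with coefficients [D (l i / l N)]. For each solution [q] of it the sum [w j] has
   derivative 0, hence is a constant of [L], and [- w j] is the missing last coordinate. *)
move=> E; have LlN : L (l N) by apply: Ll.
have E' : \sum_(i < N) l i / l N * c i + c N = 0.
  transitivity ((l N)^-1 * (\sum_(i < N) l i * c i + l N * c N)); last by rewrite E mulr0.
  rewrite mulrDr mulKf // mulr_sumr; congr (_ + _).
  by apply: eq_bigr => i _; ring.
have [|||r [d [q [Dd Cq cE qE]]]] := IH (fun i => D (l i / l N)).
- move=> i iN; apply: (dsubd dL); apply: (dsub_div dL) => //; apply: Ll; exact: ltnW.
- by move=> i iN; apply: Dc; apply: ltnW.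
- have := congr1 D E'; rewrite derD0 derD_add (Dc N) // addr0 derD_sum; apply: etrans.
  by apply: eq_bigr => i _; rewrite [RHS]derD_mul (Dc i (ltnW (ltn_ord i))) mulr0 addr0.
pose w j := \sum_(i < N) l i / l N * q i j.
have Cw j : consts D L (w j).
  split.
    apply: (dsub_sum dL) => i _; apply: (dsubM dL); last by case: (Cq i j).
    by apply: (dsub_div dL) => //; apply: Ll; exact: (ltnW (ltn_ord i)).
  rewrite derD_sum; apply: etrans (qE j); apply: eq_bigr => i _.
  by rewrite [LHS]derD_mul; case: (Cq i j) => _ ->; rewrite mulr0 addr0.
exists r, d, (fun i j => if i == N then - w j else q i j); split=> //.
- move=> i j; case: ifP => // _; exact: (dsubN (consts_dsubfield dL)).
- move=> i iN; case: (eqVneq i N) iN => [-> _|iN]; last first.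
    by rewrite ltnS leq_eqVlt (negPf iN) /= => /cE.
  have -> : c N = - \sum_(i < N) l i / l N * c i.
    by apply/eqP; rewrite -addr_eq0 addrC E'.
  transitivity (- \sum_(m < N) \sum_(j < r) l m / l N * q m j * d j).
    congr (- _); apply: eq_bigr => m _; rewrite (cE m (ltn_ord m)) mulr_sumr.
    by apply: eq_bigr => j _; rewrite mulrA.
  rewrite exchange_big /= -sumrN; apply: eq_bigr => j _.
  by rewrite mulNr mulr_suml.
- move=> j; rewrite big_ord_recr /= eqxx mulrN /w mulr_sumr.
  apply/eqP; rewrite subr_eq0; apply/eqP/eq_bigr => i _.
  by rewrite ltn_eqF // mulrA mulrCA divff // mulr1.
Qed.

End LinearDisjointness.

(* [H] is the graph of a differential ring homomorphism, fixing the constants of [L],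
   from a subring of [L] to [A]. *)
Record diff_graph (L : A -> Prop) (H : A -> A -> Prop) : Prop := DiffGraph {
  dg_const : forall q, consts D L q -> H q q;
  dg_sub : forall x y x' y', H x y -> H x' y' -> H (x - x') (y - y');
  dg_mul : forall x y x' y', H x y -> H x' y' -> H (x * x') (y * y');
  dg_der : forall x y, H x y -> H (D x) (D y);
  dg_dom : forall x y, H x y -> L x;
  dg_zero : forall y, H 0 y -> y = 0
}.

Arguments dg_sub {L H} _ {x y x' y'}.
Arguments dg_mul {L H} _ {x y x' y'}.
Arguments dg_der {L H} _ {x y}.
Arguments dg_dom {L H} _ {x y}.

Section ConstantExtension.
Variables (L : A -> Prop) (H : A -> A -> Prop).
Hypothesis dL : is_dsubfield D L.
Hypothesis dgH : diff_graph L H.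

(** The extension of [H] to constant combinations is a relation because one element has many
    expressions as such a sum; independence of the expression is the content of [const_ext_fun0]. *)
Inductive const_ext : A -> A -> Prop :=
| ConstExt0 : const_ext 0 0
| ConstExtS l l' c r r' : H l l' -> D c = 0 -> const_ext r r' ->
    const_ext (l * c + r) (l' * c + r').

Lemma H00 : H 0 0.
Proof. by apply: (dg_const dgH); split; [exact: (dsub0 dL)|exact: derD0]. Qed.
Lemma H11 : H 1 1.
Proof. by apply: (dg_const dgH); split; [exact: (dsub1 dL)|exact: derD1]. Qed.
Lemma HD x y x' y' : H x y -> H x' y' -> H (x + x') (y + y').
Proof.
move=> h h'; have := (dg_sub dgH) h ((dg_sub dgH) H00 h').
by rewrite !sub0r !opprK.
Qed.

Lemma const_ext1 l l' c : H l l' -> D c = 0 -> const_ext (l * c) (l' * c).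
Proof. by move=> h Dc; rewrite -[l * c]addr0 -[l' * c]addr0; apply: ConstExtS => //; exact: ConstExt0. Qed.

Lemma const_extD x y x' y' : const_ext x y -> const_ext x' y' ->
  const_ext (x + x') (y + y').
Proof.
move=> h h'; elim: h => [|l l' c r r' hl Dc _ IH]; first by rewrite !add0r.
by rewrite -!addrA; constructor.
Qed.

Lemma const_extM1 l l' c x y : H l l' -> D c = 0 -> const_ext x y ->
  const_ext (l * c * x) (l' * c * y).
Proof.
move=> h Dc; elim=> [|m m' d r r' hm Dd _ IH]; first by rewrite !mulr0; constructor.
have -> : l * c * (m * d + r) = l * m * (c * d) + l * c * r by ring.
have -> : l' * c * (m' * d + r') = l' * m' * (c * d) + l' * c * r' by ring.
by constructor => //; [exact: (dg_mul dgH)|rewrite derD_mul Dc Dd mulr0 mul0r addr0].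
Qed.

Lemma const_extM x y x' y' : const_ext x y -> const_ext x' y' ->
  const_ext (x * x') (y * y').
Proof.
move=> h h'; elim: h => [|l l' c r r' hl Dc _ IH].
  by rewrite !mul0r; constructor.
by rewrite !mulrDl; apply: const_extD => //; apply: const_extM1.
Qed.

Lemma const_extN x y : const_ext x y -> const_ext (- x) (- y).
Proof.
move=> h; have := const_extM1 H11 (c := -1) _ h.
by rewrite !mul1r !mulN1r; apply; rewrite derDN derD1 oppr0.
Qed.

Lemma const_ext_der x y : const_ext x y -> const_ext (D x) (D y).
Proof.
elim=> [|l l' c r r' hl Dc _ IH]; first by rewrite derD0; constructor.
by rewrite !derD_add !derD_mul !Dc !mulr0 !addr0; constructor => //; apply: (dg_der dgH).
Qed.

Lemma const_ext_sum x y : const_ext x y -> exists (N : nat) (l l' c : nat -> A),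
  [/\ forall i, H (l i) (l' i), forall i, D (c i) = 0,
    x = \sum_(i < N) l i * c i & y = \sum_(i < N) l' i * c i].
Proof.
elim=> [|l l' c r r' hl Dc _ [N [m [m' [d [Hm Dd -> ->]]]]]].
  exists 0%N, (fun _ => 0), (fun _ => 0), (fun _ => 0).
  by rewrite !big_ord0; split=> // _; [exact: H00|exact: derD0].
exists N.+1, (fun i => if i == N then l else m i), (fun i => if i == N then l' else m' i),
  (fun i => if i == N then c else d i).
split; try by move=> i; case: ifP.
- rewrite big_ord_recr /= eqxx addrC; congr (_ + _).
  by apply: eq_bigr => i _; rewrite ltn_eqF.
- rewrite big_ord_recr /= eqxx addrC; congr (_ + _).
  by apply: eq_bigr => i _; rewrite ltn_eqF.
Qed.

Lemma H_sum N (f g : nat -> A) : (forall i, H (f i) (g i)) ->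
  H (\sum_(i < N) f i) (\sum_(i < N) g i).
Proof.
move=> h; elim: N => [|N IH]; first by rewrite !big_ord0; exact: H00.
by rewrite !big_ord_recr /=; apply: HD.
Qed.

(** A relation between the [l i] with constant coefficients is a combination of relations whose
    coefficients [q i j] are constants of [L]. [H] fixes these coefficients, so it carries each such
    relation to a relation between the [l' i]. *)
Lemma const_ext_fun0 y : const_ext 0 y -> y = 0.
Proof.
move=> /const_ext_sum [N [l [l' [c [Hl Dc /esym E ->]]]]].
have [||r [d [q [Dd Cq cE qE]]]] := constant_relations dL _ _ E.
- by move=> i _; apply: (dg_dom dgH) (Hl i).
- by move=> i _; apply: Dc.
under eq_bigr => m _ do rewrite (cE m (ltn_ord m)) mulr_sumr.
rewrite exchange_big big1 //= => j _.
transitivity ((\sum_(i < N) l' i * q i j) * d j).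
  by rewrite mulr_suml; apply: eq_bigr => i _; rewrite mulrA.
have h : H (\sum_(i < N) l i * q i j) (\sum_(i < N) l' i * q i j).
  apply: (@H_sum N (fun i => l i * q i j) (fun i => l' i * q i j)) => i.
  by apply: (dg_mul dgH) => //; apply: (dg_const dgH).
by rewrite (@dg_zero _ _ dgH (\sum_(i < N) l' i * q i j)) ?mul0r // -[X in H X _](qE j).
Qed.

(** Both denominators are required to be nonzero, since [H] may be a specialization that sends
    nonzero elements to 0. *)
Definition frac_ext (u v : A) : Prop :=
  exists r r' q q', [/\ const_ext r r', const_ext q q', q != 0 /\ q' != 0, u = r / q & v = r' / q'].

Lemma frac_ext_of r r' : const_ext r r' -> frac_ext r r'.
Proof.
move=> h; exists r, r', 1, 1; rewrite !divr1; split=> //.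
  by have := const_ext1 H11 derD1; rewrite mulr1.
by rewrite oner_neq0.
Qed.

Lemma frac_ext_H l l' : H l l' -> frac_ext l l'.
Proof. by move=> h; apply: frac_ext_of; have := const_ext1 h derD1; rewrite !mulr1. Qed.

Lemma frac_ext_const c : D c = 0 -> frac_ext c c.
Proof. by move=> Dc; apply: frac_ext_of; have := const_ext1 H11 Dc; rewrite mul1r. Qed.

Lemma frac_extD x y x' y' : frac_ext x y -> frac_ext x' y' -> frac_ext (x + x') (y + y').
Proof.
move=> [r [r' [q [q' [hr hq [q0 q0'] -> ->]]]]] [t [t' [w [w' [ht hw [w0 w0'] -> ->]]]]].
exists (r * w + t * q), (r' * w' + t' * q'), (q * w), (q' * w'); split.
- by apply: const_extD; apply: const_extM.
- exact: const_extM.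
- by rewrite !mulf_neq0.
- by rewrite addf_div.
- by rewrite addf_div.
Qed.

Lemma frac_extM x y x' y' : frac_ext x y -> frac_ext x' y' -> frac_ext (x * x') (y * y').
Proof.
move=> [r [r' [q [q' [hr hq [q0 q0'] -> ->]]]]] [t [t' [w [w' [ht hw [w0 w0'] -> ->]]]]].
exists (r * t), (r' * t'), (q * w), (q' * w'); split.
- exact: const_extM.
- exact: const_extM.
- by rewrite !mulf_neq0.
- by rewrite mulf_div.
- by rewrite mulf_div.
Qed.

Lemma frac_extN x y : frac_ext x y -> frac_ext (- x) (- y).
Proof.
move=> [r [r' [q [q' [hr hq h -> ->]]]]].
by exists (- r), (- r'), q, q'; rewrite !mulNr; split=> //; apply: const_extN.
Qed.

Lemma frac_extB x y x' y' : frac_ext x y -> frac_ext x' y' -> frac_ext (x - x') (y - y').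
Proof. by move=> h h'; apply: frac_extD => //; apply: frac_extN. Qed.

Lemma frac_ext_der x y : frac_ext x y -> frac_ext (D x) (D y).
Proof.
move=> [r [r' [q [q' [hr hq [q0 q0'] -> ->]]]]]; rewrite !derD_div //.
exists (D r * q - r * D q), (D r' * q' - r' * D q'), (q ^+ 2), (q' ^+ 2); split=> //.
- apply: const_extD; first by apply: const_extM => //; apply: const_ext_der.
  by apply/const_extN/const_extM => //; apply: const_ext_der.
- by rewrite !expr2; apply: const_extM.
- by rewrite !expf_neq0.
Qed.

Lemma frac_ext_fun0 y : frac_ext 0 y -> y = 0.
Proof.
move=> [r [r' [q [q' [hr hq [q0 q0'] /esym/eqP + ->]]]]].
rewrite mulf_eq0 invr_eq0 (negPf q0) orbF => /eqP r0.
by rewrite (@const_ext_fun0 r') ?mul0r // -r0.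
Qed.

Lemma frac_ext_fun x y y' : frac_ext x y -> frac_ext x y' -> y = y'.
Proof.
move=> h h'; apply/eqP; rewrite -subr_eq0; apply/eqP/frac_ext_fun0.
by have := frac_extB h h'; rewrite subrr.
Qed.

(** The premise excludes a nonzero [x] specializing to 0, whose inverse has no image; for [x = 0]
    the convention that the inverse of 0 is 0 is respected. *)
Lemma frac_extV x y : y != 0 \/ x = 0 -> frac_ext x y -> frac_ext x^-1 y^-1.
Proof.
move=> [y0|x0] h; last first.
  move: h; rewrite x0 => /frac_ext_fun0 ->; rewrite invr0; exact: frac_ext_const derD0.
case: h y0 => [r [r' [q [q' [hr hq [q0 q0'] -> ->]]]]] y0.
have r0' : r' != 0 by apply: contraNneq y0 => ->; rewrite mul0r.
have r0 : r != 0.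
  by apply: contraNneq r0' => r0; rewrite (@const_ext_fun0 r') // -r0.
by exists q, q', r, r'; split=> //; rewrite invf_div.
Qed.

Lemma frac_ext_deval (K : A -> Prop) (e e' : nat -> A) t :
  (forall k, K k -> H k k) -> (forall i, frac_ext (e i) (e' i)) ->
  dterm_params K t -> frac_ext (deval D e t) (deval D e' t).
Proof.
move=> HK He; elim: t => //=.
- by move=> c /HK /frac_ext_H.
- by move=> _; apply: frac_ext_const derD0.
- by move=> _; apply: frac_ext_const derD1.
- by move=> t IHt u IHu [/IHt ht /IHu hu]; apply: frac_extD.
- by move=> t IHt /IHt; apply: frac_extN.
- by move=> t IHt u IHu [/IHt ht /IHu hu]; apply: frac_extM.
- by move=> t IHt /IHt; apply: frac_ext_der.
Qed.

End ConstantExtension.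
End DerivationField.

(** * Saturation for tuples *)

Lemma all_list_cat (T : Type) (P : T -> Prop) (s t : seq T) :
  all_list P (s ++ t) <-> all_list P s /\ all_list P t.
Proof. by elim: s => [|a s IH] /=; [tauto|rewrite IH; tauto]. Qed.

Lemma all_list_sub (T : Type) (P Q : T -> Prop) (s : seq T) :
  (forall x, P x -> Q x) -> all_list P s -> all_list Q s.
Proof. by move=> PQ; elim: s => //= a s IH [/PQ ? /IH]. Qed.

Section Formulas.
Variables (B : fieldType) (DB : B -> B).

Lemma deval_ext (e e' : nat -> B) t : e =1 e' -> deval DB e t = deval DB e' t.
Proof. by move=> E; elim: t => //= [u -> v ->|u ->|u -> v ->|u ->]. Qed.

Lemma dholds_ext (e e' : nat -> B) f : e =1 e' -> dholds DB e f <-> dholds DB e' f.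
Proof.
elim: f e e' => [||t u|g IH|g IHg h IHh|g IHg h IHh|i g IH|i g IH] e e' E //=.
- by rewrite !(deval_ext _ E).
- by rewrite (IH _ _ E).
- by rewrite (IHg _ _ E) (IHh _ _ E).
- by rewrite (IHg _ _ E) (IHh _ _ E).
- have H x : dholds DB (upd e i x) g <-> dholds DB (upd e' i x) g.
    by apply: IH => j; rewrite /upd E.
  by split=> -[x /H]; exists x.
- have H x : dholds DB (upd e i x) g <-> dholds DB (upd e' i x) g.
    by apply: IH => j; rewrite /upd E.
  by split=> Hx x; apply/H.
Qed.

Fixpoint dand_list (fs : seq (dformula B)) : dformula B :=
  if fs is f :: fs' then DAnd f (dand_list fs') else DTrue.

Lemma dholds_and_list e fs : dholds DB e (dand_list fs) <-> all_list (dholds DB e) fs.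
Proof. by elim: fs => //= f fs ->. Qed.

Lemma dand_list_params P fs :
  all_list (dformula_params P) fs -> dformula_params P (dand_list fs).
Proof. by elim: fs => //= f fs IH [Hf /IH]. Qed.

Fixpoint dex_list (vs : seq nat) (f : dformula B) : dformula B :=
  if vs is i :: vs' then DEx i (dex_list vs' f) else f.

Lemma dex_list_params P vs f : dformula_params P f -> dformula_params P (dex_list vs f).
Proof. by elim: vs. Qed.

Lemma dholds_ex_list e vs f : dholds DB e (dex_list vs f) <->
  exists e', (forall j, j \notin vs -> e' j = e j) /\ dholds DB e' f.
Proof.
elim: vs e => [|i vs IH] e /=.
  split=> [H|[e' [E H]]]; first by exists e.
  by apply/(@dholds_ext e' e) => // j; apply: E.
split=> [[x /IH [e' [E H]]]|[e' [E H]]].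
  exists e'; split=> // j; rewrite in_cons negb_or => /andP [ji jvs].
  by rewrite E // /upd (negPf ji).
exists (e' i); apply/IH; exists e'; split=> // j jvs; rewrite /upd.
by case: (eqVneq j i) => [-> //|ji]; apply: E; rewrite in_cons negb_or ji.
Qed.

(* [pin_formula n k b fs] says of the value of variable 0 that it can be completed,
   as the [k]-th entry, to an [n]-tuple extending [b] and satisfying [fs];
   variable [n] is used to move the value out of the way of the quantifiers. *)
Definition pin_formula (n k : nat) (b : nat -> B) (fs : seq (dformula B)) : dformula B :=
  DEx n (DAnd (DEq (DVar B n) (DVar B 0)) (dex_list (iota 0 n)
   (DAnd (dand_list [seq DEq (DVar B i) (DConst (b i)) | i <- iota 0 k])
   (DAnd (DEq (DVar B k) (DVar B n)) (DEx n (DAnd (DEq (DVar B n) DZero)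
      (dand_list fs))))))).

Lemma pin_formulaP n k b fs z : (k < n)%N ->
  dholds DB (env1 z) (pin_formula n k b fs) <->
  exists e, [/\ forall i, (n <= i)%N -> e i = 0, forall i, (i < k)%N -> e i = b i,
    e k = z & all_list (dholds DB e) fs].
Proof.
move=> kn; have n0 : (0 < n)%N by apply: leq_ltn_trans kn.
have n0' : (0 == n)%N = false by rewrite eq_sym eqn0Ngt n0.
have kn' : (k == n)%N = false by rewrite ltn_eqF.
have nn x (f : nat -> B) : upd f n x n = x by rewrite /upd eqxx.
split.
  rewrite /pin_formula /= => -[x []]; rewrite nn /upd n0' /env1 /= => -> {x}.
  move=> /dholds_ex_list [e [E /= [/dholds_and_list Hb [Hk [x [Hx /dholds_and_list H]]]]]].
  rewrite nn in Hx; have En : e n = z by rewrite E ?eqxx // mem_iota ltnn.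
  exists (upd e n x); split=> //; rewrite /upd.
  - move=> i; rewrite leq_eqVlt => /orP [/eqP <-|ni]; first by rewrite eqxx.
    rewrite gtn_eqF // E; last by rewrite mem_iota add0n -leqNgt ltnW.
    by rewrite gtn_eqF // gtn_eqF // (leq_trans n0 (ltnW ni)).
  - move=> i ik; rewrite ltn_eqF; last exact: ltn_trans kn.
    have : i \in iota 0 k by rewrite mem_iota.
    by elim: (iota 0 k) Hb => //= j s IH [H1 /IH H2]; rewrite in_cons => /orP [/eqP ->|/H2].
  - by rewrite kn' Hk.
move=> [e [e0 eb ek H]]; rewrite /pin_formula /=; exists z; rewrite nn /upd n0'.
split=> //; apply/dholds_ex_list.
exists (fun j => if j == n then z else e j); split.
  move=> j; rewrite mem_iota add0n /= -leqNgt => nj; case: eqP => [//|/eqP jn].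
  by rewrite e0 // /env1 gtn_eqF // (leq_trans n0).
rewrite /= eqxx kn'; split; last first.
  split=> //; exists 0; split=> //; apply/dholds_and_list.
  apply: all_list_sub H => f; apply: (proj1 (dholds_ext _ _)) => j.
  by rewrite /upd; case: eqP => [->|//]; apply: e0.
apply/dholds_and_list.
have : forall i, i \in iota 0 k -> (i < k)%N by move=> i; rewrite mem_iota.
elim: (iota 0 k) => //= i s IH Hs; split; last first.
  by apply: IH => j js; apply: Hs; rewrite in_cons js orbT.
have ik : (i < k)%N by apply: Hs; rewrite mem_head.
by rewrite ltn_eqF ?eb // (ltn_trans ik).
Qed.

Lemma pin_formula_params (P : B -> Prop) n k b fs :
  (forall i, (i < k)%N -> P (b i)) -> all_list (dformula_params P) fs ->
  dformula_params P (pin_formula n k b fs).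
Proof.
move=> Pb Pfs /=; split=> //; apply: dex_list_params => /=; split; last first.
  by split=> //; split=> //; apply: dand_list_params.
apply: dand_list_params.
have : forall i, i \in iota 0 k -> (i < k)%N by move=> i; rewrite mem_iota.
elim: (iota 0 k) => //= i s IH Hs; split; first by split=> //; apply: Pb (Hs _ (mem_head _ _)).
by apply: IH => j js; apply: Hs; rewrite in_cons js orbT.
Qed.

(** Realizing a tuple coordinate by coordinate turns each realized value into a parameter, so
    smallness must survive the addition of one point. It does because [P] contains the natural
    numbers and is therefore infinite. *)
Lemma card_lt_add1 (P : B -> Prop) (b : B) : [pchar B] =i pred0 ->
  (forall n : nat, P n%:R) -> card_lt P (fun _ => True) ->
  card_lt (fun x => P x \/ x = b) (fun _ => True).
Proof.
move=> char0 Pn Psmall [f [fP finj]]; apply: Psmall.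
have [Pb|nPb] := EM (P b).
  by exists f; split=> // x _; case: (fP x I) => [//|->].
(* Hilbert's hotel on the copy of the natural numbers in [P]. *)
have ninj (m n : nat) : m%:R = n%:R :> B -> m = n.
  wlog mn : m n / (m <= n)%N.
    by case: (leqP m n) => [mn H|nm H]; [exact: H|move=> E; apply/esym/(H n m (ltnW nm))].
  move=> /esym/eqP; rewrite -subr_eq0 -natrB // (proj1 (pcharf0P B) char0) subn_eq0 => nm.
  by apply/eqP; rewrite eqn_leq mn.
pose h (y : B) : B := if y == b then 0 else
  if pselect (exists n : nat, y = n%:R) is left ex then (projT1 (cid ex)).+1%:R else y.
have hn n : h n%:R = n.+1%:R.
  rewrite /h; case: eqP => [E|_]; first by case: nPb; rewrite -E.
  case: pselect => [ex|]; last by case; exists n.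
  by congr (_.+1%:R); apply/ninj; rewrite -(projT2 (cid ex)).
have ho y : y <> b -> (forall n : nat, y <> n%:R) -> h y = y.
  move=> yb yn; rewrite /h; case: eqP => // _.
  by case: pselect => // -[n E]; case: (yn n).
have hb : h b = 0%:R by rewrite /h eqxx.
have cases y : [\/ y = b, exists n : nat, y = n%:R |
    y <> b /\ forall n : nat, y <> n%:R].
  have [->|yb] := EM (y = b); first by constructor 1.
  have [?|H] := EM (exists n : nat, y = n%:R); first by constructor 2.
  by constructor 3; split=> // n yn; apply: H; exists n.
exists (h \o f); split=> /= [x _|x y _ _ E].
  case: (cases (f x)) => [->|[n ->]|[H1 H2]]; rewrite ?hb ?hn ?ho //.
  by case: (fP x I).
apply: finj => //; move: E.
case: (cases (f x)) => [->|[n ->]|[H1 H2]];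
  case: (cases (f y)) => [->|[m ->]|[H3 H4]]; rewrite ?hb ?hn ?(ho _ H1 H2) ?(ho _ H3 H4) //.
- by move=> /ninj.
- by move=> H; case: (H4 0%N).
- by move=> /ninj.
- by move=> /ninj [->].
- by move=> H; case: (H4 n.+1).
- by move=> H; case: (H2 0%N).
- by move=> H; case: (H2 m.+1).
Qed.

(** [saturated] speaks of one variable. The [k]-th coordinate realizes the type saying that, for
    each finite part of [Sigma], the value can be completed to a tuple that agrees with the
    coordinates already chosen. Entries from [n] on are kept at 0 to match [env1]. *)
Lemma saturated_tuple (P : B -> Prop) (n : nat) (Sigma : dformula B -> Prop) :
  [pchar B] =i pred0 -> saturated DB -> (forall n : nat, P n%:R) ->
  card_lt P (fun _ => True) ->
  (forall f, Sigma f -> dformula_params P f) ->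
  (forall fs, all_list Sigma fs -> exists e : nat -> B,
     (forall i, (n <= i)%N -> e i = 0) /\ all_list (dholds DB e) fs) ->
  exists e : nat -> B, (forall i, (n <= i)%N -> e i = 0) /\
    forall f, Sigma f -> dholds DB e f.
Proof.
move=> char0 sat Pn Psmall SP fin.
have step k : (k <= n)%N -> exists (b : nat -> B) (P' : B -> Prop),
    [/\ forall n : nat, P' n%:R, card_lt P' (fun _ => True), forall x, P x -> P' x,
      forall i, (i < k)%N -> P' (b i) &
      forall fs, all_list Sigma fs -> exists e : nat -> B,
      [/\ forall i, (n <= i)%N -> e i = 0, forall i, (i < k)%N -> e i = b i &
      all_list (dholds DB e) fs]].
  elim: k => [_|k IH kn].
    exists (fun _ => 0), P; split=> // fs /fin [e [e0 He]]; by exists e.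
  have [b [P' [P'n P'small PP' P'b He]]] := IH (ltnW kn).
  pose S1 f := exists fs, all_list Sigma fs /\ f = pin_formula n k b fs.
  have [||z zP] := sat P' P'small S1.
  - move=> _ [fs [Hfs ->]]; apply: pin_formula_params => //.
    apply: all_list_sub Hfs => f /SP.
    clear -PP'.
    have Ht t : dterm_params P t -> dterm_params P' t.
      by elim: t => //= [t1 H1 t2 H2 [/H1 ? /H2]|t1 H1 t2 H2 [/H1 ? /H2]].
    elim: f => //= [t1 t2 [/Ht ? /Ht]|f1 H1 f2 H2 [/H1 ? /H2]|f1 H1 f2 H2 [/H1 ? /H2]] //.
  - move=> Fs HFs.
    (* Finitely many pin formulas all follow from the single one for the concatenation of their
       lists. *)
    have [fs [Hfs H]] : exists fs, all_list Sigma fs /\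
       forall z, dholds DB (env1 z) (pin_formula n k b fs) ->
         all_list (dholds DB (env1 z)) Fs.
      elim: Fs HFs => [_|F Fs IHF [[fs1 [Hfs1 ->]] /IHF [fs2 [Hfs2 H2]]]].
        by exists [::].
      exists (fs1 ++ fs2); split; first by apply/all_list_cat.
      move=> z /(pin_formulaP _ _ _ kn) [e [e1 e2 e3 /all_list_cat [e4 e5]]].
      split; first by apply/(pin_formulaP _ _ _ kn); exists e.
      by apply: H2; apply/(pin_formulaP _ _ _ kn); exists e.
    have [e [e0 eb efs]] := He _ Hfs.
    by exists (e k); apply: H; apply/(pin_formulaP _ _ _ kn); exists e.
  exists (upd b k z), (fun x => P' x \/ x = z); split.
  - by move=> m; left.
  - exact: card_lt_add1.
  - by move=> x /PP'; left.
  - move=> i; rewrite ltnS leq_eqVlt /upd => /orP [/eqP ->|ik].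
      by rewrite eqxx; right.
    by rewrite ltn_eqF //; left; apply: P'b.
  - move=> fs Hfs.
    have /(pin_formulaP _ _ _ kn) [e [e0 eb ek efs]] : dholds DB (env1 z) (pin_formula n k b fs).
      by apply: zP; exists fs.
    exists e; split=> // i; rewrite ltnS leq_eqVlt /upd => /orP [/eqP ->|ik].
      by rewrite eqxx.
    by rewrite ltn_eqF // eb.
have [b [P' [_ _ _ _ H]]] := step n (leqnn n).
exists (fun i => if (i < n)%N then b i else 0); split=> [i|f Sf].
  by rewrite leqNgt => /negPf ->.
have [e [e0 eb [ef _]]] := H [:: f] (conj Sf I).
apply: (proj1 (dholds_ext _ _)) ef => i.
by case: ltnP => [/eb|/e0].
Qed.

End Formulas.

(** * Embeddings and automorphisms *)

Section Extension.
Variables (A : fieldType) (D : A -> A) (K L : A -> Prop).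
Hypothesis derD : is_derivation D.
Hypothesis dK : is_dsubfield D K.
Hypothesis dL : is_dsubfield D L.
Hypothesis KL : forall x, K x -> L x.

Local Notation M := (dgen D (sunion L (CA D))).
Local Notation M0 := (dgen D (sunion K (CA D))).

Lemma M_dsubfield : is_dsubfield D M.
Proof. exact: dgen_dsubfield. Qed.

Lemma L_M x : L x -> M x.
Proof. by move=> Lx; apply: dgen_incl; left. Qed.
Lemma CA_M x : CA D x -> M x.
Proof. by move=> Lx; apply: dgen_incl; right. Qed.
Lemma M0_M x : M0 x -> M x.
Proof.
move=> H; apply: H; first exact: M_dsubfield.
by move=> y [/KL /L_M|/CA_M].
Qed.

Lemma deval_dsubfield (F : A -> Prop) e t : is_dsubfield D F ->
  (forall k, K k -> F k) -> (forall i, F (e i)) -> dterm_params K t -> F (deval D e t).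
Proof.
move=> dF KF Fe; elim: t => //=.
- by move=> _; exact: (dsub0 dF).
- by move=> _; exact: (dsub1 dF).
- by move=> t IHt u IHu [/IHt ? /IHu ?]; apply: (dsubD dF).
- by move=> t IHt /IHt; apply: (dsubN dF).
- by move=> t IHt u IHu [/IHt ? /IHu ?]; apply: (dsubM dF).
- by move=> t IHt /IHt; apply: (dsubd dF).
Qed.

Section HomGraph.
Variable tau : A -> A.
Hypothesis homT : is_Hom D K L tau.

Lemma homD x y : L x -> L y -> tau (x + y) = tau x + tau y.
Proof. by case: homT => H _; apply: H. Qed.
Lemma homM x y : L x -> L y -> tau (x * y) = tau x * tau y.
Proof. by case: homT => _ [H _]; apply: H. Qed.
Lemma hom1 : tau 1 = 1.
Proof. by case: homT => _ [_ [H _]]. Qed.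
Lemma hom_der x : L x -> tau (D x) = D (tau x).
Proof. by case: homT => _ [_ [_ [H _]]]; apply: H. Qed.
Lemma hom_inj x y : L x -> L y -> tau x = tau y -> x = y.
Proof. by case: homT => _ [_ [_ [_ [H _]]]]; apply: H. Qed.
Lemma hom_id x : K x -> tau x = x.
Proof. by case: homT => _ [_ [_ [_ [_ H]]]]; apply: H. Qed.
Lemma hom0 : tau 0 = 0.
Proof. by apply: hom_id; apply: (dsub0 dK). Qed.
Lemma homN x : L x -> tau (- x) = - tau x.
Proof.
move=> Lx; apply/eqP; rewrite -addr_eq0 -homD ?addNr ?hom0 //.
exact: (dsubN dL).
Qed.
Lemma homB x y : L x -> L y -> tau (x - y) = tau x - tau y.
Proof. by move=> Lx Ly; rewrite homD ?homN //; apply: (dsubN dL). Qed.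
Lemma hom_eq0 x : L x -> tau x = 0 -> x = 0.
Proof. by move=> Lx T0; apply: hom_inj => //; [exact: (dsub0 dL)|rewrite hom0]. Qed.
Lemma homV x : L x -> tau x^-1 = (tau x)^-1.
Proof.
move=> Lx; have [->|x0] := eqVneq x 0; first by rewrite invr0 hom0 invr0.
have Tx0 : tau x != 0 by apply: contraNneq x0 => /(hom_eq0 Lx) ->.
apply: (mulfI Tx0); rewrite -homM ?divff ?hom1 //; exact: (dsubV dL).
Qed.

Lemma hom_deval (e : nat -> A) t : (forall i, L (e i)) -> dterm_params K t ->
  tau (deval D e t) = deval D (tau \o e) t.
Proof.
move=> Le; have Lt u : dterm_params K u -> L (deval D e u).
  by move=> Ku; apply: deval_dsubfield.
elim: t => //=.
- by move=> c /hom_id.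
- by rewrite hom0.
- by rewrite hom1.
- by move=> t IHt u IHu [Kt Ku]; rewrite homD ?IHt ?IHu //; apply: Lt.
- by move=> t IHt Kt; rewrite homN ?IHt //; apply: Lt.
- by move=> t IHt u IHu [Kt Ku]; rewrite homM ?IHt ?IHu //; apply: Lt.
- by move=> t IHt Kt; rewrite hom_der ?IHt //; apply: Lt.
Qed.

Lemma img_dsubfield : is_dsubfield D (img tau L).
Proof.
rewrite /img; do !split.
- by exists 0; [exact: (dsub0 dL)|rewrite hom0].
- by exists 1; [exact: (dsub1 dL)|rewrite hom1].
- by move=> _ _ [x Lx ->] [y Ly ->]; exists (x - y); rewrite ?homB //; apply: (dsubB dL).
- by move=> _ _ [x Lx ->] [y Ly ->]; exists (x * y); rewrite ?homM //; apply: (dsubM dL).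
- by move=> _ [x Lx ->]; exists x^-1; rewrite ?homV //; apply: (dsubV dL).
- by move=> _ [x Lx ->]; exists (D x); rewrite ?hom_der //; apply: (dsubd dL).
Qed.

Hypothesis tau_const : forall c, consts D L c -> tau c = c.

Let H x y := L x /\ y = tau x.
Let H' y x := L x /\ y = tau x.

Lemma hom_graph : diff_graph D L H.
Proof.
rewrite /H; split.
- by move=> q Cq; split; [case: Cq|rewrite tau_const].
- by move=> x _ x' _ [Lx ->] [Lx' ->]; split; [exact: (dsubB dL)|rewrite homB].
- by move=> x _ x' _ [Lx ->] [Lx' ->]; split; [exact: (dsubM dL)|rewrite homM].
- by move=> x y [Lx ->]; split; [exact: (dsubd dL)|rewrite hom_der].
- by move=> x y [].
- by move=> y [_ ->]; exact: hom0.
Qed.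

(** A constant of the image is the image of a constant of [L], since [tau] commutes with [D] and is
    injective; so it is fixed. Linear disjointness over the image then makes the extension to the
    constants injective. *)
Lemma hom_graph_inv : diff_graph D (img tau L) H'.
Proof.
rewrite /H'; split.
- move=> _ [[x Lx ->] Dx].
  have Cx : consts D L x.
    by split=> //; apply: hom_eq0; [exact: (dsubd dL)|rewrite hom_der].
  by rewrite tau_const //; split=> //; rewrite tau_const.
- by move=> _ x _ x' [Lx ->] [Lx' ->]; split; [exact: (dsubB dL)|rewrite homB].
- by move=> _ x _ x' [Lx ->] [Lx' ->]; split; [exact: (dsubM dL)|rewrite homM].
- by move=> _ x [Lx ->]; split; [exact: (dsubd dL)|rewrite hom_der].
- by move=> _ x [Lx ->]; exists x.
- by move=> x [Lx /esym /hom_eq0]; apply.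
Qed.

Lemma const_ext_inv x y : const_ext D H x y -> const_ext D H' y x.
Proof. by elim=> [|l l' c r r' h Dc _ IH]; constructor. Qed.

Lemma frac_ext_inv x y : frac_ext D H x y -> frac_ext D H' y x.
Proof.
move=> [r [r' [q [q' [hr hq [q0 q0'] -> ->]]]]].
by exists r', r, q', q; split=> //; apply: const_ext_inv.
Qed.

(** For an embedding the premise of [frac_extV] always holds: if [y] is 0, the inverse graph forces
    [x] to be 0. *)
Lemma frac_ext_ofV x y : frac_ext D H x y -> frac_ext D H x^-1 y^-1.
Proof.
move=> h; apply: (frac_extV derD dL hom_graph) => //.
have [y0|] := eqVneq y 0; [right|by left].
by apply: (frac_ext_fun0 derD img_dsubfield hom_graph_inv); rewrite -y0; apply: frac_ext_inv.
Qed.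

Lemma frac_ext_total x : M x -> exists y, frac_ext D H x y.
Proof.
move=> Mx; apply: (Mx (fun x => exists y, frac_ext D H x y)); last first.
  move=> y [Ly|Cy]; last by exists y; apply: (frac_ext_const derD dL hom_graph).
  by exists (tau y); apply: (frac_ext_H derD dL hom_graph).
do !split.
- by exists 0; apply: (frac_ext_const derD dL hom_graph); exact: derD0.
- by exists 1; apply: (frac_ext_const derD dL hom_graph); exact: derD1.
- by move=> a b [a' ha] [b' hb]; exists (a' - b'); apply: (frac_extB derD dL hom_graph).
- by move=> a b [a' ha] [b' hb]; exists (a' * b'); apply: (frac_extM derD hom_graph).
- by move=> a [a' ha]; exists a'^-1; apply: frac_ext_ofV.
- by move=> a [a' ha]; exists (D a'); apply: (frac_ext_der derD dL hom_graph).
Qed.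

Lemma const_ext_img x y : const_ext D H x y -> dgen D (sunion (img tau L) (CA D)) y.
Proof.
have dG := dgen_dsubfield D (sunion (img tau L) (CA D)).
elim=> [|l l' c r r' [Ll ->] Dc _ IH]; first exact: (dsub0 dG).
apply: (dsubD dG) => //; apply: (dsubM dG); apply: dgen_incl; last by right.
by left; exists l.
Qed.

Lemma frac_ext_img x y : frac_ext D H x y -> dgen D (sunion (img tau L) (CA D)) y.
Proof.
have dG := dgen_dsubfield D (sunion (img tau L) (CA D)).
move=> [r [r' [q [q' [/const_ext_img hr /const_ext_img hq _ _ ->]]]]].
exact: (dsub_div dG).
Qed.

Lemma frac_ext_surj y : dgen D (sunion (img tau L) (CA D)) y ->
  exists2 x, M x & frac_ext D H x y.
Proof.
move=> My; apply: (My (fun y => exists2 x, M x & frac_ext D H x y)); last first.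
  move=> z [[x Lx ->]|Cy]; last first.
    by exists z; [exact: CA_M|apply: (frac_ext_const derD dL hom_graph)].
  by exists x; [exact: L_M|apply: (frac_ext_H derD dL hom_graph)].
have dM := M_dsubfield; do !split.
- exists 0; first exact: (dsub0 dM).
  by apply: (frac_ext_const derD dL hom_graph); exact: derD0.
- exists 1; first exact: (dsub1 dM).
  by apply: (frac_ext_const derD dL hom_graph); exact: derD1.
- move=> a b [a' Ma ha] [b' Mb hb]; exists (a' - b'); first exact: (dsubB dM).
  by apply: (frac_extB derD dL hom_graph).
- move=> a b [a' Ma ha] [b' Mb hb]; exists (a' * b'); first exact: (dsubM dM).
  by apply: (frac_extM derD hom_graph).
- move=> a [a' Ma ha]; exists a'^-1; first exact: (dsubV dM).
  exact: frac_ext_ofV.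
- move=> a [a' Ma ha]; exists (D a'); first exact: (dsubd dM).
  by apply: (frac_ext_der derD dL hom_graph).
Qed.

Hypothesis tau_img : forall x, M x <-> dgen D (sunion (img tau L) (CA D)) x.

(** On [M] the map is read off from [frac_ext], total and single-valued there; outside [M] its value
    is arbitrary. That its range is exactly [M] is the second half of strongness, [tau_img]. *)
Lemma gal_of_hom : exists sg, is_gal D K L sg /\ forall x, L x -> sg x = tau x.
Proof.
pose P x y := M x -> frac_ext D H x y.
have /choice [sg sgP] : forall x, exists y, P x y.
  move=> x; have [/frac_ext_total [y h]|nMx] := EM (M x); first by exists y.
  by exists x => /nMx.
have dM := M_dsubfield.
have sgE x y : M x -> frac_ext D H x y -> sg x = y.
  by move=> Mx; apply: (frac_ext_fun derD dL hom_graph); apply: sgP.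
exists sg; split; last first.
  move=> x Lx; apply: sgE; first exact: L_M.
  by apply: (frac_ext_H derD dL hom_graph).
do !split.
- by move=> x Mx; apply/tau_img; apply: frac_ext_img (sgP _ Mx).
- move=> y /tau_img /frac_ext_surj [x Mx h]; exists x => //; exact: sgE.
- move=> x y Mx My E.
  apply: (frac_ext_fun derD img_dsubfield hom_graph_inv (x := sg x)).
    exact: frac_ext_inv (sgP _ Mx).
  by rewrite E; exact: frac_ext_inv (sgP _ My).
- move=> x y Mx My; apply: sgE; first exact: (dsubD dM).
  by apply: (frac_extD derD hom_graph); apply: sgP.
- move=> x y Mx My; apply: sgE; first exact: (dsubM dM).
  by apply: (frac_extM derD hom_graph); apply: sgP.
- apply: sgE; first exact: (dsub1 dM).
  by apply: (frac_ext_const derD dL hom_graph); exact: derD1.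
- move=> x Mx; apply: sgE; first exact: (dsubd dM).
  by apply: (frac_ext_der derD dL hom_graph); apply: sgP.
- move=> x M0x; apply: sgE; first exact: M0_M.
  apply: (M0x (fun x => frac_ext D H x x)); last first.
    move=> y [Ky|Cy]; last by apply: (frac_ext_const derD dL hom_graph).
    apply: (frac_ext_H derD dL hom_graph); split; [exact: KL|by rewrite hom_id].
  do !split.
  + by apply: (frac_ext_const derD dL hom_graph); exact: derD0.
  + by apply: (frac_ext_const derD dL hom_graph); exact: derD1.
  + by move=> a b ha hb; apply: (frac_extB derD dL hom_graph).
  + by move=> a b ha hb; apply: (frac_extM derD hom_graph).
  + by move=> a ha; apply: frac_ext_ofV.
  + by move=> a ha; apply: (frac_ext_der derD dL hom_graph).
Qed.

End HomGraph.

Section GalHom.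
Variable sg : A -> A.
Hypothesis galS : is_gal D K L sg.

Lemma gal_M x : M x -> M (sg x).
Proof. by case: galS => H _; apply: H. Qed.
Lemma gal_surj y : M y -> exists2 x, M x & sg x = y.
Proof. by case: galS => _ [H _]; apply: H. Qed.
Lemma gal_inj x y : M x -> M y -> sg x = sg y -> x = y.
Proof. by case: galS => _ [_ [H _]]; apply: H. Qed.
Lemma galD x y : M x -> M y -> sg (x + y) = sg x + sg y.
Proof. by case: galS => _ [_ [_ [H _]]]; apply: H. Qed.
Lemma galM x y : M x -> M y -> sg (x * y) = sg x * sg y.
Proof. by case: galS => _ [_ [_ [_ [H _]]]]; apply: H. Qed.
Lemma gal1 : sg 1 = 1.
Proof. by case: galS => _ [_ [_ [_ [_ [H _]]]]]. Qed.
Lemma gal_der x : M x -> sg (D x) = D (sg x).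
Proof. by case: galS => _ [_ [_ [_ [_ [_ [H _]]]]]]; apply: H. Qed.
Lemma gal_id x : M0 x -> sg x = x.
Proof. by case: galS => _ [_ [_ [_ [_ [_ [_ H]]]]]]; apply: H. Qed.
Lemma gal_CA x : CA D x -> sg x = x.
Proof. by move=> Cx; apply: gal_id; apply: dgen_incl; right. Qed.
Lemma gal_K x : K x -> sg x = x.
Proof. by move=> Kx; apply: gal_id; apply: dgen_incl; left. Qed.
Lemma gal0 : sg 0 = 0.
Proof. by apply: gal_K; exact: (dsub0 dK). Qed.
Lemma galN x : M x -> sg (- x) = - sg x.
Proof.
move=> Mx; apply/eqP; rewrite -addr_eq0 -galD ?addNr ?gal0 //.
exact: (dsubN M_dsubfield).
Qed.
Lemma galV x : M x -> sg x^-1 = (sg x)^-1.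
Proof.
move=> Mx; have [->|x0] := eqVneq x 0; first by rewrite invr0 gal0 invr0.
have sx0 : sg x != 0.
  apply: contraNneq x0 => s0; apply/eqP; apply: gal_inj => //; last by rewrite gal0.
  exact: (dsub0 M_dsubfield).
apply: (mulfI sx0); rewrite -galM ?divff ?gal1 //; exact: (dsubV M_dsubfield).
Qed.

Lemma gal_hom : is_Hom D K L sg.
Proof.
do !split.
- by move=> x y /L_M Mx /L_M My; apply: galD.
- by move=> x y /L_M Mx /L_M My; apply: galM.
- exact: gal1.
- by move=> x /L_M Mx; apply: gal_der.
- by move=> x y /L_M Mx /L_M My; apply: gal_inj.
- exact: gal_K.
Qed.

End GalHom.

Lemma gal_det (sg sg' : A -> A) : is_gal D K L sg -> is_gal D K L sg' ->
  (forall x, L x -> sg x = sg' x) -> agree_on M sg sg'.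
Proof.
move=> gS gS' E x Mx; have dM := M_dsubfield.
pose F y := M y /\ sg y = sg' y.
suff : F x by case.
apply: (Mx F); last first.
  move=> y [Ly|Cy]; first by split; [exact: L_M|exact: E].
  by split; [exact: CA_M|rewrite (gal_CA gS Cy) (gal_CA gS' Cy)].
rewrite /F; do !split.
- exact: (dsub0 dM).
- by rewrite (gal0 gS) (gal0 gS').
- exact: (dsub1 dM).
- by rewrite (gal1 gS) (gal1 gS').
- by case: H H0 => [? _] [? _]; apply: (dsubB dM).
- case: H H0 => [Ma Ea] [Mb Eb].
  have MN : M (- y) by exact: (dsubN dM).
  by rewrite (galD gS) // (galD gS') // (galN gS) // (galN gS') // Ea Eb.
- by case: H H0 => [? _] [? _]; apply: (dsubM dM).
- case: H H0 => [Ma Ea] [Mb Eb].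
  by rewrite (galM gS) // (galM gS') // Ea Eb.
- by case: H => [? _]; apply: (dsubV dM).
- by case: H => [Ma Ea]; rewrite (galV gS) // (galV gS') // Ea.
- by case: H => [? _]; apply: (dsubd dM).
- by case: H => [Ma Ea]; rewrite (gal_der gS) // (gal_der gS') // Ea.
Qed.

Lemma gal_comp (sg sg' : A -> A) : is_gal D K L sg -> is_gal D K L sg' ->
  is_gal D K L (sg \o sg').
Proof.
move=> gS gS'; do !split => /=.
- by move=> x Mx; apply: (gal_M gS); apply: (gal_M gS').
- move=> y /(gal_surj gS) [z /(gal_surj gS') [x Mx <-] <-]; by exists x.
- move=> x y Mx My /(gal_inj gS) E; apply: (gal_inj gS') => //.
  by apply: E; apply: (gal_M gS').
- by move=> x y Mx My; rewrite (galD gS') // (galD gS) //; apply: (gal_M gS').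
- by move=> x y Mx My; rewrite (galM gS') // (galM gS) //; apply: (gal_M gS').
- by rewrite (gal1 gS') (gal1 gS).
- by move=> x Mx; rewrite (gal_der gS') // (gal_der gS) //; apply: (gal_M gS').
- by move=> x Mx; rewrite (gal_id gS') // (gal_id gS).
Qed.

End Extension.

(** * Uniform description of the embeddings *)

(** The offset [o] lets several combinations of the same [ms] read successive blocks of one
    coefficient sequence. *)
Fixpoint lincomb (A : fieldType) (ms : seq A) (c : nat -> A) (o : nat) : A :=
  if ms is m :: ms' then m * c o + lincomb ms' c o.+1 else 0.

Fixpoint lincomb_dterm (A : fieldType) (ms : seq A) (o : nat) : dterm A :=
  if ms is m :: ms' then DAdd (DMul (DConst m) (DVar A o)) (lincomb_dterm ms' o.+1)
  else DZero.

(** A solution supplied by [differentially_closed] is uncontrolled from index [n] on, while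
    [saturated_tuple] asks for 0 there; replacing those variables by 0 reconciles the two. *)
Fixpoint truncate (A : Type) (n : nat) (t : dterm A) : dterm A :=
  match t with
  | DVar i => if (i < n)%N then DVar A i else DZero
  | DConst c => DConst c | DZero => DZero | DOne => DOne
  | DAdd u v => DAdd (truncate n u) (truncate n v) | DOpp u => DOpp (truncate n u)
  | DMul u v => DMul (truncate n u) (truncate n v) | DDer u => DDer (truncate n u)
  end.

Lemma block_index_ltn (n N j i : nat) : (j <= n)%N -> (i < N)%N -> (j * N + i < n.+1 * N)%N.
Proof.
move=> jn iN; apply: (@leq_trans (j * N + N)); first by rewrite ltn_add2l.
by rewrite addnC -mulSn leq_mul2r ltnS jn orbT.
Qed.

Section Generators.
Variables (A : fieldType) (D : A -> A) (K L : A -> Prop) (s : seq A).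
Hypothesis derD : is_derivation D.
Hypothesis char0 : [pchar A] =i pred0.
Hypothesis dcl : differentially_closed D.
Hypothesis sat : saturated D.
Hypothesis dK : is_dsubfield D K.
Hypothesis dL : is_dsubfield D L.
Hypothesis KL : forall x, K x -> L x.
Hypothesis Lsmall : card_lt L (fun _ => True).
Hypothesis Lgen : forall x, L x <-> dgen D (sunion K (fun y => y \in s)) x.
Hypothesis strong : forall tau, is_Hom D K L tau -> is_strong D L tau.

Local Notation n := (size s).
Local Notation M := (dgen D (sunion L (CA D))).
Definition gen_env (i : nat) : A := nth 0 s i.
Local Notation ea := gen_env.

Lemma gen_env_L i : L (ea i).
Proof.
rewrite /gen_env; case: (ltnP i n) => [h|/(nth_default 0) ->]; last exact: (dsub0 dL).
by apply/Lgen; apply: dgen_incl; right; apply: mem_nth.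
Qed.

Lemma gen_deval_L t : dterm_params K t -> L (deval D ea t).
Proof. by apply: deval_dsubfield => //; exact: gen_env_L. Qed.

Lemma L_rep x : L x -> exists P Q, [/\ dterm_params K P, dterm_params K Q,
  deval D ea Q != 0 & x = deval D ea P / deval D ea Q].
Proof.
move=> /Lgen H.
apply: (H (fun x => exists P Q, [/\ dterm_params K P, dterm_params K Q,
  deval D ea Q != 0 & x = deval D ea P / deval D ea Q])); last first.
  move=> y [Ky|ys].
    by exists (DConst y), DOne; rewrite /= oner_neq0 divr1.
  exists (DVar A (index y s)), DOne; rewrite /= oner_neq0 divr1 /gen_env.
  by rewrite nth_index.
do !split.
- by exists DZero, DOne; rewrite /= oner_neq0 mul0r.
- by exists DOne, DOne; rewrite /= oner_neq0 divr1.
- move=> _ _ [P [Q [KP KQ Q0 ->]]] [P' [Q' [KP' KQ' Q0' ->]]].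
  exists (DAdd (DMul P Q') (DOpp (DMul P' Q))), (DMul Q Q').
  split=> //=; first by rewrite mulf_neq0.
  by rewrite -mulNr addf_div // mulNr.
- move=> _ _ [P [Q [KP KQ Q0 ->]]] [P' [Q' [KP' KQ' Q0' ->]]].
  exists (DMul P P'), (DMul Q Q').
  by split=> //=; rewrite ?mulf_neq0 ?mulf_div.
- move=> _ [P [Q [KP KQ Q0 ->]]].
  have [E|P0] := eqVneq (deval D ea P) 0.
    by exists DZero, DOne; rewrite E /= oner_neq0 !mul0r invr0.
  by exists Q, P; rewrite invf_div.
- move=> _ [P [Q [KP KQ Q0 ->]]].
  exists (DAdd (DMul (DDer P) Q) (DOpp (DMul P (DDer Q)))), (DMul Q Q).
  by split=> //=; rewrite ?mulf_neq0 // (derD_div derD) // expr2.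
Qed.

(** Elements of L are quotients of differential polynomials in the generators. The implication from
    [ea] to [eb] makes the map well defined; the converse keeps denominators nonzero and makes it
    injective. *)
Lemma hom_of_env (eb : nat -> A) :
  (forall t, dterm_params K t -> (deval D ea t = 0 <-> deval D eb t = 0)) ->
  exists tau, is_Hom D K L tau /\
    forall t, dterm_params K t -> tau (deval D ea t) = deval D eb t.
Proof.
move=> E.
have E0 t : dterm_params K t -> deval D ea t != 0 -> deval D eb t != 0.
  by move=> Kt; apply: contraNneq => /E ->.
pose R x y := L x -> exists P Q, [/\ dterm_params K P, dterm_params K Q,
  deval D ea Q != 0, x = deval D ea P / deval D ea Q & y = deval D eb P / deval D eb Q].
have /choice [tau tauP] : forall x, exists y, R x y.
  move=> x; have [/L_rep [P [Q [KP KQ Q0 ->]]]|nL] := EM (L x); last by exists 0 => /nL.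
  by exists (deval D eb P / deval D eb Q) => _; exists P, Q.
have tauE P Q : dterm_params K P -> dterm_params K Q -> deval D ea Q != 0 ->
    tau (deval D ea P / deval D ea Q) = deval D eb P / deval D eb Q.
  move=> KP KQ Q0.
  have [|P' [Q' [KP' KQ' Q0' + ->]]] := tauP (deval D ea P / deval D ea Q).
    by apply: (dsub_div dL); apply: gen_deval_L.
  move=> /eqP; rewrite eqr_div // => /eqP H.
  apply/eqP; rewrite eqr_div ?E0 //; apply/eqP.
  have /E : dterm_params K (DAdd (DMul P Q') (DOpp (DMul P' Q))) by [].
  rewrite /= => -[/(_ _)]; rewrite H subrr => /(_ erefl)/eqP.
  by rewrite subr_eq0 => /eqP ->.
have tauE1 t : dterm_params K t -> tau (deval D ea t) = deval D eb t.
  move=> Kt; have := @tauE t DOne Kt I.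
  by rewrite /= !divr1 => -> //; rewrite oner_neq0.
exists tau; split=> //; do !split.
- move=> _ _ /L_rep [P [Q [KP KQ Q0 ->]]] /L_rep [P' [Q' [KP' KQ' Q0' ->]]].
  rewrite !tauE // !addf_div ?E0 //.
  rewrite (tauE (DAdd (DMul P Q') (DMul P' Q)) (DMul Q Q')) //=.
  by rewrite mulf_neq0.
- move=> _ _ /L_rep [P [Q [KP KQ Q0 ->]]] /L_rep [P' [Q' [KP' KQ' Q0' ->]]].
  rewrite !tauE // !mulf_div ?E0 //.
  by rewrite (tauE (DMul P P') (DMul Q Q')) //= mulf_neq0.
- by rewrite (tauE1 DOne).
- move=> _ /L_rep [P [Q [KP KQ Q0 ->]]].
  rewrite tauE // !(derD_div derD) ?E0 // !expr2.
  rewrite (tauE (DAdd (DMul (DDer P) Q) (DOpp (DMul P (DDer Q)))) (DMul Q Q)) //=.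
  by rewrite mulf_neq0.
- move=> _ _ /L_rep [P [Q [KP KQ Q0 ->]]] /L_rep [P' [Q' [KP' KQ' Q0' ->]]].
  rewrite !tauE // => /eqP; rewrite eqr_div ?E0 // => /eqP H.
  apply/eqP; rewrite eqr_div //; apply/eqP.
  have /E : dterm_params K (DAdd (DMul P Q') (DOpp (DMul P' Q))) by [].
  rewrite /= => -[_]; rewrite H subrr => /(_ erefl)/eqP.
  by rewrite subr_eq0 => /eqP ->.
- by move=> x Kx; rewrite (tauE1 (DConst x)).
Qed.

Lemma hom_gen_deval tau t : is_Hom D K L tau -> dterm_params K t ->
  tau (deval D ea t) = deval D (tau \o ea) t.
Proof. by move=> hT; apply: (hom_deval dK dL KL) => //; exact: gen_env_L. Qed.

Lemma hom_gen_eq0 tau t : is_Hom D K L tau -> dterm_params K t ->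
  deval D ea t = 0 <-> deval D (tau \o ea) t = 0.
Proof.
move=> hT Kt; rewrite -hom_gen_deval //; split=> [->|]; first exact: (hom0 dK hT).
by apply: (hom_eq0 dK dL hT); apply: gen_deval_L.
Qed.

Lemma hom_gen_out tau i : is_Hom D K L tau -> (n <= i)%N -> tau (ea i) = 0.
Proof. by move=> hT h; rewrite /gen_env nth_default // (hom0 dK hT). Qed.

Lemma deval_truncate (e : nat -> A) k t :
  deval D e (truncate k t) = deval D (fun i => if (i < k)%N then e i else 0) t.
Proof.
elim: t => //= [i|u -> v ->|u ->|u -> v ->|u ->] //.
by case: ifP.
Qed.

Lemma const_in_K c : consts D L c -> K c.
Proof.
move=> [Lc Dc]; apply: contrapT => nKc.
have [B [DB [i1 [i2 [dB i1D i2D i12 i1c]]]]] := two_embeddings derD char0 dK nKc.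
have [P [Q [KP KQ Q0 cE]]] := L_rep Lc.
(* Here [c] is a parameter, so [dmap i1] sends it to [i1 c], whereas at [i2 \o ea] the quotient of
   [P] by [Q] has value [i2 c]. Hence [tc] does not vanish there; at the image of the generators
   under an embedding of L it vanishes exactly when [c] is fixed. *)
pose tc := DAdd P (DOpp (DMul (DConst c) Q)).
have i2E t : dterm_params K t ->
    deval DB (i2 \o ea) (dmap i1 t) = i2 (deval D ea t).
  elim: t => //= [_|_|u IHu v IHv [/IHu -> /IHv ->]|u IHu /IHu ->
    |u IHu v IHv [/IHu -> /IHv ->]|u IHu /IHu ->].
  - by rewrite rmorph0.
  - by rewrite rmorph1.
  - by rewrite rmorphD.
  - by rewrite rmorphN.
  - by rewrite rmorphM.
  - by rewrite i2D.
have i2E' t : deval DB (i2 \o ea) (dmap i1 (truncate n t)) = deval DB (i2 \o ea) (dmap i1 t).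
  elim: t => //= [i|u -> v ->|u ->|u -> v ->|u ->] //.
  by case: ltnP => //= h; rewrite /gen_env nth_default // rmorph0.
have tcB : deval DB (i2 \o ea) (dmap i1 tc) <> 0.
  rewrite /= !i2E // => /eqP; rewrite subr_eq0 => /eqP H; apply: i1c.
  have Q0' : i2 (deval D ea Q) != 0 by rewrite fmorph_eq0.
  by apply: (mulIf Q0'); rewrite -H -rmorphM cE divfK.
(* All equations and inequations of the generators over [K], together with [tc] nonzero. Each finite
   part holds in [B] at [i2 \o ea] and descends to [A] by differential closedness; saturation
   realizes the whole. *)
pose Sigma f := exists t, [\/ [/\ dterm_params K t, deval D ea t = 0 & f = DEq t DZero],
  [/\ dterm_params K t, deval D ea t <> 0 & f = DNot (DEq t DZero)] |
  t = tc /\ f = DNot (DEq t DZero)].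
have [|||e [e0 eS]] := @saturated_tuple A D L n Sigma char0 sat _ Lsmall.
- by move=> m; apply: (dsub_nat dL).
- have KLt t : dterm_params K t -> dterm_params L t.
    by elim: t => //= [u IHu v IHv [/IHu ? /IHv]|u IHu v IHv [/IHu ? /IHv]].
  move=> f [t [[Kt _ ->]|[Kt _ ->]|[-> ->]]] /=; split=> //; try exact: KLt.
  by split; [exact: KLt|split=> //; exact: KLt].
- move=> fs fsS.
  have [ps [qs [psB qsB H]]] : exists ps qs : seq (dterm A),
    [/\ all_list (fun p => deval DB (i2 \o ea) (dmap i1 p) = 0) ps,
        all_list (fun q => deval DB (i2 \o ea) (dmap i1 q) <> 0) qs &
     forall e, all_list (fun p => deval D e p = 0) ps ->
       all_list (fun q => deval D e q <> 0) qs ->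
       all_list (dholds D (fun i => if (i < n)%N then e i else 0)) fs].
    elim: fs fsS => [_|f fs IH [fS /IH [ps [qs [psB qsB H]]]]].
      by exists [::], [::].
    case: fS => t [[Kt t0 ->]|[Kt t0 ->]|[-> ->]].
    + exists (truncate n t :: ps), qs; split=> //=.
        by split=> //; rewrite i2E' i2E // t0 rmorph0.
      by move=> e [H1 H2] H3; split; [rewrite -deval_truncate|exact: H].
    + exists ps, (truncate n t :: qs); split=> //=.
        split=> //; rewrite i2E' i2E // => /eqP; rewrite fmorph_eq0 => /eqP; exact: t0.
      by move=> e H2 [H1 H3]; split; [rewrite -deval_truncate|exact: H].
    + exists ps, (truncate n tc :: qs); split=> //.
        by split=> //; rewrite i2E'.
      move=> e H2 [H1 H3]; split; last exact: H.
      by rewrite deval_truncate in H1.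
  have [e [He1 He2]] := dcl dB i1D (ex_intro _ _ (conj psB qsB)).
  exists (fun i => if (i < n)%N then e i else 0); split; last exact: H.
  by move=> i; rewrite leqNgt => /negPf ->.
have eE t : dterm_params K t -> (deval D ea t = 0 <-> deval D e t = 0).
  move=> Kt; split=> H.
    by apply: (eS (DEq t DZero)); exists t; constructor 1.
  apply: contrapT => nt.
  by apply: (eS (DNot (DEq t DZero))) => //; exists t; constructor 2.
have [tau [hT tauE]] := hom_of_env eE.
have tauc : tau c = c by case: (strong hT) => H _; apply: H.
have : deval D e tc <> 0 by apply: (eS (DNot (DEq tc DZero))); exists tc; constructor 3.
apply; rewrite /= -!tauE //; apply/eqP; rewrite subr_eq0; apply/eqP.
rewrite -[X in X * _]tauc -(homM hT) //; last exact: gen_deval_L.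
by congr (tau _); rewrite {1}cE divfK.
Qed.

Lemma lincomb_cat (ms ms' : seq A) c o :
  lincomb (ms ++ ms') c o = lincomb ms c o + lincomb ms' c (o + size ms)%N.
Proof.
elim: ms o => [|m ms IH] o /=; first by rewrite addn0 add0r.
by rewrite IH addrA addSnnS.
Qed.

Lemma lincomb_ext (ms : seq A) (c c' : nat -> A) o o' :
  (forall i, (i < size ms)%N -> c (o + i)%N = c' (o' + i)%N) ->
  lincomb ms c o = lincomb ms c' o'.
Proof.
elim: ms o o' => //= m ms IH o o' E.
have := E 0%N; rewrite !addn0 => -> //; congr (_ + _); apply: IH => i h.
by rewrite !addSnnS; apply: E.
Qed.

Lemma deval_lincomb e (ms : seq A) o : deval D e (lincomb_dterm ms o) = lincomb ms e o.
Proof. by elim: ms o => //= m ms IH o; rewrite IH. Qed.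

Definition cspan (ms : seq A) (x : A) : Prop :=
  exists c : nat -> A, (forall i, D (c i) = 0) /\ x = lincomb ms c 0.

Lemma cspan_catl ms ms' x : cspan ms x -> cspan (ms ++ ms') x.
Proof.
move=> [c [Dc ->]]; exists (fun i => if (i < size ms)%N then c i else 0); split.
  by move=> i; case: ifP => // _; exact: derD0.
rewrite lincomb_cat add0n.
have -> : lincomb ms' (fun i => if (i < size ms)%N then c i else 0) (size ms) = 0.
  move: (leqnn (size ms)); move: {2 4}(size ms) => o.
  elim: ms' o => //= m ms' IH o h.
  by rewrite ltnNge h /= mulr0 add0r IH // leqW.
by rewrite addr0; apply: lincomb_ext => i h; rewrite !add0n h.
Qed.

Lemma cspan_catr ms ms' x : cspan ms' x -> cspan (ms ++ ms') x.
Proof.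
move=> [c [Dc ->]]; exists (fun i => if (size ms <= i)%N then c (i - size ms)%N else 0).
split; first by move=> i; case: ifP => // _; exact: derD0.
rewrite lincomb_cat add0n.
have -> : lincomb ms (fun i => if (size ms <= i)%N then c (i - size ms)%N else 0) 0 = 0.
  have -> : lincomb ms (fun i => if (size ms <= i)%N then c (i - size ms)%N else 0) 0 =
     lincomb ms (fun _ => 0) 0.
    by apply: lincomb_ext => i h; rewrite add0n leqNgt h.
  by elim: ms 0%N => //= m ms IH o; rewrite mulr0 add0r.
by rewrite add0r; apply: lincomb_ext => i h; rewrite leq_addr addKn add0n.
Qed.

Definition gen_vals (ts : seq (dterm A)) : seq A := [seq deval D ea t | t <- ts].

(* [b] is the tuple of quotients of constant combinations of the [gen_vals ts],
   with one denominator in common, whose coefficients come last. *)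
Definition const_quot (ts : seq (dterm A)) (b : nat -> A) : Prop :=
  exists c : nat -> A, [/\ forall i, D (c i) = 0,
    lincomb (gen_vals ts) c (n * size ts) != 0 &
    forall j, (j < n)%N -> b j * lincomb (gen_vals ts) c (n * size ts) =
      lincomb (gen_vals ts) c (j * size ts)].

Lemma const_quotP ts b : const_quot ts b <-> exists q,
  [/\ q != 0, cspan (gen_vals ts) q & forall j, (j < n)%N -> cspan (gen_vals ts) (b j * q)].
Proof.
have sz : size (gen_vals ts) = size ts by rewrite size_map.
split=> [[c [Dc q0 H]]|[q [q0 Sq Sb]]].
  have sp o : cspan (gen_vals ts) (lincomb (gen_vals ts) c o).
    exists (fun i => c (o + i)%N); split=> //.
    by apply: lincomb_ext => i _; rewrite add0n.
  by eexists; split; [exact: q0|exact: sp|move=> j /H ->; exact: sp].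
have /choice [f fP] : forall j, exists c : nat -> A, (forall i, D (c i) = 0) /\
    ((j <= n)%N -> (if (j < n)%N then b j * q else q) = lincomb (gen_vals ts) c 0).
  move=> j; case: (ltnP j n) => [/Sb [c [Dc E]]|_]; first by exists c.
  by have [c [Dc E]] := Sq; exists c.
(* The [n.+1] coefficient sequences are laid end to end: block [j < n] holds a numerator, block [n]
   the common denominator. *)
pose c i := f (i %/ size ts)%N (i %% size ts)%N.
have cE j : lincomb (gen_vals ts) c (j * size ts) = lincomb (gen_vals ts) (f j) 0.
  apply: lincomb_ext => i; rewrite sz => h.
  have s0 : (0 < size ts)%N by apply: leq_ltn_trans h.
  by rewrite /c divnMDl // divn_small // addn0 modnMDl modn_small.
exists c; have E : lincomb (gen_vals ts) c (n * size ts) = q.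
  by rewrite cE; have [_ <-] := fP n; rewrite ?ltnn.
rewrite E; split=> //; first by move=> i; have [H _] := fP (i %/ size ts)%N; apply: H.
by move=> j jn; rewrite cE; have [_ <-] := fP j; rewrite ?jn // ltnW.
Qed.

Lemma const_quot_catl ts ts' b : const_quot ts b -> const_quot (ts ++ ts') b.
Proof.
move=> /const_quotP [q [q0 Sq Sb]]; apply/const_quotP; exists q; rewrite /gen_vals map_cat.
by split=> // [|j /Sb]; apply: cspan_catl.
Qed.

Lemma const_quot_catr ts ts' b : const_quot ts' b -> const_quot (ts ++ ts') b.
Proof.
move=> /const_quotP [q [q0 Sq Sb]]; apply/const_quotP; exists q; rewrite /gen_vals map_cat.
by split=> // [|j /Sb]; apply: cspan_catr.
Qed.

Lemma const_quot_ext ts b b' : (forall j, (j < n)%N -> b j = b' j) ->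
  const_quot ts b -> const_quot ts b'.
Proof. by move=> E [c [Dc q0 H]]; exists c; split=> // j jn; rewrite -E // H. Qed.

(** This is the specialization of K{a} at [eb], possibly not injective since only one implication is
    assumed. Constants of [L] belong to its domain because they lie in [K], hence are values of
    constant terms. *)
Lemma gen_dterm_graph (eb : nat -> A) :
  (forall c, consts D L c -> K c) ->
  (forall t, dterm_params K t -> deval D ea t = 0 -> deval D eb t = 0) ->
  diff_graph D L (fun x y => exists t, [/\ dterm_params K t, x = deval D ea t & y = deval D eb t]).
Proof.
move=> CLK E; split.
- by move=> q Cq; exists (DConst q); split=> //; exact: CLK.
- move=> _ _ _ _ [t [Kt -> ->]] [u [Ku -> ->]].
  by exists (DAdd t (DOpp u)).
- move=> _ _ _ _ [t [Kt -> ->]] [u [Ku -> ->]].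
  by exists (DMul t u).
- by move=> _ _ [t [Kt -> ->]]; exists (DDer t).
- by move=> _ _ [t [Kt -> _]]; apply: gen_deval_L.
- by move=> _ [t [Kt /esym t0 ->]]; apply: E.
Qed.

Let H0 := fun x y => exists t, [/\ dterm_params K t, x = deval D ea t & y = deval D ea t].
Let dgH0 : diff_graph D L H0 := gen_dterm_graph const_in_K (fun t _ h => h).

(** Since [H0] is the identity of K{a}, the conclusion says that [x] is a quotient of constant
    combinations of differential polynomials in the generators. *)
Lemma M_frac_ext x : M x -> frac_ext D H0 x x.
Proof.
have frV y : frac_ext D H0 y y -> frac_ext D H0 y^-1 y^-1.
  move=> h; apply: (frac_extV derD dL dgH0) => //.
  by case: (eqVneq y 0); [right|left].
move=> Mx; apply: (Mx (fun x => frac_ext D H0 x x)); last first.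
  move=> y [/L_rep [P [Q [KP KQ Q0 ->]]]|Cy]; last exact: (frac_ext_const derD dL dgH0).
  apply: (frac_extM derD dgH0); last apply: frV.
    by apply: (frac_ext_H derD dL dgH0); exists P.
  by apply: (frac_ext_H derD dL dgH0); exists Q.
do !split.
- by apply: (frac_ext_const derD dL dgH0); exact: derD0.
- by apply: (frac_ext_const derD dL dgH0); exact: derD1.
- by move=> a b ha hb; apply: (frac_extB derD dL dgH0).
- by move=> a b ha hb; apply: (frac_extM derD dgH0).
- by move=> a ha; apply: frV.
- by move=> a ha; apply: (frac_ext_der derD dL dgH0).
Qed.

Lemma const_ext_cspan x y : const_ext D H0 x y ->
  x = y /\ exists ts, all_list (dterm_params K) ts /\ cspan (gen_vals ts) x.
Proof.
elim=> [|_ _ c r r' [t [Kt -> ->]] Dc _ [<- [ts [Kts [d [Dd rE]]]]]].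
  by split=> //; exists [::]; split=> //; exists (fun _ => 0); split=> // _; exact: derD0.
split=> //; exists (t :: ts); split=> //.
exists (fun i => if i is i'.+1 then d i' else c); split; first by case.
by rewrite rE /=; congr (_ + _); apply: lincomb_ext.
Qed.

Lemma M_const_quot (x : nat -> A) : (forall j, (j < n)%N -> M (x j)) ->
  exists ts, all_list (dterm_params K) ts /\ const_quot ts x.
Proof.
move=> Mx.
(* A common denominator is obtained by multiplying the denominators of the coordinates. The two
   components of each pair coincide because [H0] is diagonal. *)
have hq k : (k <= n)%N -> exists q, [/\ q != 0, const_ext D H0 q q &
    forall j, (j < k)%N -> const_ext D H0 (x j * q) (x j * q)].
  elim: k => [_|k IH kn].
    exists 1; split=> //; first exact: oner_neq0.
    by have := const_ext1 (H11 derD dL dgH0) (derD1 derD); rewrite mulr1.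
  have [q [q0 hq hx]] := IH (ltnW kn).
  have [r [r' [w [w' [hr hw [w0 w0'] xr xr']]]]] := M_frac_ext (Mx k kn).
  have [rr' _] := const_ext_cspan hr; have [ww' _] := const_ext_cspan hw.
  rewrite -rr' -ww' in hr hw.
  exists (q * w); split; [by rewrite mulf_neq0|exact: (const_extM derD dgH0)|].
  move=> j; rewrite ltnS leq_eqVlt => /orP [/eqP ->|/hx h].
    have -> : x k * (q * w) = q * r by rewrite xr mulrCA divfK.
    exact: (const_extM derD dgH0).
  by rewrite mulrA; exact: (const_extM derD dgH0).
have [q [q0 {}hq hx]] := hq n (leqnn n).
have hts k : (k <= n)%N -> exists ts, [/\ all_list (dterm_params K) ts,
    cspan (gen_vals ts) q & forall j, (j < k)%N -> cspan (gen_vals ts) (x j * q)].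
  elim: k => [_|k IH kn].
    by have [_ [ts [Kts h]]] := const_ext_cspan hq; exists ts.
  have [ts [Kts Sq Sx]] := IH (ltnW kn).
  have [_ [us [Kus h]]] := const_ext_cspan (hx k kn).
  exists (ts ++ us); rewrite /gen_vals map_cat; split; first by apply/all_list_cat.
    exact: cspan_catl.
  move=> j; rewrite ltnS leq_eqVlt => /orP [/eqP ->|/Sx h'].
    exact: cspan_catr.
  exact: cspan_catl.
have [ts [Kts Sq Sx]] := hts n (leqnn n).
by exists ts; split=> //; apply/const_quotP; exists q.
Qed.

(** Variables below [n] hold the tuple; the next [n.+1 * N] hold the quantified coefficients,
    constrained to be constants. The values [gen_vals ts] enter as parameters, which is why the type
    using this formula is over [L]. *)
Definition const_quot_formula (ts : seq (dterm A)) : dformula A :=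
  let N := size ts in
  let q := lincomb_dterm (gen_vals ts) (n + n * N) in
  dex_list (iota n (n.+1 * N)) (dand_list
   ([seq DEq (DDer (DVar A i)) DZero | i <- iota n (n.+1 * N)] ++
    DNot (DEq q DZero) ::
    [seq DEq (DMul (DVar A j) q) (lincomb_dterm (gen_vals ts) (n + j * N)) | j <- iota 0 n])).

Lemma const_quot_formulaP ts e : (forall i, (n <= i)%N -> e i = 0) ->
  dholds D e (const_quot_formula ts) <-> const_quot ts e.
Proof.
have sz : size (gen_vals ts) = size ts by rewrite size_map.
have all_map (T : Type) (P : T -> Prop) (f : nat -> T) r :
    all_list P [seq f i | i <- r] <-> forall i, i \in r -> P (f i).
  elim: r => [|a r IH] /=; first by split.
  split=> [[Pa /IH Hr] i|Hr]; first by rewrite in_cons => /orP [/eqP ->|/Hr].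
  split; first by apply: Hr; rewrite mem_head.
  by apply/IH => i ir; apply: Hr; rewrite in_cons ir orbT.
move=> e0; rewrite /const_quot_formula dholds_ex_list; split.
  move=> [e' [E /dholds_and_list /all_list_cat [/all_map Hd [/= Hq /all_map Hj]]]].
  pose c i := if (i < n.+1 * size ts)%N then e' (n + i)%N else 0.
  have cE j : (j <= n)%N -> lincomb (gen_vals ts) c (j * size ts) =
      lincomb (gen_vals ts) e' (n + j * size ts).
    move=> jn; apply: lincomb_ext => i; rewrite sz => h.
    by rewrite /c addnA ifT //; apply: block_index_ltn.
  exists c; split.
  - move=> i; rewrite /c; case: ifP => h; last exact: derD0.
    by apply: (Hd (n + i)%N); rewrite mem_iota leq_addr ltn_add2l.
  - by rewrite cE //; apply/eqP; rewrite -deval_lincomb.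
  - move=> j jn; rewrite !cE // 1?ltnW // -!deval_lincomb.
    have := Hj j; rewrite /= mem_iota => /(_ jn) <-.
    by rewrite E // mem_iota negb_and -ltnNge jn.
move=> [c [Dc q0 Hj]].
pose e' i := if (i < n)%N then e i else if (i < n + n.+1 * size ts)%N then c (i - n)%N else 0.
have cE j : (j <= n)%N -> lincomb (gen_vals ts) e' (n + j * size ts) =
    lincomb (gen_vals ts) c (j * size ts).
  move=> jn; apply: lincomb_ext => i; rewrite sz => h.
  rewrite /e' -addnA ltnNge leq_addr /= ltn_add2l addKn ifT //.
  exact: block_index_ltn.
exists e'; split.
  move=> i; rewrite mem_iota negb_and -ltnNge -leqNgt /e' => /orP [->//|h].
  rewrite !ltnNge h (leq_trans (leq_addr _ _) h) /= e0 //.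
  exact: leq_trans (leq_addr _ _) h.
apply/dholds_and_list/all_list_cat; split.
  apply/all_map => i; rewrite mem_iota => /andP [ni iN] /=.
  by rewrite /e' ltnNge ni iN /= Dc.
split; first by rewrite /= deval_lincomb cE //; apply/eqP.
apply/all_map => j; rewrite mem_iota leq0n add0n /= => jn.
by rewrite !deval_lincomb !cE // 1?ltnW // {1}/e' jn Hj.
Qed.

(** If no list worked, then every finite set of lists would be escaped by one embedding, namely one
    escaping their concatenation. Saturation would give an embedding escaping all lists, although by
    strongness the images of the generators lie in [M] and [M_const_quot] provides a list for
    them. *)
Lemma const_quot_uniform : exists ts, all_list (dterm_params K) ts /\
  forall tau, is_Hom D K L tau -> const_quot ts (tau \o ea).
Proof.
apply: contrapT => nts.
have bad ts : all_list (dterm_params K) ts ->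
    exists tau, is_Hom D K L tau /\ ~ const_quot ts (tau \o ea).
  move=> Kts; apply: contrapT => nH; apply: nts; exists ts; split=> // tau hT.
  by apply: contrapT => nq; apply: nH; exists tau.
pose Sigma f := (exists t, [/\ dterm_params K t, deval D ea t = 0 & f = DEq t DZero]) \/
  (exists t, [/\ dterm_params K t, deval D ea t <> 0 & f = DNot (DEq t DZero)]) \/
  (exists ts, all_list (dterm_params K) ts /\ f = DNot (const_quot_formula ts)).
have tau_out tau : is_Hom D K L tau -> forall i, (n <= i)%N -> (tau \o ea) i = 0.
  by move=> hT i; apply: hom_gen_out.
have [|||e [e0 eS]] := @saturated_tuple A D L n Sigma char0 sat _ Lsmall.
- by move=> m; apply: (dsub_nat dL).
- have KLt t : dterm_params K t -> dterm_params L t.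
    by elim: t => //= [u IHu v IHv [/IHu ? /IHv]|u IHu v IHv [/IHu ? /IHv]].
  move=> f [[t [Kt _ ->]]|[[t [Kt _ ->]]|[ts [Kts ->]]]] /=.
  + by split=> //; exact: KLt.
  + by split=> //; exact: KLt.
  + have Lv o : dterm_params L (lincomb_dterm (gen_vals ts) o).
      elim: ts o Kts => //= t ts IH o [Kt Kts]; split; last exact: IH.
      by split=> //; exact: gen_deval_L.
    apply: dex_list_params; apply: dand_list_params; apply/all_list_cat; split.
      by move: (iota _ _) => r; elim: r.
    split; first by split.
    elim: (iota 0 n) => //= j r IH; split=> //.
- move=> fs fsS.
  have [ts [Kts H]] : exists ts, all_list (dterm_params K) ts /\
      forall tau, is_Hom D K L tau -> ~ const_quot ts (tau \o ea) ->
        all_list (dholds D (tau \o ea)) fs.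
    elim: fs fsS => [_|f fs IH [fS /IH [ts [Kts H]]]]; first by exists [::].
    case: fS => [[t [Kt t0 ->]]|[[t [Kt t0 ->]]|[us [Kus ->]]]].
    + exists ts; split=> // tau hT nq; split; last exact: H.
      by rewrite /=; apply/(hom_gen_eq0 hT).
    + exists ts; split=> // tau hT nq; split; last exact: H.
      by move=> /= /(hom_gen_eq0 hT Kt).
    + exists (us ++ ts); split; first by apply/all_list_cat.
      move=> tau hT nq; split.
        move=> /= /(const_quot_formulaP _ (tau_out _ hT)) h; apply: nq.
        exact: const_quot_catl.
      by apply: H => // h; apply: nq; exact: const_quot_catr.
  have [tau [hT nq]] := bad _ Kts.
  by exists (tau \o ea); split; [exact: tau_out|exact: H].
have eE t : dterm_params K t -> (deval D ea t = 0 <-> deval D e t = 0).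
  move=> Kt; split=> H.
    by apply: (eS (DEq t DZero)); left; exists t.
  apply: contrapT => nt.
  by apply: (eS (DNot (DEq t DZero))) => //; right; left; exists t.
have [tau [hT tauE]] := hom_of_env eE.
have [|ts [Kts hq]] := @M_const_quot (tau \o ea).
  move=> j jn; have [_ str] := strong hT; apply/str; apply: dgen_incl; left.
  by exists (ea j) => //; exact: gen_env_L.
apply: (eS (DNot (const_quot_formula ts))); first by right; right; exists ts.
apply/const_quot_formulaP => //; apply: const_quot_ext hq => j jn /=.
exact: (tauE (DVar A j)).
Qed.

End Generators.

(** * Finite subsystems of polynomial equations *)

Section Ideals.
Variable R : comNzRingType.

Definition rideal (J : R -> Prop) : Prop :=
  [/\ J 0, forall x y, J x -> J y -> J (x + y) & forall a x, J x -> J (a * x)].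

Definition idgen (P : R -> Prop) (x : R) : Prop :=
  forall J, rideal J -> (forall y, P y -> J y) -> J x.

Lemma idgen_rideal P : rideal (idgen P).
Proof.
split.
- by move=> J [J0 _ _] _.
- by move=> x y hx hy J hJ PJ; have [_ JD _] := hJ; apply: JD; [exact: hx|exact: hy].
- by move=> a x hx J hJ PJ; have [_ _ JM] := hJ; apply: JM; exact: hx.
Qed.

Lemma idgen_incl (P : R -> Prop) x : P x -> idgen P x.
Proof. by move=> Px J _; apply. Qed.

Lemma idgen_mono (P Q : R -> Prop) x : (forall y, P y -> Q y) -> idgen P x -> idgen Q x.
Proof. by move=> PQ h J hJ QJ; apply: h => // y /PQ /QJ. Qed.

Lemma rideal_sub (J : R -> Prop) x y : rideal J -> J x -> J y -> J (x - y).
Proof. by move=> [_ JD JM] Jx Jy; apply: JD => //; rewrite -mulN1r; apply: JM. Qed.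

Definition noetherian : Prop := forall J, rideal J ->
  exists S : seq R, (forall x, x \in S -> J x) /\ forall x, J x -> idgen (fun y => y \in S) x.

(** The generators must be taken from [P] itself, because they are to form a subsystem of given
    equations. Each element of the ideal already lies in the ideal of finitely many elements of
    [P]. *)
Lemma noetherian_subset (P : R -> Prop) : noetherian ->
  exists S : seq R, (forall x, x \in S -> P x) /\ forall x, P x -> idgen (fun y => y \in S) x.
Proof.
move=> nR; have [S0 [S0P genS0]] := nR _ (idgen_rideal P).
have fin x : idgen P x -> exists S : seq R, (forall x, x \in S -> P x) /\
    idgen (fun y => y \in S) x.
  move=> hx; apply: (hx (fun x => exists S : seq R, (forall x, x \in S -> P x) /\
    idgen (fun y => y \in S) x)); last first.
    move=> y Py; exists [:: y]; split; first by move=> z; rewrite inE => /eqP ->.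
    by apply: idgen_incl; rewrite mem_head.
  split.
  - by exists [::]; split=> //; case: (idgen_rideal (fun y => y \in [::])).
  - move=> y z [S [SP hy]] [S' [SP' hz]]; exists (S ++ S'); split.
      by move=> w; rewrite mem_cat => /orP [/SP|/SP'].
    have [_ h _] := idgen_rideal (fun y => y \in S ++ S'); apply: h.
      by apply: idgen_mono hy => w; rewrite mem_cat => ->.
    by apply: idgen_mono hz => w; rewrite mem_cat => ->; rewrite orbT.
  - move=> a y [S [SP hy]]; exists S; split=> //.
    by have [_ _ h] := idgen_rideal (fun y => y \in S); apply: h.
have [S [SP hS]] : exists S : seq R, (forall x, x \in S -> P x) /\
    forall x, x \in S0 -> idgen (fun y => y \in S) x.
  elim: S0 S0P {genS0} => [_|x S0 IH h]; first by exists [::].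
  have [|S [SP hS]] := IH; first by move=> y yS; apply: h; rewrite in_cons yS orbT.
  have [S' [SP' hS']] := fin x (h x (mem_head _ _)).
  exists (S' ++ S); split; first by move=> w; rewrite mem_cat => /orP [/SP'|/SP].
  move=> y; rewrite in_cons => /orP [/eqP ->|/hS].
    by apply: idgen_mono hS' => w; rewrite mem_cat => ->.
  by apply: idgen_mono => w; rewrite mem_cat => ->; rewrite orbT.
exists S; split=> // x Px; apply: (genS0 x (idgen_incl Px)) => //.
exact: idgen_rideal.
Qed.

End Ideals.

Lemma noetherian_field (F : fieldType) : noetherian F.
Proof.
move=> J [J0 JD JM]; have [[x [Jx x0]]|none] := EM (exists x, J x /\ x <> 0).
  exists [:: x]; split; first by move=> y; rewrite inE => /eqP ->.
  move=> y _; have [_ _ h] := idgen_rideal (fun y => y \in [:: x]).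
  by move/eqP: x0 => x0; rewrite -[y](divfK x0); apply: h; apply: idgen_incl; rewrite mem_head.
exists [::]; split=> // y Jy; have -> : y = 0 by apply: contrapT => y0; apply: none; exists y.
by case: (idgen_rideal (fun y : F => y \in [::])).
Qed.

(** Hilbert's basis theorem through the ideals [lc J d] of degree-[d] coefficients, which increase
    with [d]. A coefficient 0 is allowed in them, so they are ideals. *)
Lemma noetherian_poly (R : comNzRingType) : noetherian R -> noetherian {poly R}.
Proof.
move=> nR J hJ; have [J0 JD JM] := hJ.
have JZ (a : R) f : J f -> J (a *: f) by rewrite -mul_polyC; apply: JM.
pose lc (I : {poly R} -> Prop) d a := exists f : {poly R}, [/\ I f, (size f <= d.+1)%N & f`_d = a].
have lc_ideal (I : {poly R} -> Prop) d : rideal I -> rideal (lc I d).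
  move=> [I0 ID IM]; split.
  - by exists 0; rewrite size_poly0 coef0.
  - move=> _ _ [f [If sf <-]] [g [Ig sg <-]]; exists (f + g); split; first exact: ID.
      by rewrite (leq_trans (size_polyD _ _)) // geq_max sf.
    by rewrite coefD.
  - move=> a _ [f [If sf <-]]; exists (a *: f); split.
    + by rewrite -mul_polyC; apply: IM.
    + exact: leq_trans (size_scale_leq _ _) sf.
    + by rewrite coefZ.
have lc_shift (I : {poly R} -> Prop) d d' a : rideal I -> (d <= d')%N -> lc I d a -> lc I d' a.
  move=> [_ _ IM] dd' [f [If sf fa]]; exists ('X^(d' - d) * f); split; first exact: IM.
    rewrite mulrC; have [->|f0] := eqVneq f 0; first by rewrite mul0r size_poly0.
    by rewrite size_mulXn // -{2}(subnK dd') -addnS leq_add2l.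
  by rewrite mulrC coefMXn ltnNge leq_subr /= subKn.
pose gen (Fs : seq {poly R}) := idgen (fun f => f \in Fs).
have gen_mono Fs Fs' d a : {subset Fs <= Fs'} -> lc (gen Fs) d a -> lc (gen Fs') d a.
  by move=> sub [f [gf sf fa]]; exists f; split=> //; apply: idgen_mono gf.
have pick (Q : {poly R} -> nat -> R -> Prop) (S : seq R) :
    (forall a, a \in S -> exists f d, J f /\ Q f d a) ->
    exists (Fs : seq {poly R}) D, (forall f, f \in Fs -> J f) /\
      forall a, a \in S -> exists f d, [/\ f \in Fs, (d <= D)%N & Q f d a].
  elim: S => [_|a S IH h]; first by exists [::], 0%N.
  have [|Fs [D [FsJ H]]] := IH; first by move=> b bS; apply: h; rewrite in_cons bS orbT.
  have [f [d [Jf Qf]]] := h a (mem_head _ _).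
  exists (f :: Fs), (maxn d D); split.
    by move=> g; rewrite in_cons => /orP [/eqP ->|/FsJ].
  move=> b; rewrite in_cons => /orP [/eqP ->|/H [g [d' [gF d'D Qg]]]].
    by exists f, d; rewrite mem_head leq_maxl.
  by exists g, d'; rewrite in_cons gF orbT leq_max d'D orbT.
have step d : exists Fs : seq {poly R}, (forall f, f \in Fs -> J f) /\
    forall a, lc J d a -> lc (gen Fs) d a.
  have [S [SJ genS]] := nR _ (lc_ideal J d hJ).
  have [|Fs [D0 [FsJ H]]] := pick (fun f _ a => (size f <= d.+1)%N /\ f`_d = a) S.
    by move=> a /SJ [f [Jf sf fa]]; exists f, 0%N.
  exists Fs; split=> // a /genS h; apply: (h (lc (gen Fs) d)); first exact/lc_ideal/idgen_rideal.
  by move=> b /H [f [d' [fF _ [sf fb]]]]; exists f; split=> //; apply: idgen_incl.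
(* The union over all [d] is an ideal of [R], hence finitely generated. [D] bounds the degrees at
   which its generators occur, and above [D] multiplication by powers of the variable suffices; the
   finitely many smaller degrees are treated one by one. *)
have [Finf [D [FinfJ Hinf]]] : exists (Fs : seq {poly R}) D, (forall f, f \in Fs -> J f) /\
    forall d a, (D <= d)%N -> lc J d a -> lc (gen Fs) d a.
  have [|S [SJ genS]] := nR (fun a => exists d, lc J d a).
    split.
    - by exists 0%N; have [] := lc_ideal J 0%N hJ.
    - move=> a b [d ha] [d' hb]; exists (maxn d d').
      have [_ h _] := lc_ideal J (maxn d d') hJ; apply: h.
        exact: lc_shift (leq_maxl _ _) ha.
      exact: lc_shift (leq_maxr _ _) hb.
    - by move=> a b [d hb]; exists d; have [_ _ h] := lc_ideal J d hJ; apply: h.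
  have [|Fs [D [FsJ H]]] := pick (fun f d a => (size f <= d.+1)%N /\ f`_d = a) S.
    by move=> a /SJ [d [f [Jf sf fa]]]; exists f, d.
  exists Fs, D; split=> // d a Dd ha.
  apply: (genS a (ex_intro _ d ha) (lc (gen Fs) d)); first exact/lc_ideal/idgen_rideal.
  move=> b /H [f [d' [fF d'D [sf fb]]]].
  apply: lc_shift (leq_trans d'D Dd) _; first exact: idgen_rideal.
  by exists f; split=> //; apply: idgen_incl.
have [Fs [FsJ H]] : exists Fs : seq {poly R}, (forall f, f \in Fs -> J f) /\
    forall d a, lc J d a -> lc (gen Fs) d a.
  have [F0 [F0J H0]] : exists Fs : seq {poly R}, (forall f, f \in Fs -> J f) /\
    forall d a, (d < D)%N -> lc J d a -> lc (gen Fs) d a.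
    elim: (D) => [|k [Fs [FsJ H]]]; first by exists [::].
    have [Fk [FkJ Hk]] := step k.
    exists (Fs ++ Fk); split; first by move=> f; rewrite mem_cat => /orP [/FsJ|/FkJ].
    move=> d a; rewrite ltnS leq_eqVlt => /orP [/eqP ->|dk] h.
      by apply: gen_mono (Hk _ h) => f fF; rewrite mem_cat fF orbT.
    by apply: gen_mono (H _ _ dk h) => f fF; rewrite mem_cat fF.
  exists (F0 ++ Finf); split; first by move=> f; rewrite mem_cat => /orP [/F0J|/FinfJ].
  move=> d a h; case: (ltnP d D) => dD.
    by apply: gen_mono (H0 _ _ dD h) => f fF; rewrite mem_cat fF.
  by apply: gen_mono (Hinf _ _ dD h) => f fF; rewrite mem_cat fF orbT.
(* Induction on a bound for the size: an element generated by [Fs] with the same coefficient in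
   degree [m] is subtracted, which lowers the bound. *)
exists Fs; split=> // f Jf; move: (leqnn (size f)); move: {2}(size f) => m.
have [G0 GD GM] := idgen_rideal (fun f => f \in Fs).
elim: m f Jf => [|m IH] f Jf sf.
  by move: sf; rewrite leqn0 size_poly_eq0 => /eqP ->.
have [g [gg sg gm]] : lc (gen Fs) m f`_m by apply: H; exists f.
rewrite -(subrK g f); apply: GD => //; apply: IH.
  by apply: rideal_sub => //; apply: gg.
apply/leq_sizeP => j; rewrite leq_eqVlt coefB => /orP [/eqP <-|mj].
  by rewrite gm subrr.
by rewrite !nth_default ?subrr // (leq_trans _ mj).
Qed.

(** [R] is the [n]-fold iterated polynomial ring over [F] and [ev e] is evaluation at [e]. Only
    these evaluations are used later, so the iteration itself stays hidden. *)
Lemma polynomial_functions_ring (F : fieldType) n :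
  exists (R : comNzRingType) (ev : seq F -> {rmorphism R -> F}),
    [/\ noetherian R, forall a, exists r, forall e, ev e r = a &
      forall i, (i < n)%N -> exists r, forall e, ev e r = e`_i].
Proof.
elim: n => [|n [R [ev [nR evC evX]]]].
  exists F, (fun _ => (idfun : {rmorphism F -> F})); split=> //; first exact: noetherian_field.
  by move=> a; exists a.
have ev'D e : zmod_morphism (fun p : {poly R} => (map_poly (ev e) p).[e`_n]).
  by move=> p q; rewrite rmorphB hornerD hornerN.
have ev'M e : monoid_morphism (fun p : {poly R} => (map_poly (ev e) p).[e`_n]).
  by split=> [|p q]; [rewrite rmorph1 hornerC|rewrite rmorphM hornerM].
pose ev' e : {rmorphism {poly R} -> F} := HB.pack (fun p : {poly R} => (map_poly (ev e) p).[e`_n])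
  (GRing.isZmodMorphism.Build _ _ _ (ev'D e)) (GRing.isMonoidMorphism.Build _ _ _ (ev'M e)).
have ev'E e r : ev' e r%:P = ev e r by rewrite /= map_polyC hornerC.
exists ({poly R} : comNzRingType), ev'; split; first exact: noetherian_poly.
- by move=> a; have [r h] := evC a; exists r%:P => e; rewrite ev'E.
- move=> i; rewrite ltnS leq_eqVlt => /orP [/eqP ->|/evX [r h]].
    by exists 'X => e; rewrite /= map_polyX hornerX.
  by exists r%:P => e; rewrite ev'E.
Qed.

(** Terms accepted by [rterm_ok] contain no inverse, so each is an evaluation of an element of a
    noetherian ring. With [size e = n], variables from [n] on evaluate to 0. *)
Lemma finite_subsystem (F : fieldType) (n : nat) (P : F -> Prop) (T : GRing.term F -> Prop) :
  (forall t, T t -> rterm_ok P t) ->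
  exists ts, all_list T ts /\ forall e : seq F, size e = n ->
    all_list (fun t => GRing.eval e t = 0) ts -> forall t, T t -> GRing.eval e t = 0.
Proof.
move=> TP; have [R [ev [nR evC evX]]] := polynomial_functions_ring F n.
have tr t : rterm_ok P t -> exists r, forall e : seq F, size e = n -> ev e r = GRing.eval e t.
  elim: t => //=.
  - move=> i _; case: (ltnP i n) => [/evX [r h]|ni]; first by exists r => e _; exact: h.
    by exists 0 => e se; rewrite rmorph0 nth_default ?se.
  - by move=> c _; have [r h] := evC c; exists r => e _; exact: h.
  - by move=> k _; exists k%:R => e _; rewrite rmorph_nat.
  - move=> t IHt u IHu [/IHt [r h] /IHu [r' h']]; exists (r + r') => e se.
    by rewrite rmorphD h // h'.
  - by move=> t IHt /IHt [r h]; exists (- r) => e se; rewrite rmorphN h.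
  - by move=> t IHt k /IHt [r h]; exists (r *+ k) => e se; rewrite rmorphMn h.
  - move=> t IHt u IHu [/IHt [r h] /IHu [r' h']]; exists (r * r') => e se.
    by rewrite rmorphM h // h'.
  - by move=> t IHt k /IHt [r h]; exists (r ^+ k) => e se; rewrite rmorphXn h.
pose Q r := exists t, T t /\ forall e : seq F, size e = n -> ev e r = GRing.eval e t.
have [S [SQ genS]] := noetherian_subset Q nR.
have [ts [Tts H]] : exists ts, all_list T ts /\ forall e : seq F, size e = n ->
    all_list (fun t => GRing.eval e t = 0) ts -> forall r, r \in S -> ev e r = 0.
  elim: S SQ {genS} => [_|r S IH h]; first by exists [::].
  have [|ts [Tts H]] := IH; first by move=> r' r'S; apply: h; rewrite in_cons r'S orbT.
  have [t [Tt tE]] := h r (mem_head _ _).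
  exists (t :: ts); split=> // e se [t0 ts0] r'.
  by rewrite in_cons => /orP [/eqP ->|]; [rewrite tE|exact: H].
exists ts; split=> // e se ts0 t Tt.
have [r rE] := tr t (TP t Tt); rewrite -rE //.
apply: (genS r _ (fun r => ev e r = 0)); first by exists t.
  split; first by rewrite rmorph0.
    by move=> x y hx hy; rewrite rmorphD hx hy addr0.
  by move=> a x hx; rewrite rmorphM hx mulr0.
by move=> y yS; exact: (H e).
Qed.

(** * Definability in the constants *)

Section Definability.
Variables (A : fieldType) (D : A -> A) (L : A -> Prop).
Hypothesis derD : is_derivation D.
Hypothesis dL : is_dsubfield D L.

Local Notation CL := (consts D L).
Let dCL : is_dsubfield D CL := consts_dsubfield derD dL.
Let dCA : is_dsubfield D (CA D) := CA_dsubfield derD.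

(** Greedy choice of a basis of the span over the constants of [L]: [l N] either has coordinates in
    the vectors already chosen or is added to them. *)
Lemma constant_basis N (l : nat -> A) : (forall i, L (l i)) ->
  exists (r : nat) (b : nat -> A) (w : nat -> nat -> A),
  [/\ forall j, L (b j), forall j i, CL (w j i),
      forall i, (i < N)%N -> l i = \sum_(j < r) b j * w j i &
      forall q : nat -> A, (forall j, CL (q j)) -> \sum_(j < r) b j * q j = 0 ->
        forall j, (j < r)%N -> q j = 0].
Proof.
move=> Ll; elim: N => [|N [r [b [w [Lb Cw lE ind]]]]].
  by exists 0%N, (fun _ => 0), (fun _ _ => 0); split=> // *; [exact: (dsub0 dL)|exact: (dsub0 dCL)].
have [[q [Cq lN]]|nspan] := EM (exists q : nat -> A, (forall j, CL (q j)) /\ l N = \sum_(j < r) b j * q j).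
  exists r, b, (fun j i => if i == N then q j else w j i); split=> //.
    by move=> j i; case: ifP.
  move=> i; rewrite ltnS leq_eqVlt => /orP [/eqP ->|iN].
    by rewrite lN; apply: eq_bigr => j _; rewrite eqxx.
  by rewrite lE //; apply: eq_bigr => j _; rewrite ltn_eqF.
exists r.+1, (fun j => if j == r then l N else b j),
  (fun j i => if i == N then (j == r)%:R else if j == r then 0 else w j i); split.
- by move=> j; case: ifP.
- move=> j i; case: ifP => _; first exact: (dsub_nat dCL).
  by case: ifP => // _; exact: (dsub0 dCL).
- move=> i; rewrite ltnS big_ord_recr /= eqxx leq_eqVlt => /orP [/eqP ->|iN].
    rewrite eqxx mulr1 big1 ?add0r // => j _.
    by rewrite (ltn_eqF (ltn_ord j)) mulr0.
  rewrite (ltn_eqF iN) mulr0 addr0 lE //; apply: eq_bigr => j _.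
  by rewrite (ltn_eqF (ltn_ord j)).
- move=> q Cq; rewrite big_ord_recr /= eqxx => E.
  have E1 : \sum_(j < r) b j * q j + l N * q r = 0.
    rewrite -[RHS]E; congr (_ + _); apply: eq_bigr => j _.
    by rewrite (ltn_eqF (ltn_ord j)).
  have qr : q r = 0.
    apply: contrapT => /eqP qr; apply: nspan.
    exists (fun j => - (q j / q r)); split.
      by move=> j; apply/(dsubN dCL)/(dsub_div dCL).
    apply: (mulIf qr); move/eqP: E1; rewrite addrC addr_eq0 => /eqP ->.
    rewrite mulr_suml -sumrN; apply: eq_bigr => j _.
    by rewrite mulrN mulNr -mulrA divfK.
  move: E1; rewrite qr mulr0 addr0 => /(ind _ Cq) H j.
  by rewrite ltnS leq_eqVlt => /orP [/eqP ->|/H].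
Qed.

(** Expand the coefficients in a basis over the constants of [L]. By linear disjointness the basis
    stays independent over all constants of [A], so every coordinate vanishes separately. This is
    where parameters descend from [L] to its constants. *)
Lemma constant_linear_system N (l : nat -> A) : (forall i, L (l i)) ->
  exists (r : nat) (w : nat -> nat -> A), (forall j i, CL (w j i)) /\
    forall x : nat -> A, (forall i, D (x i) = 0) ->
      (\sum_(i < N) l i * x i = 0 <->
       forall j, (j < r)%N -> \sum_(i < N) w j i * x i = 0).
Proof.
move=> Ll; have [r [b [w [Lb Cw lE ind]]]] := constant_basis N Ll.
exists r, w; split=> // x Dx.
have E : \sum_(i < N) l i * x i = \sum_(j < r) b j * \sum_(i < N) w j i * x i.
  transitivity (\sum_(i < N) \sum_(j < r) b j * w j i * x i).
    by apply: eq_bigr => i _; rewrite lE // mulr_suml.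
  rewrite exchange_big /=; apply: eq_bigr => j _.
  by rewrite mulr_sumr; apply: eq_bigr => i _; rewrite mulrA.
rewrite E; split=> [H j jr|H]; last first.
  by rewrite big1 // => j _; rewrite H ?mulr0.
have [||k [d [q [Dd Cq yE qE]]]] :=
    @constant_relations A D derD L dL r b (fun j => \sum_(i < N) w j i * x i) _ _ H.
- by move=> *; exact: Lb.
- move=> j' _; apply: (dsub_sum dCA) => i _; apply: (dsubM dCA); last exact: Dx.
  by case: (Cw j' i).
rewrite yE // big1 // => m _.
by rewrite (ind (fun j => q j m)) ?mul0r.
Qed.

Definition const_seq (e : seq A) : Prop := forall a, a \in e -> CA D a.

Lemma const_seq_nth e i : const_seq e -> D e`_i = 0.
Proof.
move=> Ce; case: (ltnP i (size e)) => h; first by apply: Ce; apply: mem_nth.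
by rewrite nth_default // derD0.
Qed.

Lemma eval_const e t : const_seq e -> rterm_ok CL t -> D (GRing.eval e t) = 0.
Proof.
move=> Ce; elim: t => //=.
- by move=> i _; apply: const_seq_nth.
- by move=> c [].
- by move=> m _; apply: (dsub_nat dCA).
- by move=> t IHt u IHu [/IHt ? /IHu ?]; apply: (dsubD dCA).
- by move=> t IHt /IHt; apply: (dsubN dCA).
- by move=> t IHt m /IHt; apply: (dsub_muln dCA).
- by move=> t IHt u IHu [/IHt ? /IHu ?]; apply: (dsubM dCA).
- by move=> t IHt m /IHt; apply: (dsubX dCA).
Qed.

Implicit Type s : seq (A * GRing.term A).

(* A polynomial function with coefficients in [L] is stored as a list of products of an
   element of [L] and a polynomial over the constants of [L]. *)
Definition lin_eval s (e : seq A) : A := \sum_(p <- s) p.1 * GRing.eval e p.2.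

Definition lin_ok s : Prop := all_list (fun p => L p.1 /\ rterm_ok CL p.2) s.

Definition lpoly (F : seq A -> A) : Prop :=
  exists s, lin_ok s /\ forall e, const_seq e -> F e = lin_eval s e.

Lemma lpoly_const l : L l -> lpoly (fun _ => l).
Proof.
move=> Ll; exists [:: (l, GRing.NatConst A 1)]; split=> // e _.
by rewrite /lin_eval big_seq1 /= mulr1.
Qed.

Lemma lpoly_var i : lpoly (fun e => e`_i).
Proof.
exists [:: (1, GRing.Var A i)]; split; first by split=> //; split=> //; exact: (dsub1 dL).
by move=> e _; rewrite /lin_eval big_seq1 /= mul1r.
Qed.

Lemma lpolyD F G : lpoly F -> lpoly G -> lpoly (fun e => F e + G e).
Proof.
move=> [s [ks hs]] [t [kt ht]]; exists (s ++ t); split; first by apply/all_list_cat.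
by move=> e Ce; rewrite hs // ht // /lin_eval big_cat.
Qed.

Lemma lpolyM F G : lpoly F -> lpoly G -> lpoly (fun e => F e * G e).
Proof.
move=> [s [ks hs]] [t [kt ht]].
exists [seq (p.1 * q.1, GRing.Mul p.2 q.2) | p <- s, q <- t]; split.
  elim: s ks {hs} => //= p s IH [[Lp okp] /IH ks]; apply/all_list_cat; split=> //.
  elim: t kt {ht IH ks} => //= q t IH [[Lq okq] kt]; split; last exact: IH.
  by split=> //; exact: (dsubM dL).
move=> e Ce; rewrite hs // ht // /lin_eval big_allpairs_dep /= mulr_suml.
apply: eq_bigr => p _; rewrite mulr_sumr; apply: eq_bigr => q _ /=; ring.
Qed.

Lemma lpolyN F : lpoly F -> lpoly (fun e => - F e).
Proof.
move=> h; have [s [ks hs]] := lpolyM (lpoly_const (dsubN dL (dsub1 dL))) h.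
by exists s; split=> // e Ce; rewrite -hs // mulN1r.
Qed.

(** At constant arguments the polynomial factors are constants, so [D] acts only on the coefficients
    from [L]. *)
Lemma lpoly_der F : lpoly F -> lpoly (fun e => D (F e)).
Proof.
move=> [s [ks hs]]; exists [seq (D p.1, p.2) | p <- s]; split.
  elim: s ks {hs} => //= p s IH [[Lp okp] /IH ks]; split=> //.
  by split=> //; exact: (dsubd dL).
move=> e Ce; rewrite hs // /lin_eval big_map (derD_sum derD).
elim: s ks {hs} => [|p s IH] /=; first by rewrite !big_nil.
move=> [[_ okp] /IH ks]; rewrite !big_cons ks (derD_mul derD).
by rewrite (eval_const Ce okp) mulr0 addr0.
Qed.

Section Domain.
Variable X : seq A -> Prop.

(** [X] is a domain on which the denominator does not vanish; nothing is required of [F] outside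
    it. *)
Definition lrat (F : seq A -> A) : Prop :=
  exists G H, [/\ lpoly G, lpoly H &
    forall e, const_seq e -> X e -> H e != 0 /\ F e = G e / H e].

Lemma lrat_lpoly F : lpoly F -> lrat F.
Proof.
move=> h; exists F, (fun _ => 1); split=> //; first exact/lpoly_const/(dsub1 dL).
by move=> e _ _; rewrite oner_neq0 divr1.
Qed.

Lemma lrat_const l : L l -> lrat (fun _ => l).
Proof. by move=> Ll; apply/lrat_lpoly/lpoly_const. Qed.

Lemma lrat_var i : lrat (fun e => e`_i).
Proof. exact/lrat_lpoly/lpoly_var. Qed.

Lemma lrat_ext F F' : (forall e, const_seq e -> X e -> F e = F' e) -> lrat F -> lrat F'.
Proof.
move=> E [G [H [hG hH h]]]; exists G, H; split=> // e Ce Xe.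
by have [H0 FE] := h e Ce Xe; rewrite -E.
Qed.

Lemma lratD F F' : lrat F -> lrat F' -> lrat (fun e => F e + F' e).
Proof.
move=> [G [H [hG hH h]]] [G' [H' [hG' hH' h']]].
exists (fun e => G e * H' e + G' e * H e), (fun e => H e * H' e); split.
- by apply: lpolyD; apply: lpolyM.
- exact: lpolyM.
move=> e Ce Xe; have [H0 ->] := h e Ce Xe; have [H0' ->] := h' e Ce Xe.
by rewrite mulf_neq0 // addf_div.
Qed.

Lemma lratM F F' : lrat F -> lrat F' -> lrat (fun e => F e * F' e).
Proof.
move=> [G [H [hG hH h]]] [G' [H' [hG' hH' h']]].
exists (fun e => G e * G' e), (fun e => H e * H' e); split; try exact: lpolyM.
move=> e Ce Xe; have [H0 ->] := h e Ce Xe; have [H0' ->] := h' e Ce Xe.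
by rewrite mulf_neq0 // mulf_div.
Qed.

Lemma lratN F : lrat F -> lrat (fun e => - F e).
Proof.
move=> [G [H [hG hH h]]]; exists (fun e => - G e), H; split=> //; first exact: lpolyN.
by move=> e Ce Xe; have [H0 ->] := h e Ce Xe; rewrite mulNr.
Qed.

Lemma lratB F F' : lrat F -> lrat F' -> lrat (fun e => F e - F' e).
Proof. by move=> h h'; apply: lratD => //; apply: lratN. Qed.

Lemma lrat_der F : lrat F -> lrat (fun e => D (F e)).
Proof.
move=> [G [H [hG hH h]]].
exists (fun e => D (G e) * H e + - (G e * D (H e))), (fun e => H e * H e); split.
- apply: lpolyD; first by apply: lpolyM => //; apply: lpoly_der.
  by apply: lpolyN; apply: lpolyM => //; apply: lpoly_der.
- exact: lpolyM.
move=> e Ce Xe; have [H0 ->] := h e Ce Xe.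
by rewrite mulf_neq0 // (derD_div derD) // expr2.
Qed.

Lemma lrat_div F F' : lrat F -> lrat F' ->
  (forall e, const_seq e -> X e -> F' e != 0) -> lrat (fun e => F e / F' e).
Proof.
move=> hF [G [H [hG hH h]]] nz; apply: lratM => //; exists H, G; split=> // e Ce Xe.
have [H0 FE] := h e Ce Xe; have := nz e Ce Xe; rewrite FE mulf_eq0 negb_or => /andP [G0 _].
by rewrite invf_div.
Qed.

Lemma lrat_lincomb (fs : seq (seq A -> A)) (c : nat -> seq A -> A) o :
  all_list lrat fs -> (forall i, lrat (c i)) ->
  lrat (fun e => lincomb [seq f e | f <- fs] (c^~ e) o).
Proof.
move=> + hc; elim: fs o => /= [|f fs IH] o; first by move=> _; apply/lrat_const/(dsub0 dL).
by move=> [hf hfs]; apply: lratD; [apply: lratM|apply: IH].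
Qed.

Lemma lrat_deval (K : A -> Prop) (b : nat -> seq A -> A) t :
  (forall k, K k -> L k) -> (forall i, lrat (b i)) -> dterm_params K t ->
  lrat (fun e => deval D (b^~ e) t).
Proof.
move=> KL hb; elim: t => //=.
- by move=> c Kc; apply/lrat_const/KL.
- by move=> _; apply/lrat_const/(dsub0 dL).
- by move=> _; apply/lrat_const/(dsub1 dL).
- by move=> t IHt u IHu [/IHt ? /IHu ?]; apply: lratD.
- by move=> t IHt /IHt ?; apply: lratN.
- by move=> t IHt u IHu [/IHt ? /IHu ?]; apply: lratM.
- by move=> t IHt /IHt ?; apply: lrat_der.
Qed.

Definition qf_def (P : seq A -> Prop) : Prop :=
  exists f, qf_ring_formula CL f /\
    forall e, const_seq e -> X e -> (P e <-> GRing.holds e f).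

Lemma qf_def_true : qf_def (fun _ => True).
Proof. by exists (GRing.Bool true). Qed.

Lemma qf_def_and P Q : qf_def P -> qf_def Q -> qf_def (fun e => P e /\ Q e).
Proof.
move=> [f [kf hf]] [g [kg hg]]; exists (GRing.And f g); split=> // e Ce Xe /=.
by rewrite hf // hg.
Qed.

Lemma qf_def_not P : qf_def P -> qf_def (fun e => ~ P e).
Proof.
move=> [f [kf hf]]; exists (GRing.Not f); split=> // e Ce Xe /=.
by rewrite hf.
Qed.

Lemma qf_def_ext P Q : (forall e, const_seq e -> X e -> (P e <-> Q e)) -> qf_def P -> qf_def Q.
Proof.
move=> PQ [f [kf hf]]; exists f; split=> // e Ce Xe.
by rewrite -PQ // hf.
Qed.

Lemma qf_def_all n (P : nat -> seq A -> Prop) : (forall i, (i < n)%N -> qf_def (P i)) ->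
  qf_def (fun e => forall i, (i < n)%N -> P i e).
Proof.
elim: n => [_|n IH h]; first by apply: qf_def_ext qf_def_true.
apply: (@qf_def_ext (fun e => (forall i, (i < n)%N -> P i e) /\ P n e)); last first.
  by apply: qf_def_and; [apply: IH => i h'; apply: h; apply: ltnW|exact: h].
move=> e _ _; split=> [[H1 H2] i|H]; last by split=> [i h'|]; apply: H => //; apply: ltnW.
by rewrite ltnS leq_eqVlt => /orP [/eqP ->|/H1].
Qed.

Lemma qf_def_all_list (T : Type) (P : T -> seq A -> Prop) (r : seq T) :
  all_list (fun t => qf_def (P t)) r -> qf_def (fun e => all_list (P^~ e) r).
Proof.
elim: r => [_|t r IH [ht /IH hr]] /=; first exact: qf_def_true.
exact: qf_def_and.
Qed.

Lemma qf_def_lpoly F : lpoly F -> qf_def (fun e => F e = 0).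
Proof.
move=> [s [ks hs]]; pose p0 : A * GRing.term A := (0, GRing.NatConst A 0).
have Ll i : L (nth p0 s i).1.
  elim: s ks {hs} i => [_ i|p s IH [[Lp _] /IH ks] [|i]] //=.
  by rewrite nth_nil; exact: (dsub0 dL).
have okm i : rterm_ok CL (nth p0 s i).2.
  by elim: s ks {hs Ll} i => [_ i|p s IH [[_ okp] /IH ks] [|i]] //=; rewrite nth_nil.
have [r [w [Cw wE]]] := constant_linear_system (size s) Ll.
pose row j := foldr (fun i t => GRing.Add (GRing.Mul (GRing.Const (w j i)) (nth p0 s i).2) t)
  (GRing.NatConst A 0) (iota 0 (size s)).
have rowE j e : GRing.eval e (row j) =
    \sum_(i < size s) w j i * GRing.eval e (nth p0 s i).2.
  rewrite -(big_mkord xpredT (fun i => w j i * GRing.eval e (nth p0 s i).2)).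
  rewrite /row /index_iota subn0; elim: (iota 0 _) => [|i l IH] /=; first by rewrite big_nil.
  by rewrite big_cons IH.
have row_ok j : rterm_ok CL (row j).
  by rewrite /row; elim: (iota 0 _) => //= i l IH; split=> //; split=> //; exact: Cw.
have rowP j : qf_def (fun e => GRing.eval e (row j) = 0).
  by exists (GRing.Equal (row j) (GRing.NatConst A 0)).
apply: qf_def_ext (qf_def_all (fun j _ => rowP j) (n := r)) => e Ce _ /=.
rewrite hs // /lin_eval (big_nth p0) big_mkord.
rewrite (wE (fun i => GRing.eval e (nth p0 s i).2)); last by move=> i; apply: eval_const.
by split=> H j jr; have := H j jr; rewrite rowE.
Qed.

Lemma qf_def_lrat F : lrat F -> qf_def (fun e => F e = 0).
Proof.
move=> [G [H [hG hH h]]]; apply: qf_def_ext (qf_def_lpoly hG) => e Ce Xe.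
have [H0 ->] := h e Ce Xe; split=> [->|/eqP]; first by rewrite mul0r.
by rewrite mulf_eq0 invr_eq0 (negPf H0) orbF => /eqP.
Qed.

Lemma qf_def_lrat_neq0 F : lrat F -> qf_def (fun e => F e != 0).
Proof.
move=> /qf_def_lrat /qf_def_not; apply: qf_def_ext => e _ _.
by split=> [/eqP|/eqP].
Qed.

Lemma qf_def_lrat_eq F G : lrat F -> lrat G -> qf_def (fun e => F e = G e).
Proof.
move=> hF hG; apply: qf_def_ext (qf_def_lrat (lratB hF hG)) => e _ _.
by split=> [/eqP|->]; [rewrite subr_eq0 => /eqP|rewrite subrr].
Qed.

(** Hilbert's theorem is applied to the numerators, with coefficients still in [L]. The descent to
    the constants of [L] is made afterwards, separately for each of the finitely many remaining
    equations. *)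
Lemma qf_def_family (T : Type) (Q : T -> Prop) (F : T -> seq A -> A) n :
  (forall e, X e -> size e = n) -> (forall t, Q t -> lrat (F t)) ->
  qf_def (fun e => forall t, Q t -> F t e = 0).
Proof.
move=> Xn hF.
pose rt s : GRing.term A := foldr (fun p t => GRing.Add (GRing.Mul (GRing.Const p.1) p.2) t)
  (GRing.NatConst A 0) s.
have rtE s e : GRing.eval e (rt s) = lin_eval s e.
  rewrite /lin_eval; elim: s => [|p s IH] /=; first by rewrite big_nil.
  by rewrite big_cons IH.
have rt_ok s : lin_ok s -> rterm_ok L (rt s).
  have sub u : rterm_ok CL u -> rterm_ok L u.
    elim: u => //= [c [] //|u IHu v IHv [/IHu ? /IHv]|u IHu v IHv [/IHu ? /IHv]] //.
  by elim: s => //= p s IH [[Lp /sub okp] /IH]; split.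
pose T' u := exists t s, [/\ Q t, lin_ok s, u = rt s &
  forall e, const_seq e -> X e -> (F t e = 0 <-> lin_eval s e = 0)].
have [|ts [Tts H]] := @finite_subsystem A n L T'.
  by move=> _ [t [s [_ ks -> _]]]; apply: rt_ok.
have defT' : all_list (fun u => qf_def (fun e => GRing.eval e u = 0)) ts.
  apply: all_list_sub Tts => _ [t [s [_ ks -> _]]].
  by apply: qf_def_lpoly; exists s; split=> // e _; rewrite rtE.
apply: qf_def_ext (qf_def_all_list defT') => e Ce Xe; split=> [h t Qt|h].
  have [G [K [[s [ks hs]] hK FE]]] := hF t Qt.
  have sE e' : const_seq e' -> X e' -> (F t e' = 0 <-> lin_eval s e' = 0).
    move=> Ce' Xe'; have [K0 ->] := FE e' Ce' Xe'; rewrite -hs //.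
    split=> [/eqP|->]; last by rewrite mul0r.
    by rewrite mulf_eq0 invr_eq0 (negPf K0) orbF => /eqP.
  by apply/sE => //; rewrite -rtE; apply: H => //; [exact: Xn|exists t, s].
apply: all_list_sub Tts => _ [t [s [Qt _ -> E]]].
by rewrite rtE; apply/E => //; apply: h.
Qed.

End Domain.

(** Layering: [P] asserts that denominators do not vanish, and only under this assumption is [Q]
    expressible by rational functions. *)
Lemma qf_def_seq (X P Q : seq A -> Prop) : qf_def X P -> qf_def (fun e => X e /\ P e) Q ->
  qf_def X (fun e => P e /\ Q e).
Proof.
move=> [f [kf hf]] [g [kg hg]]; exists (GRing.And f g); split=> // e Ce Xe /=.
split=> [[Pe Qe]|[/hf Pe Qe]]; first by split; [exact/hf|apply/hg].
by have {}Pe := Pe Ce Xe; split=> //; apply/hg.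
Qed.

End Definability.

(** * The interpretation *)

Section Parametrization.
Variables (A : fieldType) (D : A -> A) (K L : A -> Prop) (s : seq A) (ts : seq (dterm A)).
Hypothesis derD : is_derivation D.
Hypothesis dK : is_dsubfield D K.
Hypothesis dL : is_dsubfield D L.
Hypothesis KL : forall x, K x -> L x.
Hypothesis Lgen : forall x, L x <-> dgen D (sunion K (fun y => y \in s)) x.
Hypothesis strong : forall tau, is_Hom D K L tau -> is_strong D L tau.
Hypothesis CK : forall c, consts D L c -> K c.
Hypothesis Kts : all_list (dterm_params K) ts.
Hypothesis tsP : forall tau, is_Hom D K L tau -> const_quot D s ts (tau \o gen_env s).

Local Notation n := (size s).
Local Notation N := (size ts).
Local Notation ea := (gen_env s).
Local Notation M := (dgen D (sunion L (CA D))).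

Definition block_size : nat := (n.+1 * N)%N.
Local Notation d0 := block_size.

Definition vals_at (b : nat -> A) : seq A := [seq deval D b t | t <- ts].
Definition num (b : nat -> A) (c : nat -> A) (j : nat) : A := lincomb (vals_at b) c (j * N).
Definition den (b : nat -> A) (c : nat -> A) : A := num b c n.

(* The candidate image of the generators with coefficients [c]. *)
Definition point (c : nat -> A) (j : nat) : A :=
  if (j < n)%N then num ea c j / den ea c else 0.

(** The single premise on [t] fits the index predicate of [qf_def_family]. Terms may mention
    variables from [n] on; there both [gen_env s] and [point c] are 0. *)
Definition point_ok (c : nat -> A) : Prop :=
  forall t, dterm_params K t /\ deval D ea t = 0 -> deval D (point c) t = 0.

(** Evaluating the terms [ts] at [point c] with coefficients [c'] is applying the map coded by [c]
    to [point c']. The condition says that the result is the tuple of generators, with denominators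
    cleared. *)
Definition inverts (c c' : nat -> A) : Prop :=
  den (point c) c' != 0 /\
  forall j, (j < n)%N -> num (point c) c' j = ea j * den (point c) c'.

(* [c] and [c'] are coefficients of an automorphism and of its inverse. *)
Definition gal_param (c c' : nat -> A) : Prop :=
  (den ea c != 0 /\ den ea c' != 0) /\
  ((point_ok c /\ point_ok c') /\ (inverts c c' /\ inverts c' c)).

Definition const_fun (c : nat -> A) : Prop := forall i, D (c i) = 0.

Lemma vals_at_ext b b' : b =1 b' -> vals_at b = vals_at b'.
Proof. by move=> E; apply: eq_map => t; apply: deval_ext. Qed.

Lemma num_ext b b' c c' j : b =1 b' -> (forall i, (i < d0)%N -> c i = c' i) -> (j <= n)%N ->
  num b c j = num b' c' j.
Proof.
move=> Eb Ec jn; rewrite /num (vals_at_ext Eb); apply: lincomb_ext => i.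
by rewrite size_map => iN; apply: Ec; apply: block_index_ltn.
Qed.

Lemma den_ext b b' c c' : b =1 b' -> (forall i, (i < d0)%N -> c i = c' i) ->
  den b c = den b' c'.
Proof. by move=> Eb Ec; apply: num_ext. Qed.

Lemma point_ext c c' : (forall i, (i < d0)%N -> c i = c' i) -> point c =1 point c'.
Proof.
move=> E j; rewrite /point; case: ifP => // jn.
by rewrite (num_ext (fun _ => erefl) E (ltnW jn)) (den_ext (fun _ => erefl) E).
Qed.

Lemma point_ok_ext c c' : (forall i, (i < d0)%N -> c i = c' i) -> point_ok c -> point_ok c'.
Proof.
move=> E H t Ht; rewrite -(H t Ht); apply: deval_ext => j.
by rewrite (point_ext E).
Qed.

Lemma inverts_ext c1 c2 c1' c2' : (forall i, (i < d0)%N -> c1 i = c1' i) ->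
  (forall i, (i < d0)%N -> c2 i = c2' i) -> inverts c1 c2 -> inverts c1' c2'.
Proof.
move=> E1 E2 [H1 H2]; rewrite /inverts -(den_ext (point_ext E1) E2); split=> // j jn.
by rewrite -(num_ext (point_ext E1) E2 (ltnW jn)) H2.
Qed.

Lemma gal_param_ext c1 c2 c1' c2' : (forall i, (i < d0)%N -> c1 i = c1' i) ->
  (forall i, (i < d0)%N -> c2 i = c2' i) -> gal_param c1 c2 -> gal_param c1' c2'.
Proof.
move=> E1 E2 [[q1 q2] [[p1 p2] [i1 i2]]]; split; last split.
- by rewrite -(den_ext (fun _ => erefl) E1) -(den_ext (fun _ => erefl) E2).
- by split; [exact: point_ok_ext p1|exact: point_ok_ext p2].
- by split; [exact: inverts_ext i1|exact: inverts_ext i2].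
Qed.

(* The specialization at [point c] maps [point c'] to the generators, so a relation
   satisfied by [point c'] is satisfied by the generators. *)
Lemma inverts_inj c c' : const_fun c' -> point_ok c -> den ea c' != 0 -> inverts c c' ->
  forall t, dterm_params K t -> deval D (point c') t = 0 -> deval D ea t = 0.
Proof.
move=> Dc' okc q0 [q0' inv] t Kt.
pose H x y := exists t, [/\ dterm_params K t, x = deval D ea t & y = deval D (point c) t].
have dgH : diff_graph D L H.
  by apply: (gen_dterm_graph dL KL Lgen CK) => u Ku u0; apply: okc.
have cext o : const_ext D H (lincomb (vals_at ea) c' o) (lincomb (vals_at (point c)) c' o).
  rewrite /vals_at; elim: ts o Kts => [|u us IH] o /=; first by move=> _; exact: ConstExt0.
  move=> [Ku Kus]; apply: ConstExtS; [by exists u|exact: Dc'|exact: IH].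
have fext i : frac_ext D H (point c' i) (ea i).
  rewrite /point; case: (ltnP i n) => jn; last first.
    rewrite /gen_env nth_default //; apply: (frac_ext_const derD dL dgH); exact: derD0.
  exists (num ea c' i), (num (point c) c' i), (den ea c'), (den (point c) c').
  split=> //; try exact: cext.
  by rewrite inv // mulfK.
have HK k : K k -> H k k by move=> Kk; exists (DConst k).
have := frac_ext_deval derD dL dgH HK fext Kt => h t0.
by apply: (frac_ext_fun0 derD dL dgH); rewrite -t0.
Qed.

(** The equations of the generators hold at [point c] by [point_ok c]. Conversely the specialization
    at [point c'] brings [point c] back to the generators, so no further equation holds there. *)
Lemma gal_of_param c c' : const_fun c -> const_fun c' -> gal_param c c' ->
  exists sg, is_gal D K L sg /\ forall j, sg (ea j) = point c j.
Proof.
move=> Dc Dc' [[q0 q0'] [[ok ok'] [inv inv']]].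
have [|tau [hT tauE]] := @hom_of_env A D K L s derD dL KL Lgen (point c).
  by move=> t Kt; split=> H; [exact: (ok t (conj Kt H))|exact: (inverts_inj Dc ok' q0 inv' Kt H)].
have [st1 st2] := strong hT.
have [sg [gS sgE]] := gal_of_hom derD dK dL KL hT st1 st2.
exists sg; split=> // j; rewrite sgE; last exact: (gen_env_L dL Lgen).
exact: (tauE (DVar A j)).
Qed.

Lemma gal_inverse sg : is_gal D K L sg -> exists sg', is_gal D K L sg' /\
  forall x, M x -> sg (sg' x) = x /\ sg' (sg x) = x.
Proof.
move=> gS; have dM := M_dsubfield D L.
have /choice [sg' h] : forall y, exists x, M y -> M x /\ sg x = y.
  move=> y; have [/(gal_surj gS) [x Mx E]|nMy] := EM (M y); first by exists x.
  by exists 0 => /nMy.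
have hM y : M y -> M (sg' y) by move=> /h [].
have hE y : M y -> sg (sg' y) = y by move=> /h [].
have hE' x y : M x -> M y -> sg x = y -> sg' y = x.
  by move=> Mx My E; apply: (gal_inj gS) => //; [exact: hM|rewrite hE].
exists sg'; split; last first.
  move=> x Mx; split; first exact: hE.
  by apply: hE' => //; apply: (gal_M gS).
do !split.
- exact: hM.
- by move=> x Mx; exists (sg x); [exact: (gal_M gS)|apply: hE' => //; apply: (gal_M gS)].
- by move=> x y Mx My E; rewrite -(hE x) // E hE.
- move=> x y Mx My; apply: hE'; [by apply: (dsubD dM); exact: hM|exact: (dsubD dM)|].
  by rewrite (galD gS) ?hE //; exact: hM.
- move=> x y Mx My; apply: hE'; [by apply: (dsubM dM); exact: hM|exact: (dsubM dM)|].
  by rewrite (galM gS) ?hE //; exact: hM.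
- by apply: hE'; [exact: (dsub1 dM)|exact: (dsub1 dM)|exact: (gal1 gS)].
- move=> x Mx; apply: hE'; [by apply: (dsubd dM); exact: hM|exact: (dsubd dM)|].
  by rewrite (gal_der gS) ?hE //; exact: hM.
- move=> x Mx; have Mx' := M0_M KL Mx; apply: hE' => //; exact: (gal_id gS).
Qed.

Lemma lincomb_M (ms : seq A) c o : (forall m, m \in ms -> L m) -> const_fun c ->
  M (lincomb ms c o).
Proof.
move=> + Dc; have dM := M_dsubfield D L; elim: ms o => /= [|m ms IH] o Lms; first exact: (dsub0 dM).
apply: (dsubD dM); last by apply: IH => m' h; apply: Lms; rewrite in_cons h orbT.
apply: (dsubM dM); last exact: CA_M.
by apply: L_M; apply: Lms; rewrite mem_head.
Qed.

Lemma gal_lincomb sg (ms : seq A) c o : is_gal D K L sg -> (forall m, m \in ms -> L m) ->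
  const_fun c -> sg (lincomb ms c o) = lincomb [seq sg m | m <- ms] c o.
Proof.
move=> gS + Dc; have dM := M_dsubfield D L; elim: ms o => /= [|m ms IH] o Lms.
  exact: (gal0 dK gS).
have Lms' m' : m' \in ms -> L m' by move=> h; apply: Lms; rewrite in_cons h orbT.
have Lm : L m by apply: Lms; rewrite mem_head.
have Mc : M (c o) by apply: CA_M; exact: Dc.
rewrite (galD gS); [|by apply: (dsubM dM) => //; exact: L_M|exact: lincomb_M].
rewrite (galM gS) //; last exact: L_M.
by rewrite (gal_CA gS (Dc o)) IH.
Qed.

Lemma vals_L m : m \in vals_at ea -> L m.
Proof.
rewrite /vals_at; elim: ts Kts => //= t us IH [Kt Kus].
rewrite in_cons => /orP [/eqP ->|/IH]; last exact.
exact: (gen_deval_L dL KL Lgen).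
Qed.

Lemma gal_num sg b c j : is_gal D K L sg -> (forall i, sg (ea i) = b i) -> const_fun c ->
  sg (num ea c j) = num b c j.
Proof.
move=> gS Eb Dc; rewrite /num (gal_lincomb _ gS vals_L Dc); congr (lincomb _ _ _).
rewrite /vals_at -map_comp; elim: ts Kts => //= t us IH [Kt Kus].
rewrite IH //; congr (_ :: _).
rewrite (hom_gen_deval dK dL KL Lgen (gal_hom gS) Kt).
exact: deval_ext.
Qed.

Lemma num_M c j : const_fun c -> M (num ea c j).
Proof. by move=> Dc; apply: lincomb_M => //; exact: vals_L. Qed.

Lemma gal_den_neq0 sg b c : is_gal D K L sg -> (forall i, sg (ea i) = b i) -> const_fun c ->
  den ea c != 0 -> den b c != 0.
Proof.
move=> gS Eb Dc q0; rewrite /den -(gal_num n gS Eb Dc); apply: contraNneq q0 => E.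
apply/eqP; apply: (gal_inj gS); rewrite ?(gal0 dK gS) //; first exact: num_M.
exact: (dsub0 (M_dsubfield D L)).
Qed.

Lemma gal_point sg b c j : is_gal D K L sg -> (forall i, sg (ea i) = b i) -> const_fun c ->
  (j < n)%N -> sg (point c j) = num b c j / den b c.
Proof.
move=> gS Eb Dc jn; have dM := M_dsubfield D L; have Mn k := num_M k Dc.
rewrite /point jn (galM gS) //; last by apply: (dsubV dM); exact: (Mn n).
by rewrite (galV dK gS) /den ?(gal_num _ gS Eb Dc) //.
Qed.

(** The uniform list [ts] gives coefficients for [sg] and for its inverse. Applying either
    automorphism to the point of the other returns the generators, which is [inverts] in both
    directions. *)
Lemma param_of_gal sg : is_gal D K L sg -> exists c c',
  [/\ const_fun c, const_fun c', gal_param c c' & forall j, sg (ea j) = point c j].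
Proof.
move=> gS; have [sg' [gS' sgK]] := gal_inverse gS.
have coeff f : is_gal D K L f -> exists c, [/\ const_fun c, den ea c != 0 &
    forall j, f (ea j) = point c j].
  move=> gF; have [c [Dc q0 H]] := tsP (gal_hom gF).
  exists c; split=> // j; rewrite /point; case: (ltnP j n) => jn.
    apply: (mulIf q0); rewrite divfK //; exact: H.
  by rewrite /gen_env nth_default // (gal0 dK gF).
have [c [Dc q0 cE]] := coeff _ gS; have [c' [Dc' q0' cE']] := coeff _ gS'.
have ok f b : is_gal D K L f -> const_fun b -> (forall j, f (ea j) = point b j) -> point_ok b.
  move=> gF Db bE t [Kt t0]; have := proj1 (hom_gen_eq0 dK dL KL Lgen (gal_hom gF) Kt) t0.
  by move=> <-; apply: deval_ext => j /=; rewrite bE.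
have inv f g b b' : is_gal D K L f -> is_gal D K L g -> const_fun b' ->
    den ea b' != 0 -> (forall j, f (ea j) = point b j) -> (forall j, g (ea j) = point b' j) ->
    (forall x, M x -> f (g x) = x) -> inverts b b'.
  move=> gF gG Db' q bE bE' fg; split; first exact: (gal_den_neq0 gF bE Db').
  move=> j jn; have Mj : M (ea j) by apply: L_M; exact: (gen_env_L dL Lgen).
  have := fg _ Mj; rewrite bE' (gal_point gF bE Db' jn) => <-.
  by rewrite divfK //; exact: (gal_den_neq0 gF bE Db').
exists c, c'; split=> //; split=> //; split; first by split; [exact: ok cE|exact: ok cE'].
split.
  by apply: inv cE cE' _ => // x /sgK [].
by apply: inv cE' cE _ => // x /sgK [].
Qed.

Lemma gal_eq_gen sg sg' : is_gal D K L sg -> is_gal D K L sg' ->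
  (agree_on M sg sg' <-> forall j, (j < n)%N -> sg (ea j) = sg' (ea j)).
Proof.
move=> gS gS'; split=> [H j _|H].
  by apply: H; apply: L_M; exact: (gen_env_L dL Lgen).
have H' j : sg (ea j) = sg' (ea j).
  case: (ltnP j n) => [/H //|h].
  by rewrite /gen_env nth_default // (gal0 dK gS) (gal0 dK gS').
apply: (gal_det dK gS gS') => x /(L_rep derD Lgen) [P [Q [KP KQ Q0 ->]]].
have hS := gal_hom gS; have hS' := gal_hom gS'.
have LP := gen_deval_L dL KL Lgen KP; have LQ := gen_deval_L dL KL Lgen KQ.
have LV := dsubV dL LQ.
rewrite (homM hS) // (homM hS') // (homV dK dL hS) // (homV dK dL hS') //.
rewrite !(hom_gen_deval dK dL KL Lgen hS) // !(hom_gen_deval dK dL KL Lgen hS') //.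
by congr (_ / _); apply: deval_ext.
Qed.

Section Formulas.
Local Notation lrat := (lrat D L).
Local Notation qf_def := (qf_def D L).

Definition block (o : nat) (e : seq A) (i : nat) : A := e`_(o + i).

Lemma lrat_block X o i : lrat X (fun e => block o e i).
Proof. exact: lrat_var. Qed.

Lemma lrat_num X (b : nat -> seq A -> A) o j : (forall i, lrat X (b i)) ->
  lrat X (fun e => num (b^~ e) (block o e) j).
Proof.
move=> hb; pose fs := [seq (fun e => deval D (b^~ e) t) | t <- ts].
apply: (@lrat_ext A D L X (fun e => lincomb [seq f e | f <- fs] (block o e) (j * N))).
  by move=> e _ _; rewrite /fs -map_comp.
apply: (@lrat_lincomb A D L dL X fs (fun i e => block o e i)); last first.
  by move=> i; exact: lrat_block.
rewrite /fs; elim: ts Kts => //= t us IH [Kt Kus]; split; last exact: IH.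
exact: (lrat_deval derD dL KL).
Qed.

Lemma lrat_gen X i : lrat X (fun _ => ea i).
Proof. by apply: lrat_const => //; exact: (gen_env_L dL Lgen). Qed.

Lemma lrat_num_gen X o j : lrat X (fun e => num ea (block o e) j).
Proof. by apply: (@lrat_num X (fun i _ => ea i)) => i; exact: lrat_gen. Qed.

Lemma lrat_point (X : seq A -> Prop) o j :
  (forall e, const_seq D e -> X e -> den ea (block o e) != 0) ->
  lrat X (fun e => point (block o e) j).
Proof.
move=> q0; rewrite /point; case: (j < n)%N; last by apply: lrat_const => //; exact: (dsub0 dL).
by apply: lrat_div => //; exact: lrat_num_gen.
Qed.

Lemma qf_def_point_ok (X : seq A -> Prop) k o : (forall e, X e -> size e = k) ->
  (forall e, const_seq D e -> X e -> den ea (block o e) != 0) ->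
  qf_def X (fun e => point_ok (block o e)).
Proof.
move=> Xk q0; rewrite /point_ok.
apply: (qf_def_family derD dL (F := fun t e => deval D (point (block o e)) t) Xk).
move=> t [Kt _]; apply: (@lrat_deval A D L derD dL X K (fun i e => point (block o e) i)) => //.
by move=> i; apply: lrat_point.
Qed.

Lemma qf_def_inverts (X : seq A -> Prop) o o' :
  (forall e, const_seq D e -> X e -> den ea (block o e) != 0) ->
  qf_def X (fun e => inverts (block o e) (block o' e)).
Proof.
move=> q0; have hn j : lrat X (fun e => num (point (block o e)) (block o' e) j).
  by apply: (@lrat_num X (fun i e => point (block o e) i)) => i; apply: lrat_point.
apply: qf_def_and; first by apply: qf_def_lrat_neq0 => //; exact: hn.
apply: qf_def_all => j _; apply: qf_def_lrat_eq => //.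
by apply: lratM => //; [exact: lrat_gen|exact: hn].
Qed.

Lemma qf_def_gal_param :
  qf_def (fun e => size e = (2 * d0)%N) (fun e => gal_param (block 0 e) (block d0 e)).
Proof.
rewrite /gal_param; apply: qf_def_seq.
  by apply: qf_def_and; apply: qf_def_lrat_neq0 => //; exact: lrat_num_gen.
have q1 e : const_seq D e -> size e = (2 * d0)%N /\
  (den ea (block 0 e) != 0 /\ den ea (block d0 e) != 0) -> den ea (block 0 e) != 0.
  by move=> _ [_ []].
have q2 e : const_seq D e -> size e = (2 * d0)%N /\
  (den ea (block 0 e) != 0 /\ den ea (block d0 e) != 0) -> den ea (block d0 e) != 0.
  by move=> _ [_ []].
apply: qf_def_and; apply: qf_def_and.
- by apply: (qf_def_point_ok (k := (2 * d0)%N)) q1 => e [].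
- by apply: (qf_def_point_ok (k := (2 * d0)%N)) q2 => e [].
- exact: qf_def_inverts.
- exact: qf_def_inverts.
Qed.

Lemma qf_def_gal_eq o o' :
  qf_def (fun e => den ea (block o e) != 0 /\ den ea (block o' e) != 0)
   (fun e => forall j, (j < n)%N -> point (block o e) j = point (block o' e) j).
Proof.
apply: qf_def_all => j _; apply: qf_def_lrat_eq => //.
  by apply: lrat_point => e _ [].
by apply: lrat_point => e _ [].
Qed.

(** The composite of the automorphisms coded at [o] and [o'], the second applied first, sends the
    generators to the quotients on the right: the outer map fixes the constants and moves the
    generators to its own point. *)
Lemma qf_def_gal_mul o o' o'' :
  qf_def (fun e => [/\ den ea (block o e) != 0, den (point (block o e)) (block o' e) != 0 &
                    den ea (block o'' e) != 0])
   (fun e => forall j, (j < n)%N -> point (block o'' e) j =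
      num (point (block o e)) (block o' e) j / den (point (block o e)) (block o' e)).
Proof.
set X := (X in qf_def X _).
have hn j : lrat X (fun e => num (point (block o e)) (block o' e) j).
  apply: (@lrat_num X (fun i e => point (block o e) i)) => i.
  by apply: lrat_point => e _ [].
apply: qf_def_all => j _; apply: qf_def_lrat_eq => //.
  by apply: lrat_point => e _ [].
apply: lrat_div => //; try exact: hn.
by move=> e _ [].
Qed.

End Formulas.

(** The inclusion of L is itself an embedding, so it has a nonzero denominator; with empty [ts]
    every denominator would be 0. *)
Lemma block_size_gt0 : (0 < d0)%N.
Proof.
have hid : is_Hom D K L id by do !split.
have [c [_ q0 _]] := tsP hid.
rewrite /block_size muln_gt0 /=; case: ts q0 => //=; by rewrite eqxx.
Qed.

Theorem gal_interpretation :
  exists (d : nat) (phiS phiE phiR : GRing.formula A) (gal : seq A -> A -> A),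
    let CK := consts D K in
    let inS := fun x : seq A =>
      [/\ size x = d, (forall a, a \in x -> CA D a) & GRing.holds x phiS] in
    let equiv := fun x y : seq A => GRing.holds (x ++ y) phiE in
    let Rel := fun x y z : seq A => GRing.holds (x ++ y ++ z) phiR in
    (((1 <= d)%N) /\
    (qf_ring_formula CK phiS) /\
    (qf_ring_formula CK phiE) /\
    (qf_ring_formula CK phiR) /\
    ((forall x, inS x -> is_gal D K L (gal x))) /\
    ((forall s, is_gal D K L s -> exists2 x, inS x & agree_on M (gal x) s)) /\
    ((forall x y, inS x -> inS y -> (equiv x y <-> agree_on M (gal x) (gal y)))) /\
    ((forall x y z, inS x -> inS y -> inS z ->
           (Rel x y z <-> agree_on M (gal z) (gal x \o gal y))))).
Proof.
(* The formulas have parameters among the constants of [L], which are constants of [K] by [CK]. *)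
have qfK f : qf_ring_formula (consts D L) f -> qf_ring_formula (consts D K) f.
  have CLK c : consts D L c -> consts D K c by move=> Cc; split; [exact: CK|case: Cc].
  have sub t : rterm_ok (consts D L) t -> rterm_ok (consts D K) t.
    by elim: t => //= [u IHu v IHv [/IHu ? /IHv]|u IHu v IHv [/IHu ? /IHv]].
  by elim: f => //= [u v [/sub ? /sub]|g IHg h IHh [/IHg ? /IHh]
    |g IHg h IHh [/IHg ? /IHh]|g IHg h IHh [/IHg ? /IHh]].
pose d := (2 * d0)%N.
have [fS [kS hS]] := qf_def_gal_param.
(* In a concatenation the codes start at 0, [d] and [d + d]. Only the first half of each code, the
   coefficients of the automorphism itself, enters equality and composition. *)
have [fE [kE hE]] := qf_def_gal_eq 0 d.
have [fR [kR hR]] := qf_def_gal_mul 0 d (d + d).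
have blk0 o (x y : seq A) i : (o + i < size x)%N -> block o (x ++ y) i = block o x i.
  by move=> h; rewrite /block nth_cat h.
have blkS o (x y : seq A) i : size x = d -> block (d + o) (x ++ y) i = block o y i.
  by move=> sx; rewrite /block nth_cat sx -addnA ltnNge leq_addr /= addKn.
have /choice [gal galP] : forall x, exists sg, const_seq D x ->
    gal_param (block 0 x) (block d0 x) ->
    is_gal D K L sg /\ forall j, sg (ea j) = point (block 0 x) j.
  move=> x; have [[Cx Px]|nP] := EM (const_seq D x /\ gal_param (block 0 x) (block d0 x)).
    have [||sg [gS sgE]] := gal_of_param _ _ Px; try by move=> i; apply: const_seq_nth.
    by exists sg.
  by exists id => Cx Px; case: nP.
exists d, fS, fE, fR, gal => /=.
have inSP x : [/\ size x = d, (forall a, a \in x -> CA D a) & GRing.holds x fS] ->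
    [/\ size x = d, const_seq D x & gal_param (block 0 x) (block d0 x)].
  by move=> [sx Cx hx]; split=> //; apply/hS.
have blkE (x y : seq A) i : size x = d -> (i < d0)%N -> block 0 (x ++ y) i = block 0 x i.
  by move=> sx h; apply: blk0; rewrite sx /d add0n mul2n -addnn (leq_trans h) // leq_addr.
have Ccat (x y : seq A) : const_seq D x -> const_seq D y -> const_seq D (x ++ y).
  by move=> Cx Cy a; rewrite mem_cat => /orP [/Cx|/Cy].
have Cblk x o : const_seq D x -> const_fun (block o x).
  by move=> Cx i; apply: const_seq_nth.
split; first by rewrite /d muln_gt0 block_size_gt0.
split; first exact: qfK.
split; first exact: qfK.
split; first exact: qfK.
split; first by move=> x /inSP [_ Cx Px]; case: (galP x Cx Px).
split.
  move=> sg gS; have [c [c' [Dc Dc' Pcc' sgE]]] := param_of_gal gS.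
  pose x := mkseq c d0 ++ mkseq c' d0.
  have sx : size x = d by rewrite size_cat !size_mkseq addnn -mul2n.
  have Cx : const_seq D x.
    by move=> a; rewrite mem_cat => /orP [] /mapP [i _ ->]; [exact: Dc|exact: Dc'].
  have E1 i : (i < d0)%N -> c i = block 0 x i.
    by move=> h; rewrite /block nth_cat size_mkseq add0n h nth_mkseq.
  have E2 i : (i < d0)%N -> c' i = block d0 x i.
    by move=> h; rewrite /block nth_cat size_mkseq ltnNge leq_addr /= addKn nth_mkseq.
  have Px := gal_param_ext E1 E2 Pcc'.
  exists x; first by split=> //; apply/hS.
  have [gx gxE] := galP x Cx Px.
  apply/gal_eq_gen => // j jn; rewrite gxE sgE.
  by rewrite (point_ext E1).
split.
  move=> x y /inSP [sx Cx Px] /inSP [sy Cy Py].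
  have [gx gxE] := galP x Cx Px; have [gy gyE] := galP y Cy Py.
  have E1 i : (i < d0)%N -> block 0 (x ++ y) i = block 0 x i by exact: blkE.
  have E2 i : (i < d0)%N -> block d (x ++ y) i = block 0 y i.
    by move=> _; rewrite -[d]addn0 blkS.
  rewrite -hE; [|exact: Ccat|]; last first.
    rewrite (den_ext (fun _ => erefl) E1) (den_ext (fun _ => erefl) E2).
    by case: Px => -[? _] _; case: Py => -[? _] _.
  rewrite gal_eq_gen //; split=> H j jn; have := H j jn;
    by rewrite gxE gyE (point_ext E1) (point_ext E2).
move=> x y z /inSP [sx Cx Px] /inSP [sy Cy Py] /inSP [sz Cz Pz].
have [gx gxE] := galP x Cx Px; have [gy gyE] := galP y Cy Py; have [gz gzE] := galP z Cz Pz.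
have E1 i : (i < d0)%N -> block 0 (x ++ y ++ z) i = block 0 x i by exact: blkE.
have E2 i : (i < d0)%N -> block d (x ++ y ++ z) i = block 0 y i.
  by move=> h; rewrite -[d]addn0 blkS // blkE.
have E3 i : (i < d0)%N -> block (d + d) (x ++ y ++ z) i = block 0 z i.
  by move=> h; rewrite blkS // -[d]addn0 blkS.
have q0 w : gal_param (block 0 w) (block d0 w) -> den ea (block 0 w) != 0 by case=> -[].
(* This denominator is the image under [gal x] of the nonzero denominator of [y], so the triple lies
   in the domain on which [fR] is meaningful. *)
have q1 : den (point (block 0 x)) (block 0 y) != 0.
  by apply: (gal_den_neq0 gx gxE); [exact: Cblk|exact: q0].
rewrite -hR; [|by apply: (Ccat x) => //; exact: Ccat|]; last first.
  rewrite (den_ext (fun _ => erefl) E1) (den_ext (point_ext E1) E2).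
  by rewrite (den_ext (fun _ => erefl) E3); split=> //; exact: q0.
rewrite gal_eq_gen //; last exact: gal_comp.
have Hj j : (j < n)%N -> (gal x \o gal y) (ea j) =
    num (point (block 0 (x ++ y ++ z))) (block d (x ++ y ++ z)) j /
    den (point (block 0 (x ++ y ++ z))) (block d (x ++ y ++ z)).
  move=> jn; rewrite /= gyE (gal_point gx gxE) //; last exact: Cblk.
  by rewrite -(num_ext (point_ext E1) E2 (ltnW jn)) -(den_ext (point_ext E1) E2).
by split=> H j jn; have := H j jn; rewrite Hj // gzE (point_ext E3).
Qed.

End Parametrization.

Theorem theorem3p14 (A : fieldType) (D : A -> A) (K L : A -> Prop) :
  is_derivation D ->
  [pchar A] =i pred0 ->
  differentially_closed D ->
  saturated D ->
  is_dsubfield D K -> is_dsubfield D L -> (forall x, K x -> L x) ->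
  card_lt L (fun _ => True) ->
  strongly_normal D K L ->
  exists (d : nat) (phiS phiE phiR : GRing.formula A) (gal : seq A -> A -> A),
    let CK := consts D K in
    let M := dgen D (sunion L (CA D)) in
    let inS := fun x : seq A =>
      [/\ size x = d, (forall a, a \in x -> CA D a) & GRing.holds x phiS] in
    let equiv := fun x y : seq A => GRing.holds (x ++ y) phiE in
    let Rel := fun x y z : seq A => GRing.holds (x ++ y ++ z) phiR in
    (((1 <= d)%N) /\
    (qf_ring_formula CK phiS) /\
    (qf_ring_formula CK phiE) /\
    (qf_ring_formula CK phiR) /\
    ((forall x, inS x -> is_gal D K L (gal x))) /\
    ((forall s, is_gal D K L s -> exists2 x, inS x & agree_on M (gal x) s)) /\
    ((forall x y, inS x -> inS y -> (equiv x y <-> agree_on M (gal x) (gal y)))) /\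
    ((forall x y z, inS x -> inS y -> inS z ->
           (Rel x y z <-> agree_on M (gal z) (gal x \o gal y))))).
Proof.
move=> derD char0 dcl sat dK dL KL Lsmall [[s Lgen] strong].
have CK := const_in_K derD char0 dcl sat dK dL KL Lsmall Lgen strong.
have [ts [Kts tsP]] :=
  const_quot_uniform derD char0 dcl sat dK dL KL Lsmall Lgen strong.
exact: (gal_interpretation derD dK dL KL Lgen strong CK Kts tsP).
Qed.
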